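(* Let $c\in\mathbb{C}$ with $\operatorname{Re}(c)>0$ and $\operatorname{Im}(c)\neq 0$, and let $H_c=-\frac{d^2}{dx^2}+cx^2$ be the complex harmonic oscillator acting in $L^2(\mathbb{R})$. Let $C_0>0$. Then $$\|(H_c-zI)^{-1}\|=O(|z|^{-1/3})$$ as $|z|\to+\infty$ with $z$ in the region $\{z\in\mathbb{C}:\operatorname{Re}(z)>0,\ |\operatorname{Im}(z)|\le C_0(\operatorname{Re}(z))^{1/3}\}$. That is, there exist constants $M>0$ and $R>0$ (depending on $c$ and $C_0$) such that every $z\in\mathbb{C}$ with $\operatorname{Re}(z)>0$, $|\operatorname{Im}(z)|\le C_0(\operatorname{Re}(z))^{1/3}$ and $|z|\ge R$ lies in the resolvent set of $H_c$ and satisfies $\|(H_c-zI)^{-1}\|\le M|z|^{-1/3}$.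
   Context: $H_c$ is the m-sectorial operator in $L^2(\mathbb{R})$ associated (via the representation theorem for closed sectorial forms) with the closed sectorial form $h_c(f,g)=\int_{\mathbb{R}}f'(x)\overline{g'(x)}\,dx+c\int_{\mathbb{R}}x^2f(x)\overline{g(x)}\,dx$ on the form domain $W^{1,2}(\mathbb{R})\cap\{f\in L^2(\mathbb{R}):\int_{\mathbb{R}}x^2|f(x)|^2dx<\infty\}$. The norm is the operator norm on $L^2(\mathbb{R})$, with the convention $\|(H_c-zI)^{-1}\|=\infty$ when $z$ is in the spectrum of $H_c$. *)

(* Defs.v *)
From mathcomp Require Import all_boot all_order all_algebra complex.
From mathcomp Require Import all_classical all_reals all_analysis.

Set Implicit Arguments.
Unset Strict Implicit.
Unset Printing Implicit Defensive.

Import Order.TTheory GRing.Theory Num.Theory.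
Import numFieldNormedType.Exports.
Import Normc.

Local Open Scope classical_set_scope.
Local Open Scope complex_scope.
Local Open Scope ring_scope.

Section L2_operators.
Context {R : realType}.
Local Notation C := R[i].
Local Notation mu := (@lebesgue_measure R).

Definition cintegral (f : R -> C) : C :=
  (\int[mu]_x complex.Re (f x)) +i* (\int[mu]_x complex.Im (f x)).

(* Elements of L^2(R; C) are represented by functions; two functions that
   agree almost everywhere represent the same element. *)
Definition L2 : set (R -> C) :=
  [set f : R -> C |
    [/\ measurable_fun setT (fun x : R => complex.Re (f x) : R),
        measurable_fun setT (fun x : R => complex.Im (f x) : R)
      & finite_norm mu 2%:E (fun x : R => normc (f x))]].

Definition L2norm (f : R -> C) : \bar R :=
  'N[mu]_2%:E[EFin \o (fun x : R => normc (f x))]%E.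

Definition L2inner (f g : R -> C) : C := cintegral (fun x : R => f x * (g x)^*).

Definition test_function : set (R -> R) :=
  [set phi : R -> R | (forall n x, derivable (derive1n n phi) x 1) /\
             compact (closure [set x | phi x != 0])].

Definition is_weak_derivative (f f' : R -> C) : Prop :=
  forall phi, test_function phi ->
    cintegral (fun x : R => f x * (derive1 phi x)%:C) =
    - cintegral (fun x : R => f' x * (phi x)%:C).

Definition W12 : set (R -> C) :=
  [set f : R -> C | L2 f /\ exists2 f', L2 f' & is_weak_derivative f f'].

(* The L^2 weak derivative, unique up to a null set when f is in W12. *)
Definition weak_derive (f : R -> C) : R -> C :=
  xget (fun=> 0) [set f' : R -> C | L2 f' /\ is_weak_derivative f f'].

(* Unbounded operators in L^2 are given by their graphs, which are compatible
   with almost everywhere equality: A u w means u \in dom A and A u = w. *)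
Definition L2_operator := (R -> C) -> (R -> C) -> Prop.

(* The operator given by the first representation theorem for a densely
   defined closed sectorial form h with domain D: u \in dom A and A u = w iff
   u \in D and h(u, g) = <w, g> for all g \in D. *)
Definition form_operator (D : set (R -> C)) (h : (R -> C) -> (R -> C) -> C) :
    L2_operator :=
  fun u w => [/\ D u, L2 w & forall g, D g -> h u g = L2inner w g].

(* (A - z) u = v *)
Definition shifted (A : L2_operator) (z : C) : L2_operator :=
  fun u v => A u (fun x : R => v x + z * u x).

(* A - z is a bijection from dom A onto L^2 with bounded inverse. *)
Definition resolvent_set (A : L2_operator) : set C :=
  [set z | [/\ forall v, L2 v -> exists u, shifted A z u v,
               forall u1 u2 v, shifted A z u1 v -> shifted A z u2 v ->
                 {ae mu, forall x, u1 x = u2 x}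
             & exists K : R, forall u v, shifted A z u v ->
                 (L2norm u <= K%:E * L2norm v)%E]].

(* The operator norm of (A - z)^-1, set to +oo on the spectrum. *)
Definition resolvent_norm (A : L2_operator) (z : C) : \bar R :=
  if `[< resolvent_set A z >] then
    ereal_sup [set L2norm u | u in
      [set u | exists v, (L2norm v <= 1)%E /\ shifted A z u v]]
  else +oo%E.

Definition oscillator_form_domain : set (R -> C) :=
  [set f : R -> C |
    W12 f /\ (\int[mu]_x (x ^+ 2 * normc (f x) ^+ 2)%:E < +oo)%E].

Definition oscillator_form (c : C) (f g : R -> C) : C :=
  cintegral (fun x : R => weak_derive f x * (weak_derive g x)^*) +
  c * cintegral (fun x : R => (x ^+ 2)%:C * f x * (g x)^*).

Definition complex_harmonic_oscillator (c : C) : L2_operator :=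
  form_operator oscillator_form_domain (oscillator_form c).

End L2_operators.

(* Main.v *)
Require Import Defs.
From mathcomp Require Import all_boot all_order all_algebra complex.
From mathcomp Require Import all_classical all_reals all_analysis.
From mathcomp Require Import measurable_realfun ring lra.

Set Implicit Arguments.
Unset Strict Implicit.
Unset Printing Implicit Defensive.

Import Order.TTheory GRing.Theory Num.Theory.
Import numFieldNormedType.Exports.

Local Open Scope classical_set_scope.
Local Open Scope ring_scope.

(** Let [c2 > 0]; the other sign follows by complex conjugation.
    Write [z = r + i eta] with [r = lam^6], [u = f + i k], and let
    [N = |u|^2], [m + i l = conj(u) u'].  For [s = 1] and [s = -1] the square
    [|u' + i s lam^3 u|^2 = |u'|^2 + r N + 2 s lam^3 l] measures a wave
    [exp(i s lam^3 x)], which is amplified at the rate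
    [s (c2 x^2 - eta) / lam^3].  Multiplied by the weight
    [exp(kap s y - y^2)], [y = x / lam], its logarithmic derivative has sign [s] and is
    at least of order [1 / lam], because [c2 y^2 - 2 s y + kap - eta / lam^2 >= 1]
    for [kap = C0 + 1 + 1 / c2].  Summing over both signs and integrating controls
    [u] where [|x|] is at most of order [lam]; elsewhere [c2 x^2 - eta] is
    positive and the identity [l' = (c2 x^2 - eta) N - Im(conj(u) v)] controls
    [N].  The result is [lam^2 ||u|| <= K ||(H_c - z) u||].

    Surjectivity of [H_c - z] holds when [c2 eta < 0], by the Lax-Milgram theorem
    for the form of [(eps - i c2) (H_c - z)], and is continued to every
    [|eta| <= C0 lam^2] by contractions along steps of length comparable to
    [lam^2], whose size is dictated by the a priori estimate. *)

(** * Integrals and primitives of real functions *)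

(** Take [c2 > 0]. When [eta > 0], the quantity [c2 x^2 - eta] changes sign and [z] may lie in the
    numerical range of [H_c], so no form bound for [H_c - z] is at hand. What saves the estimate is
    the scale: where [|x|] is of order [lam] the amplification rate is [lam^2 / lam^3 = 1 / lam], so
    a wave crossing this region grows by a bounded factor only. This is what [|eta| <= C0 r^(1/3)]
    ensures, and the crossing length [lam] over the frequency [lam^3] is the size
    [lam^-2 = r^(-1/3)] of the resolvent. A weight in [x / lam] with constants independent of [lam]
    compensates the growth; its Gaussian factor absorbs the polynomial coefficients. The terms with
    [c1] are smaller than the main one by [lam^-4], hence harmless for large [lam]. A second
    obstacle is that elements of [L^2] are functions known up to null sets and weak derivatives are
    arbitrary choices. Therefore norms are only semi-definite, weak derivatives are carried along
    with functions, and weak solutions are first replaced by locally absolutely continuous ones, on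
    which the flux identities can be integrated. *)

Section integrable_real_functions.
Context {R : realType}.
Local Notation mu := (@lebesgue_measure R).
Implicit Types (A : set R) (f g h : R -> R).

Local Notation intg A f := (mu.-integrable (A : set R) (EFin \o f)).

Lemma ae_imp (P Q : R -> Prop) : (forall x, P x -> Q x) ->
  {ae mu, forall x, P x} -> {ae mu, forall x, Q x}.
Proof. by move=> PQ; apply: (@filterS _ _ (ae_filter_ringOfSetsType mu)). Qed.

Lemma ae_imp2 (P Q S : R -> Prop) : (forall x, P x -> Q x -> S x) ->
  {ae mu, forall x, P x} -> {ae mu, forall x, Q x} -> {ae mu, forall x, S x}.
Proof. by move=> PQS; apply: (@filterS2 _ _ (ae_filter_ringOfSetsType mu)). Qed.

Lemma intg_measurable A f : intg A f -> measurable_fun A f.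
Proof. by move=> /integrableP[/measurable_EFinP]. Qed.

Lemma intgD A f g : measurable A ->
  intg A f -> intg A g -> intg A (fun x => f x + g x).
Proof. by move=> mA fi gi; exact: (@integrableD _ _ _ mu A mA (EFin \o f) (EFin \o g) fi gi). Qed.

Lemma intgB A f g : measurable A ->
  intg A f -> intg A g -> intg A (fun x => f x - g x).
Proof. by move=> mA fi gi; exact: (@integrableB _ _ _ mu A mA (EFin \o f) (EFin \o g) fi gi). Qed.

Lemma intgZ A (k : R) f : measurable A ->
  intg A f -> intg A (fun x => k * f x).
Proof. by move=> mA fi; exact: (@integrableZl _ _ _ mu A mA k (EFin \o f) fi). Qed.

Lemma intgS A B f : measurable A -> measurable B -> B `<=` A ->
  intg A f -> intg B f.
Proof. by move=> mA mB BA fi; exact: (@integrableS _ _ _ mu A B _ mA mB BA fi). Qed.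

Lemma intg_le A f g : measurable A -> measurable_fun A f -> intg A g ->
  (forall x, A x -> `|f x| <= g x) -> intg A f.
Proof.
move=> mA mf gi fg; apply: (@le_integrable _ _ _ mu A mA _ (EFin \o g) _ _ gi).
  exact/measurable_EFinP.
by move=> x Ax /=; rewrite lee_fin (le_trans (fg _ Ax))// ler_norm.
Qed.

Lemma intg_norm A f : measurable A -> intg A f -> intg A (fun x => `|f x|).
Proof.
move=> mA fi; apply: (@intg_le _ _ (fun x => `|f x|)) => //.
- apply: measurableT_comp => //; exact: intg_measurable fi.
- exact: (@integrable_norm _ _ _ mu A f fi).
- by move=> x _; rewrite normr_id.
Qed.

Lemma intg_bound A f g (K : R) : measurable A -> measurable_fun A f ->
  intg A g -> (forall x, A x -> `|f x| <= K) -> intg A (fun x => f x * g x).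
Proof.
move=> mA mf gi fK.
apply: (@intg_le _ _ (fun x => K * `|g x|)) => //.
- by apply: measurable_funM => //; exact: intg_measurable gi.
- by apply: intgZ => //; exact: intg_norm.
- by move=> x Ax; rewrite normrM ler_wpM2r// fK.
Qed.

Lemma eq_intg A f g : measurable A -> (forall x, A x -> f x = g x) ->
  intg A f -> intg A g.
Proof.
move=> mA fg; apply: (@eq_integrable _ _ _ mu A mA (EFin \o f)).
by move=> x; rewrite inE => Ax /=; rewrite fg.
Qed.

Lemma intg_restrict A f : measurable A -> intg A f <-> intg setT (f \_ A).
Proof.
move=> mA; by rewrite -restrict_EFin; exact: (@integrable_mkcond _ _ _ mu).
Qed.

Lemma intg_itv_bnd (a b : R) f (K : R) : measurable_fun `[a, b] f ->
  (forall x, a <= x <= b -> `|f x| <= K) -> intg `[a, b] f.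
Proof.
move=> mf fK.
apply: (@measurable_bounded_integrable _ _ _ mu) => //.
  by rewrite /= lebesgue_measure_itv/=; case: ifPn => _; rewrite -?EFinD ltry.
exists K; split; first exact: num_real.
by move=> M KM x /=; rewrite in_itv/= => /fK /le_trans -> //; exact: ltW.
Qed.

Lemma Rintegral_ae_eq A f g : measurable A -> measurable_fun A f ->
  measurable_fun A g ->
  {ae mu, forall x, f x = g x} -> \int[mu]_(x in A) f x = \int[mu]_(x in A) g x.
Proof.
move=> mA mf mg fg; congr fine; apply: (@ae_eq_integral _ _ _ mu) => //.
- exact/measurable_EFinP.
- exact/measurable_EFinP.
- by apply: ae_imp fg => x ->.
Qed.

Lemma intg_ae A f g : measurable A -> measurable_fun A g ->
  {ae mu, forall x, f x = g x} -> intg A f -> intg A g.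
Proof.
move=> mA mg fg fi; apply/integrableP; split; first exact/measurable_EFinP.
have := fi => /integrableP[mf]; congr (_ < _)%E.
apply: ae_eq_integral => //; first exact: measurableT_comp.
  by apply: measurableT_comp => //; exact/measurable_EFinP.
by apply: ae_imp fg => x /= ->.
Qed.

Lemma ae_zero_Rintegral0 A f : measurable A -> intg A f ->
  (forall x, A x -> 0 <= f x) -> \int[mu]_(x in A) f x = 0 ->
  {ae mu, forall x, A x -> f x = 0}.
Proof.
move=> mA fi f0 f00.
have mf := @measurable_int _ _ _ mu A _ fi.
have : (\int[mu]_(x in A) (`|(EFin \o f) x|))%E = 0%E.
  under eq_integral => x.
    rewrite inE => xA; rewrite gee0_abs /= ?lee_fin ?f0//; over.
  rewrite -[LHS]fineK; first by rewrite -/(Rintegral _ _ _) f00.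
  exact: (@integrable_fin_num _ _ _ mu).
move/(@ae_eq_integral_abs _ _ _ mu A mA (EFin \o f) mf).1; apply: ae_imp => x /= h Ax.
by have [] := h Ax.
Qed.

End integrable_real_functions.

(** * Integration over a triangle in two orders *)

Section triangle.
Context {R : realType}.
Local Notation mu := (@lebesgue_measure R).
Implicit Types (A : set R) (f g h : R -> R).
Local Notation intg A f := (mu.-integrable (A : set R) (EFin \o f)).

Lemma normr_Rintegral_le A f : measurable A -> intg setT f ->
  `|\int[mu]_(x in A) f x| <= \int[mu]_x `|f x|.
Proof.
move=> mA fi; have fAi : intg setT (f \_ A).
  by apply: (intg_restrict f mA).1; apply: intgS fi.
rewrite Rintegral_mkcond (le_trans (le_normr_Rintegral _ fAi))//.
apply: le_Rintegral => //; [exact: intg_norm|exact: intg_norm|move=> x _].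
by rewrite patchE; case: ifP; rewrite // normr0.
Qed.

(** Both sides are the integral of [f s * g t] over [s <= t]. This is the source of integration by
    parts when no pointwise derivative is available. *)
Lemma triangle_Fubini f g : intg setT f -> intg setT g ->
  let F s := f s * \int[mu]_(t in `[s, +oo[) g t in
  let G t := g t * \int[mu]_(s in `]-oo, t]) f s in
  [/\ intg setT F, intg setT G & \int[mu]_x F x = \int[mu]_x G x].
Proof.
move=> fi gi F G.
pose H (z : measurableTypeR R * measurableTypeR R) : \bar R :=
  (f z.1 * g z.2 * ((z.1 : R) <= (z.2 : R))%R%:R)%:E.
have mf : measurable_fun setT f by exact: intg_measurable fi.
have mg : measurable_fun setT g by exact: intg_measurable gi.
have mH : measurable_fun setT H.
  apply/measurable_EFinP/measurable_funM.
    by apply: measurable_funM; apply: measurableT_comp.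
  apply: (@measurableT_comp _ _ _ _ _ _ (fun b : bool => b%:R : R)) => //.
  exact: measurable_fun_ler.
have Hs s : (fun t => H (s, t)) = EFin \o (fun t => f s * (g \_ `[s, +oo[) t).
  apply/funext => t; rewrite /H /= patchE/= mem_setE in_itv/= andbT.
  by case: (s <= t); rewrite ?mulr1 ?mulr0.
have Ht t : (fun s => H (s, t)) = EFin \o (fun s => g t * (f \_ `]-oo, t]) s).
  apply/funext => s; rewrite /H /= patchE/= mem_setE in_itv/=.
  by case: (s <= t); rewrite ?mulr1 ?mulr0// mulrC.
have gsi s : intg setT (g \_ `[s, +oo[) by apply: (intg_restrict g _).1 => //; apply: intgS gi.
have fti t : intg setT (f \_ `]-oo, t]) by apply: (intg_restrict f _).1 => //; apply: intgS fi.
have iH : (mu \x mu)%E.-integrable setT H.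
  apply/(integrable12ltyP _ _ mH).
  have fin x : (\int[mu]_y `|H (x, y)| <= (`|f x| * \int[mu]_y `|g y|)%:E)%E.
    have : (\int[mu]_y `|H (x, y)| <= \int[mu]_y (`|f x| * `|g y|)%:E)%E.
      apply: ge0_le_integral => //.
      - apply: measurableT_comp => //; rewrite Hs; apply/measurable_EFinP.
        by apply: measurable_funM => //; exact: intg_measurable (gsi x).
      - apply/measurable_EFinP/measurable_funM => //.
        exact: measurableT_comp.
      - move=> y _; rewrite /H /= lee_fin !normrM.
        by rewrite ler_piMr ?mulr_ge0// normr_nat lern1 leq_b1.
    move=> /le_trans -> //.
    rewrite -RintegralZl//; last exact: intg_norm.
    rewrite fineK//; apply: (@integrable_fin_num _ _ _ mu) => //.
    by apply: intgZ => //; exact: intg_norm.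
  apply: (@le_lt_trans _ _ (\int[mu]_x (`|f x| * \int[mu]_y `|g y|)%:E)%E).
    apply: ge0_le_integral => //.
    - by move=> x _; exact: integral_ge0.
    - apply: (@measurable_fun_fubini_tonelli_F _ _ _ _ _ mu (fun z => `|H z|%E)) => //.
      exact: measurableT_comp.
    - apply/measurable_EFinP/measurable_funM => //.
      exact: measurableT_comp.
  have : intg setT (fun x => `|f x| * \int[mu]_y `|g y|).
    under eq_fun do rewrite mulrC.
    by apply: intgZ => //; exact: intg_norm.
  move=> /(@integrable_lty _ _ _ mu); exact.
have FE s : (F s)%:E = (\int[mu]_t H (s, t))%E.
  rewrite /F Rintegral_mkcond -RintegralZl//.
  rewrite fineK; last first.
    by apply: (@integrable_fin_num _ _ _ mu) => //; exact: intgZ.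
  by apply: eq_integral => t _; rewrite -[RHS]/((fun t => H (s, t)) t) Hs.
have GE t : (G t)%:E = (\int[mu]_s H (s, t))%E.
  rewrite /G Rintegral_mkcond -RintegralZl//.
  rewrite fineK; last first.
    by apply: (@integrable_fin_num _ _ _ mu) => //; exact: intgZ.
  by apply: eq_integral => s _; rewrite -[RHS]/((fun s => H (s, t)) s) Ht.
split.
- rewrite (_ : EFin \o F = fubini_F mu H); first exact: integrable_fubini_F.
  by apply/funext => s; exact: FE.
- apply: (@intg_le _ _ _ (fun t => \int[mu]_x `|f x| * `|g t|)) => //.
  + apply/measurable_EFinP.
    rewrite (_ : EFin \o G = fubini_G mu H);
      first exact: (@measurable_fubini_G _ _ _ _ _ mu mu H iH).
    by apply/funext => t; exact: GE.
  + by apply: intgZ => //; exact: intg_norm.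
  + move=> t _; rewrite /G normrM mulrC ler_wpM2r//.
    exact: normr_Rintegral_le.
- congr fine; transitivity (\int[mu]_s \int[mu]_t H (s, t))%E.
    by apply: eq_integral => s _; exact: FE.
  by rewrite Fubini//; apply: eq_integral => t _; rewrite GE.
Qed.
End triangle.

(** * Locally absolutely continuous functions *)

Section primitives.
Context {R : realType}.
Local Notation mu := (@lebesgue_measure R).
Implicit Types (A : set R) (f g h : R -> R) (a b : R).
Local Notation intg A f := (mu.-integrable (A : set R) (EFin \o f)).

(** Local absolute continuity, expressed by increments, so that [f'] matters only up to null sets.
    The derivative of a weak solution falls in this class and no better one, since its own
    derivative involves an arbitrary square-integrable right-hand side. *)
Definition primitive f f' := [/\ measurable_fun setT f',
  forall a b, intg `[a, b] f' &
  forall a b, a <= b -> f b - f a = \int[mu]_(x in `[a, b]) f' x].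

Lemma primitive_continuous f f' : primitive f f' -> continuous f.
Proof.
move=> [mf' fi ff'] x.
have xx : x - 1 <= x + 1 by lra.
have := @parameterized_integral_continuous R (x - 1) (x + 1) f' xx (fi _ _).
pose F y := parameterized_integral mu (x - 1) y f'.
move=> /continuous_within_itvP => /(_ ltac:(lra))[+ _ _].
move=> /(_ x); rewrite in_itv/= => /(_ ltac:(lra)) Fx.
have : {for x, continuous (fun y => f (x - 1) + F y)}.
  by apply: cvgD; [exact: cvg_cst|exact: Fx].
rewrite /prop_for /continuous_at.
have -> : f (x - 1) + F x = f x.
  by rewrite /F /parameterized_integral -ff' ?subrKC//; lra.
apply: cvg_trans; apply: near_eq_cvg; near=> y.
rewrite /F /parameterized_integral -ff' ?subrKC//.
near: y; exists 1 => //= t; rewrite /ball_/= ltr_norml => /andP[]; lra.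
Unshelve. all: by end_near. Qed.

Lemma continuous_bounded_itv f a b : continuous f ->
  exists2 K, 0 < K & forall x, a <= x <= b -> `|f x| <= K.
Proof.
move=> cf; have [ab|ba] := leP a b; last first.
  by exists 1 => // x /andP[ax xb]; have := le_lt_trans (le_trans ax xb) ba; rewrite ltxx.
have [M [_ MP]] : bounded_set (f @` `[a, b]).
  apply: compact_bounded; apply: continuous_compact; last exact: segment_compact.
  exact: continuous_subspaceT.
exists (`|M| + 1) => // x xab; apply: (MP (`|M| + 1)).
  by rewrite (le_lt_trans (ler_norm _))// ltrDl.
by exists x => //=; rewrite in_itv.
Qed.

Lemma intg_continuousM f g a b : continuous f -> intg `[a, b] g ->
  intg `[a, b] (fun x => f x * g x).
Proof.
move=> cf gi; have [K _ fK] := continuous_bounded_itv a b cf.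
apply: (@intg_bound _ _ _ _ K) => //.
by apply: measurable_funTS; exact: continuous_measurable_fun.
Qed.

Lemma eq_primitive f f' g g' : primitive f f' -> f =1 g -> f' =1 g' ->
  primitive g g'.
Proof. by move=> + /funext <- /funext <-. Qed.

Lemma primitiveD f f' g g' : primitive f f' -> primitive g g' ->
  primitive (fun x => f x + g x) (fun x => f' x + g' x).
Proof.
move=> [mf fi ff] [mg gi gg]; split.
- exact: measurable_funD.
- by move=> a b; apply: intgD.
- by move=> a b ab; rewrite RintegralD// -ff// -gg//; ring.
Qed.

Lemma primitiveZ (k : R) f f' : primitive f f' ->
  primitive (fun x => k * f x) (fun x => k * f' x).
Proof.
move=> [mf fi ff]; split.
- exact: measurable_funM.
- by move=> a b; apply: intgZ.
- by move=> a b ab; rewrite RintegralZl// -ff//; ring.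
Qed.

Lemma primitiveB f f' g g' : primitive f f' -> primitive g g' ->
  primitive (fun x => f x - g x) (fun x => f' x - g' x).
Proof.
move=> pf /(primitiveZ (-1)) /(primitiveD pf) /eq_primitive; apply => x /=; ring.
Qed.

(** With both derivatives cut off to [[a, b]], the inner integrals in [triangle_Fubini] are the
    increments [g b - g s] and [f t - f a]; equating the two orders of integration gives the product
    rule. *)
Lemma primitiveM f f' g g' : primitive f f' -> primitive g g' ->
  primitive (fun x => f x * g x) (fun x => f' x * g x + f x * g' x).
Proof.
move=> pf pg; have [mf fi ff] := pf; have [mg gi gg] := pg.
have cf := primitive_continuous pf; have cg := primitive_continuous pg.
have fgi a b : intg `[a, b] (fun x => f x * g' x) by exact: intg_continuousM.
have gfi a b : intg `[a, b] (fun x => f' x * g x).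
  rewrite (_ : (fun x => f' x * g x) = (fun x => g x * f' x)).
    exact: intg_continuousM.
  by apply/funext => x; rewrite mulrC.
split.
- by apply: measurable_funD; apply: measurable_funM => //;
    exact: continuous_measurable_fun.
- by move=> a b; apply: intgD.
move=> a b ab; rewrite RintegralD//.
have phii : intg setT (f' \_ `[a, b]) by exact: (intg_restrict f' _).1.
have psii : intg setT (g' \_ `[a, b]) by exact: (intg_restrict g' _).1.
have [_ _] := triangle_Fubini phii psii.
rewrite (_ : \int[mu]_x _ = \int[mu]_(x in `[a, b]) (g b * f' x - f' x * g x)); last first.
  rewrite [RHS]Rintegral_mkcond; apply: eq_Rintegral => x _; rewrite !patchE.
  case: ifPn => [|_]; last by rewrite mul0r.
  rewrite inE/= in_itv/= => /andP[ax xb].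
  rewrite -Rintegral_mkcondr (_ : _ `&` _ = `[x, b]%classic); last first.
    apply/seteqP; split => y /=; rewrite !in_itv/= ?andbT; first by move=> [-> /andP[]].
    by move=> /andP[xy yb]; rewrite xy yb (le_trans ax).
  by rewrite -gg//; ring.
rewrite (_ : \int[mu]_x _ = \int[mu]_(x in `[a, b]) (f x * g' x - f a * g' x)); last first.
  rewrite [RHS]Rintegral_mkcond; apply: eq_Rintegral => x _; rewrite !patchE.
  case: ifPn => [|_]; last by rewrite mul0r.
  rewrite inE/= in_itv/= => /andP[ax xb].
  rewrite -Rintegral_mkcondr (_ : _ `&` _ = `[a, x]%classic); last first.
    apply/seteqP; split => y /=; rewrite !in_itv/= ?andbT.
      by move=> [-> /andP[->]].
    by move=> /andP[-> yx]; rewrite yx (le_trans yx).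
  by rewrite -ff//; ring.
rewrite RintegralB//; last exact: intgZ.
rewrite RintegralB//; last exact: intgZ.
rewrite !RintegralZl// -ff// -gg// => e; lra.
Qed.

End primitives.

(** * Dominated convergence and vanishing integrals of derivatives *)

Section integrals_of_derivatives.
Context {R : realType}.
Local Notation mu := (@lebesgue_measure R).
Implicit Types (A : set R) (f g h : R -> R) (a b : R).
Local Notation intg A f := (mu.-integrable (A : set R) (EFin \o f)).

Lemma cvgn_le (u : nat -> R) (l M : R) : u n @[n --> \oo] --> l ->
  (forall n, u n <= M) -> l <= M.
Proof.
move=> ul uM; rewrite -(cvg_lim _ ul)//; apply: limr_le; last exact: nearW.
by apply/cvg_ex; exists l.
Qed.

Lemma Rintegral_dominated A (f_ : nat -> R -> R) f g : measurable A ->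
  (forall n, measurable_fun A (f_ n)) -> measurable_fun A f -> intg A g ->
  (forall x, A x -> f_ n x @[n --> \oo] --> f x) ->
  (forall n x, A x -> `|f_ n x| <= g x) ->
  \int[mu]_(x in A) f_ n x @[n --> \oo] --> \int[mu]_(x in A) f x.
Proof.
move=> mA mf_ mf gi f_f f_g.
have fi : intg A f.
  apply: (@intg_le _ _ _ g) => // x Ax.
  apply: (@cvgn_le (fun n => `|f_ n x|)); last by move=> n; exact: f_g.
  by apply: cvg_norm; exact: f_f.
have mEf_ n : measurable_fun A (EFin \o f_ n) by exact/measurable_EFinP.
have mEf : measurable_fun A (EFin \o f) by exact/measurable_EFinP.
have Ef_f : {ae mu, forall x, A x -> (EFin \o f_ n) x @[n --> \oo] --> (EFin \o f) x}.
  by apply: aeW => x Ax /=; apply/fine_cvgP; split; [exact: nearW|exact: f_f].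
have Ef_g : {ae mu, forall x n, A x -> (`|(EFin \o f_ n) x| <= (EFin \o g) x)%E}.
  by apply: aeW => x n Ax /=; rewrite lee_fin f_g.
have [_ _] := @dominated_convergence _ _ _ mu A mA _ _ _ mEf_ mEf Ef_f gi Ef_g.
move=> H; rewrite /Rintegral; apply: fine_cvg.
by rewrite fineK//; exact: (@integrable_fin_num _ _ _ mu).
Qed.

Lemma primitive_C1 f f' : (forall x : R, is_derive x 1 f (f' x)) ->
  continuous f' -> primitive f f'.
Proof.
move=> ff' cf'; have mf' := continuous_measurable_fun cf'.
have cf : continuous f.
  by move=> x; apply/differentiable_continuous/derivable1_diffP; case: (ff' x).
have f'i a b : intg `[a, b] f'.
  have [K _ fK] := continuous_bounded_itv a b cf'.
  by apply: (@intg_itv_bnd _ _ _ _ K) => //; exact: measurable_funTS.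
split=> // a b; rewrite le_eqVlt => /predU1P[->|ab].
  by rewrite subrr set_itv1 Rintegral_set1.
rewrite /Rintegral (@continuous_FTC2 _ f' f)//.
- exact: continuous_subspaceT.
- split => [x _|//|//]; first by case: (ff' x).
  + exact/cvg_at_right_filter/cf.
  + exact/cvg_at_left_filter/cf.
- by move=> x _; rewrite derive1E; case: (ff' x).
Qed.

Lemma Rintegral_ge0_subset A B f : measurable A -> measurable B ->
  A `<=` B -> intg B f -> (forall x, B x -> 0 <= f x) ->
  \int[mu]_(x in A) f x <= \int[mu]_(x in B) f x.
Proof.
move=> mA mB AB fi f0; apply: fine_le.
- by apply: (@integrable_fin_num _ _ _ mu) => //; exact: intgS fi.
- exact: (@integrable_fin_num _ _ _ mu).
apply: ge0_subset_integral => //.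
exact: (@measurable_int _ _ _ mu).
Qed.

Lemma intg_tail f e : intg setT f -> 0 < e ->
  exists n : nat, \int[mu]_(x in ~` `[- n%:R, n%:R]) `|f x| < e.
Proof.
move=> fi e0; pose g n := (fun x => `|f x|) \_ (~` `[- n%:R, n%:R]).
have mI n : measurable (~` `[- n%:R, n%:R] : set R) by exact: measurableC.
have nfi := intg_norm measurableT fi.
have gi n : intg setT (g n).
  by apply: (intg_restrict (fun x => `|f x|) _).1 => //; apply: intgS nfi.
have : \int[mu]_x g n x @[n --> \oo] --> \int[mu]_x (cst 0 x).
  apply: (@Rintegral_dominated _ _ _ (fun x => `|f x|)) => //.
  - by move=> n; exact: intg_measurable (gi n).
  - move=> x _; apply: cvg_near_cst.
    near=> n; rewrite /g patchE/= ifF//; apply/negbTE; rewrite notin_setE/=; apply.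
    rewrite in_itv/= -ler_norml; near: n.
    exact: nbhs_infty_ger.
  - move=> n x _; rewrite /g patchE.
    by case: ifP => _; rewrite ?normr_id ?normr0.
rewrite Rintegral_cst// mul0r => /cvgrPdist_lt /(_ _ e0)[n _ /(_ n (leqnn _))].
rewrite /= sub0r normrN => H; exists n.
by rewrite Rintegral_mkcond (le_lt_trans (ler_norm _)).
Unshelve. all: by end_near. Qed.

Lemma intg_lower_bound f a b (K : R) : intg setT f -> a <= b ->
  (forall x, a <= x <= b -> K <= `|f x|) -> K * (b - a) <= \int[mu]_x `|f x|.
Proof.
move=> fi ab Kf; have nfi := intg_norm measurableT fi.
apply: (@le_trans _ _ (\int[mu]_(x in `[a, b]) `|f x|)); last first.
  exact: Rintegral_ge0_subset.
have -> : K * (b - a) = \int[mu]_(x in `[a, b]) K.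
  rewrite Rintegral_cst//= lebesgue_measure_itv/= lte_fin.
  by case: ltgtP ab => // -> _; rewrite subrr.
apply: le_Rintegral => //.
- by apply: (@intg_itv_bnd _ _ _ _ `|K|).
- by apply: intgS nfi.
Qed.

(** Integrability of [f'] makes [f] nearly constant on each side of a large [[-n, n]], and
    integrability of [f] forces these values to be small; so the increment over [[-n, n]] is small.
    This removes the boundary terms from the flux identities. *)
Lemma primitive_Rintegral0 f f' : primitive f f' -> intg setT f ->
  intg setT f' -> \int[mu]_x f' x = 0.
Proof.
move=> pf fi f'i; have [_ _ ff'] := pf.
apply/eqP; rewrite -normr_le0; apply/ler_addgt0Pr => e e0; rewrite add0r.
have e3 : 0 < e / 3 by lra.
have [n tn] := intg_tail f'i e3.
have n0 : (0 : R) <= n%:R by [].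
have f'ni := intg_norm measurableT f'i.
have mC : measurable (~` `[- n%:R, n%:R] : set R) by exact: measurableC.
have f'nCi : intg (~` `[- n%:R, n%:R]) (fun x => `|f' x|) by apply: intgS f'ni.
(* The interval is open, so that an end point may be [n] or [-n] itself. *)
have var x y : x <= y -> `]x, y[ `<=` ~` `[- n%:R, n%:R] -> `|f y - f x| < e / 3.
  move=> xy xyn; rewrite ff'//; apply: le_lt_trans tn.
  have f'xy : intg `]x, y[ f' by apply: intgS f'i.
  rewrite -Rintegral_itv_bndo_bndc; last by apply: intgS f'i.
  rewrite -Rintegral_itv_obnd_cbnd//.
  rewrite (le_trans (le_normr_Rintegral _ f'xy))//.
  exact: Rintegral_ge0_subset.
pose J := \int[mu]_x `|f x|; have J0 : 0 <= J by exact: Rintegral_ge0.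
have fn : `|f n%:R| <= e / 3.
  rewrite leNgt; apply/negP => efn; pose K := `|f n%:R| - e / 3.
  have K0 : 0 < K by rewrite /K; lra.
  (* On an interval of length [(J + 1) / K] the bound [|f| >= K] would give an integral of at least
     [J + 1]. *)
  have : K * (n%:R + (J + 1) / K - n%:R) <= J.
    apply: intg_lower_bound => //; first by rewrite lerDl divr_ge0//; lra.
    move=> x /andP[nx _]; have : `|f x - f n%:R| < e / 3.
      apply: var => // y /=; rewrite !in_itv/= => /andP[ny _] /andP[_].
      by rewrite leNgt ny.
    by move=> H; have := lerB_normD (f n%:R) (f x - f n%:R); rewrite subrKC /K; lra.
  by rewrite addrAC subrr add0r mulrC divfK ?gt_eqF//; lra.
have fNn : `|f (- n%:R)| <= e / 3.
  rewrite leNgt; apply/negP => efn; pose K := `|f (- n%:R)| - e / 3.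
  have K0 : 0 < K by rewrite /K; lra.
  have : K * (- n%:R - (- n%:R - (J + 1) / K)) <= J.
    apply: intg_lower_bound => //; first by rewrite gerBl divr_ge0//; lra.
    move=> x /andP[_ nx]; have : `|f (- n%:R) - f x| < e / 3.
      apply: var => // y /=; rewrite !in_itv/= => /andP[_ ny] /andP[].
      by rewrite leNgt ny.
    rewrite distrC => H; have := lerB_normD (f (- n%:R)) (f x - f (- n%:R)).
    by rewrite subrKC /K; lra.
  by rewrite opprB addrCA subrr addr0 mulrC divfK ?gt_eqF//; lra.
have nn : - n%:R <= (n%:R : R) by rewrite ge0_cp.
have := ff' _ _ nn.
have -> : \int[mu]_x f' x = \int[mu]_(x in `[- n%:R, n%:R]) f' x +
   \int[mu]_(x in ~` `[- n%:R, n%:R]) f' x.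
  rewrite -Rintegral_setU ?setUv//; last exact/disj_setPCl.
have f'Ci : intg (~` `[- n%:R, n%:R]) f' by apply: intgS f'i.
move=> <-; have := @le_normr_Rintegral _ _ _ mu _ _ mC f'Ci.
set T := \int[mu]_(x in _) f' x => HT.
rewrite (le_trans (ler_normD _ _))// (le_trans (lerD (ler_normB _ _) (lexx _)))//.
lra.
Qed.

End integrals_of_derivatives.

(** * Test functions and weak derivatives *)

Section smooth_functions.
Context {R : realType}.
Implicit Types (f g h : R -> R).

Definition smooth f := forall n x, derivable (derive1n n f) x 1.

(** Spares the computation of higher derivatives: smoothness follows from membership in any class
    closed under differentiation. *)
Lemma smooth_class (S : (R -> R) -> Prop) :
  (forall f, S f -> exists2 f', S f' & forall x : R, is_derive x 1 f (f' x)) ->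
  forall f, S f -> smooth f.
Proof.
move=> Sd; have Sn n f : S f -> S (derive1n n f).
  elim: n => // n IH Sf; rewrite derive1nS.
  have [f' Sf' ff'] := Sd _ (IH Sf).
  rewrite (_ : derive1 _ = f')//; apply/funext => x.
  by rewrite derive1E; case: (ff' x).
move=> f Sf n x; have [f' _ ff'] := Sd _ (Sn n f Sf).
by case: (ff' x).
Qed.

Lemma smooth_is_derive f (x : R) : smooth f -> is_derive x 1 f (derive1 f x).
Proof. by move=> /(_ 0%N x) df; rewrite derive1E; exact: DeriveDef. Qed.

Lemma smooth_derive1 f : smooth f -> smooth (derive1 f).
Proof. by move=> sf n x; have := sf n.+1 x; rewrite derive1Sn. Qed.

Lemma smooth_continuous f : smooth f -> continuous f.
Proof.
by move=> sf x; apply/differentiable_continuous/derivable1_diffP; exact: (sf 0%N).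
Qed.

Lemma smooth_affine (c p q : R) f : smooth f -> smooth (fun x => c * f (p * x + q)).
Proof.
move=> sf; apply: (@smooth_class (fun h => exists c f, smooth f /\ h = fun x => c * f (p * x + q))).
  move=> _ [d [g [sg ->]]]; exists (fun x => (d * p) * derive1 g (p * x + q)).
    by exists (d * p), (derive1 g); split; [exact: smooth_derive1|].
  move=> x.
  have dg := smooth_is_derive (p * x + q) sg.
  have dl : is_derive x 1 (fun x => p * x + q) p.
    by apply: is_derive_eq; rewrite /GRing.scale/=; ring.
  have := @is_derive1_comp _ g (fun x => p * x + q) x _ _ dg dl.
  rewrite /comp => dgl; apply: is_derive_eq.
  by rewrite /GRing.scale/= ; ring.
by exists c, f.
Qed.

Lemma smoothD f g : smooth f -> smooth g -> smooth (fun x => f x + g x).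
Proof.
move=> sf sg; apply: (@smooth_class (fun h => exists f g,
  [/\ smooth f, smooth g & h = fun x => f x + g x])); last by exists f, g.
move=> _ [u [v [su sv ->]]]; exists (fun x => derive1 u x + derive1 v x).
  by exists (derive1 u), (derive1 v); split; [exact: smooth_derive1..|].
move=> x; have ? := smooth_is_derive x su; have ? := smooth_is_derive x sv.
exact: is_deriveD.
Qed.

(** The product rule leaves the set of products of smooth functions, so the class fed to
    [smooth_class] must contain their sums. *)
Inductive smooth_products : (R -> R) -> Prop :=
| smooth_products_M f g : smooth f -> smooth g ->
    smooth_products (fun x => f x * g x)
| smooth_products_D f g : smooth_products f -> smooth_products g ->
    smooth_products (fun x => f x + g x).

Lemma smoothM f g : smooth f -> smooth g -> smooth (fun x => f x * g x).
Proof.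
move=> sf sg; apply: (@smooth_class smooth_products); last exact: smooth_products_M.
move=> h; elim=> {h} [u v su sv|u v _ [u' Su' uu'] _ [v' Sv' vv']].
  exists (fun x => u x * derive1 v x + v x * derive1 u x).
    apply: smooth_products_D.
      by apply: smooth_products_M; [exact: su|exact: smooth_derive1].
    by apply: smooth_products_M; [exact: sv|exact: smooth_derive1].
  move=> x; have ? := smooth_is_derive x su; have ? := smooth_is_derive x sv.
  exact: is_deriveM.
exists (fun x => u' x + v' x); first exact: smooth_products_D.
by move=> x; apply: is_deriveD.
Qed.

Lemma smoothZ (c : R) f : smooth f -> smooth (fun x => c * f x).
Proof.
move=> sf; rewrite (_ : (fun x => c * f x) = (fun x => c * f (1 * x + 0))).
  exact: smooth_affine.
by apply/funext => x; rewrite mul1r addr0.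
Qed.

(* [flat k] is [x^-k exp (-1/x)] extended by [0] to the negative half-line. *)
Definition flat (k : nat) (x : R) : R :=
  if 0 < x then x^-1 ^+ k * expR (- x^-1) else 0.

(** One term of the exponential series suffices: [exp (1/x) >= (1/x)^(k+2) / (k+2)!]. A quadratic
    bound is what [is_derive_quadratic] needs to differentiate at [0]. *)
Lemma flat_le (k : nat) (x : R) : `|flat k x| <= (k.+2)`!%:R * x ^+ 2.
Proof.
rewrite /flat; case: ifPn => [x0|_]; last by rewrite normr0 mulr_ge0// sqr_ge0.
have i0 : 0 < x^-1 by rewrite invr_gt0.
rewrite ger0_norm; last by rewrite mulr_ge0 ?exprn_ge0 ?expR_ge0// ltW.
have := expR_ge1Dxn k.+1 (ltW i0); rewrite expRN => H.
rewrite ler_pdivrMr ?expR_gt0// -mulrA.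
have F0 : (0 : R) < (k.+2)`!%:R by rewrite ltr0n fact_gt0.
apply: (@le_trans _ _ ((k.+2)`!%:R * (x ^+ 2 * (x^-1 ^+ k.+2 / (k.+2)`!%:R)))).
  rewrite [X in _ <= _ * (_ * X)]mulrC mulrCA [X in _ <= _ * X]mulrA divff ?gt_eqF// mul1r.
  rewrite (_ : x ^+ 2 * _ = (x / x) ^+ 2 * x^-1 ^+ k); last by rewrite !exprS expr0; ring.
  by rewrite divff ?gt_eqF// expr1n mul1r.
rewrite ler_pM2l// ler_wpM2l ?sqr_ge0//; lra.
Qed.

Lemma is_derive_quadratic f (C : R) : (forall x, `|f x| <= C * x ^+ 2) ->
  is_derive (0 : R) 1 f 0.
Proof.
move=> fC; have f0 : f 0 = 0.
  by apply/eqP; rewrite -normr_le0; have := fC 0; rewrite expr0n/= mulr0.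
have C0 : 0 <= C by have := le_trans (normr_ge0 _) (fC 1); rewrite expr1n mulr1.
have H : h^-1 *: (f (h *: 1 + 0) - f 0) @[h --> 0^'] --> 0.
  apply/cvgrPdist_le => e e0; near=> h.
  have h0 : h != 0 by near: h; exact: nbhs_dnbhs_neq.
  rewrite sub0r normrN f0 subr0 addr0 /GRing.scale/= mulr1 normrM normfV.
  rewrite ler_pdivrMl ?normr_gt0// (le_trans (fC h))//.
  rewrite -real_normK ?num_real// expr2 mulrA mulrC ler_wpM2l//.
  rewrite (@le_trans _ _ ((C + 1) * `|h|))// ?ler_wpM2r ?lerDl//.
  rewrite mulrC -ler_pdivlMr ?ltr_wpDl//; near: h.
  by apply: dnbhs0_le; rewrite divr_gt0// ltr_wpDl.
apply: DeriveDef; first by apply/cvg_ex; exists 0; exact: H.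
exact: cvg_lim H.
Unshelve. all: by end_near. Qed.

Lemma is_derive_flat (k : nat) (x : R) :
  is_derive x 1 (flat k) (- k%:R * flat k.+1 x + flat k.+2 x).
Proof.
have [x0|x0|->] := ltrgtP x 0.
- rewrite /flat !ltNge (ltW x0)/= mulr0 addr0.
  apply: (@near_eq_is_derive _ _ _ (cst 0)).
  by near=> y; rewrite ltNge (ltW _)//; near: y; exact: lt_nbhsl.
- rewrite /flat x0.
  pose u := fun y : R => y^-1 ^+ k * expR (- y^-1).
  apply: (@near_eq_is_derive _ _ _ u).
    by near=> y; rewrite ifT//; near: y; exact: lt_nbhsr.
  have xn0 : x != 0 by rewrite gt_eqF.
  have dV : is_derive x 1 (fun y : R => y^-1) (- x ^- 2).
    by apply: is_derive_eq; [exact: is_deriveV|rewrite /GRing.scale/= mulr1].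
  have dX := @is_deriveX _ _ _ k _ _ _ dV.
  have dE := is_derive1_comp (is_derive_expR _) (is_deriveN dV).
  have -> : u = (fun y : R => y^-1) ^+ k * (expR \o - (fun y : R => y^-1)).
    by apply/funext => y; rewrite /u fctE exprfctE.
  apply: is_derive_eq (is_deriveM dX dE) _.
  rewrite exprfctE /GRing.scale/= -[(- _) x]/(- x^-1) -exprVn.
  by case: k {u dX} => [|k]; rewrite /= ?expr0 !exprS; ring.
- rewrite {2 3}/flat ltxx mulr0 addr0; apply: is_derive_quadratic; exact: flat_le.
Unshelve. all: by end_near. Qed.

End smooth_functions.

(** * Test functions and smooth approximation of indicators *)

Section test_functions.
Context {R : realType}.
Implicit Types (f g h : R -> R).

(** By [is_derive_flat] the derivative of [flat k] is a combination of [flat k.+1] and [flat k.+2],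
    so linear combinations form a class closed under differentiation. *)
Inductive flat_span : (R -> R) -> Prop :=
| flat_span_base k : flat_span (flat k)
| flat_span_lin c f g : flat_span f -> flat_span g ->
    flat_span (fun x => c * f x + g x).

Lemma smooth_flat k : smooth (@flat R k).
Proof.
apply: (@smooth_class R flat_span); last exact: flat_span_base.
move=> h; elim=> {h} [j|c f g _ [f' Sf' ff'] _ [g' Sg' gg']].
  exists (fun x => - j%:R * flat j.+1 x + flat j.+2 x); last exact: is_derive_flat.
  by apply: flat_span_lin; exact: flat_span_base.
exists (fun x => c * f' x + g' x); first exact: flat_span_lin.
move=> x; have df := ff' x; have dg := gg' x.
exact: is_deriveD (is_deriveZ c df) dg.
Qed.

Lemma test_functionP f (N : R) : smooth f -> (forall x, N < `|x| -> f x = 0) ->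
  test_function f.
Proof.
move=> sf fN; split; first exact: sf.
apply: (@subclosed_compact _ _ `[- N, N]%classic).
- exact: closed_closure.
- exact: segment_compact.
have cI : closed (`[- N, N]%classic : set R) by exact: interval_closed.
rewrite ((closure_id _).1 cI); apply: closure_subset => x /= fx.
rewrite in_itv/= -ler_norml leNgt; apply/negP => /fN /eqP.
by rewrite (negbTE fx).
Qed.

Lemma test_function_smooth f : test_function f -> smooth f.
Proof. by case. Qed.

Lemma test_function_supp f : test_function f ->
  exists2 N : R, 0 < N & forall x, N < `|x| -> f x = 0.
Proof.
move=> [_ /compact_bounded[M [_ MP]]]; exists (`|M| + 1) => // x Mx.
apply/eqP/negPn/negP => fx.
have M1 : M < `|M| + 1 by rewrite (le_lt_trans (ler_norm _))// ltrDl.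
have := MP _ M1 x (@subset_closure _ _ x fx).
by rewrite /= leNgt Mx.
Qed.

Lemma test_function_derive1_supp f (N : R) : smooth f ->
  (forall x, N < `|x| -> f x = 0) -> forall x, N < `|x| -> derive1 f x = 0.
Proof.
move=> sf fN x Nx; rewrite derive1E.
suff : is_derive x 1 f 0 by case.
apply: (@near_eq_is_derive _ _ _ (cst 0)).
have := @cvgr_gt _ _ (nbhs x) (nbhs_filter x) _ _ (@norm_continuous _ _ x) N Nx.
by apply: filterS => y /fN ->.
Qed.

(* Smooth functions that increase to the indicator of ]a, b[. *)
Definition bump (a b : R) (n : nat) (x : R) : R :=
  flat 0 (n.+1%:R * (x - a)) * flat 0 (n.+1%:R * (b - x)).

Lemma flat0_itv (x : R) : 0 <= flat 0 x <= 1.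
Proof.
rewrite /flat; case: ifPn => [x0|_]; last by rewrite lexx ler01.
by rewrite expr0 mul1r expR_ge0 expR_le1 oppr_le0 invr_ge0 ltW.
Qed.

Lemma bump_itv a b n x : 0 <= bump a b n x <= 1.
Proof.
rewrite /bump; have /andP[? ?] := flat0_itv (n.+1%:R * (x - a)).
have /andP[? ?] := flat0_itv (n.+1%:R * (b - x)).
by rewrite mulr_ge0//= mulr_ile1.
Qed.

Lemma bump_out a b n x : ~~ (a < x < b) -> bump a b n x = 0.
Proof.
rewrite negb_and /bump /flat -!leNgt => /orP[xa|bx].
- by rewrite ltNge mulr_ge0_le0 ?subr_le0//= mul0r.
- by rewrite [X in _ * X]ifF ?mulr0// ltNge mulr_ge0_le0 ?subr_le0.
Qed.

Lemma flat0_cvg (x : R) : 0 < x -> flat 0 (n.+1%:R * x) @[n --> \oo] --> (1 : R).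
Proof.
move=> x0; rewrite /flat.
rewrite (_ : (fun n => _) = (fun n => expR (- (n.+1%:R^-1 * x^-1)))); last first.
  by apply/funext => n; rewrite mulr_gt0// expr0 mul1r invfM.
rewrite -{2}(@expR0 R) -oppr0 -(mul0r x^-1).
apply: continuous_cvg; first exact: continuous_expR.
apply: cvgN; apply: cvgMl; exact: cvg_harmonic.
Qed.

Lemma bump_cvg a b x : bump a b n x @[n --> \oo] --> (\1_(`]a, b[) x : R).
Proof.
rewrite indicE; rewrite mem_setE in_itv/=; case: (boolP (a < x < b)).
  move=> /andP[ax xb]; rewrite -[true%:R](mulr1 (1 : R)).
  by apply: cvgM; apply: flat0_cvg; rewrite subr_gt0.
move=> H; rewrite (_ : (fun n => _) = cst 0); first exact: cvg_cst.
by apply/funext => n; rewrite bump_out.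
Qed.

Lemma bump_test a b n : test_function (bump a b n).
Proof.
apply: (@test_functionP (bump a b n) (`|a| + `|b|)).
  apply: smoothM.
    rewrite (_ : (fun x => _) = (fun x => 1 * flat 0 (n.+1%:R * x + - (n.+1%:R * a)))).
      exact/smooth_affine/smooth_flat.
    by apply/funext => x; rewrite mul1r mulrBr.
  rewrite (_ : (fun x => _) = (fun x => 1 * flat 0 (- n.+1%:R * x + n.+1%:R * b))).
    exact/smooth_affine/smooth_flat.
  by apply/funext => x; rewrite mul1r mulrBr mulNr addrC.
move=> x abx; apply: bump_out; apply/negP => /andP[ax xb].
move: abx; rewrite ltNge => /negP; apply.
rewrite ler_norml; have := ler_norm b; have := ler_norm (- a).
by rewrite normrN; have := normr_ge0 a; have := normr_ge0 b; lra.
Qed.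

End test_functions.

(** * Weak derivatives and the du Bois-Reymond lemma *)

Section weak_derivatives.
Context {R : realType}.
Local Notation mu := (@lebesgue_measure R).
Implicit Types (A : set R) (f g h k q phi : R -> R) (a b : R).
Local Notation intg A f := (mu.-integrable (A : set R) (EFin \o f)).

Definition locint f := measurable_fun setT f /\ forall a b, intg `[a, b] f.

Definition wder f f' := forall phi, test_function phi ->
  \int[mu]_x (f x * derive1 phi x) = - \int[mu]_x (f' x * phi x).

Lemma primitive_locint f f' : primitive f f' -> locint f'.
Proof. by case. Qed.

Lemma continuous_locint f : continuous f -> locint f.
Proof.
move=> cf; split; first exact: continuous_measurable_fun.
move=> a b; have [K _ fK] := continuous_bounded_itv a b cf.
by apply: (@intg_itv_bnd _ _ _ _ K) => //; apply: measurable_funTS;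
  exact: continuous_measurable_fun.
Qed.

Lemma locintB f g : locint f -> locint g -> locint (fun x => f x - g x).
Proof.
by move=> [mf fi] [mg gi]; split; [exact: measurable_funB|move=> a b; exact: intgB].
Qed.

Lemma intg_locint f : intg setT f -> locint f.
Proof.
move=> fi; split; first exact: intg_measurable fi.
by move=> a b; apply: intgS fi.
Qed.

Lemma locintM f g : locint f -> continuous g -> locint (fun x => f x * g x).
Proof.
move=> [mf fi] cg; split.
  by apply: measurable_funM => //; exact: continuous_measurable_fun.
move=> a b; rewrite (_ : (fun x => f x * g x) = (fun x => g x * f x)).
  exact: intg_continuousM.
by apply/funext => x; rewrite mulrC.
Qed.

Lemma intg_supp f (N : R) : locint f -> (forall x, N < `|x| -> f x = 0) ->
  intg setT f.
Proof.
move=> [mf fi] fN; rewrite (_ : f = f \_ `[- N, N]).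
  by apply: (intg_restrict f _).1.
apply/funext => x; rewrite patchE; case: ifPn => //.
by rewrite notin_setE/= in_itv/= -ler_norml => /negP; rewrite -ltNge => /fN.
Qed.

Lemma intg_test f phi : locint f -> test_function phi ->
  intg setT (fun x => f x * phi x).
Proof.
move=> fl tphi; have [N _ phiN] := test_function_supp tphi.
apply: (@intg_supp _ N) => [|x /phiN ->]; last by rewrite mulr0.
by apply: locintM => //; exact/smooth_continuous/test_function_smooth.
Qed.

Lemma test_function_derive1 (phi : R -> R) : test_function phi -> test_function (derive1 phi).
Proof.
move=> tphi; have [N _ phiN] := test_function_supp tphi.
have sphi := test_function_smooth tphi.
apply: (@test_functionP _ _ N); first exact: smooth_derive1.
exact: test_function_derive1_supp.
Qed.

Lemma test_primitive (phi : R -> R) : test_function phi -> primitive phi (derive1 phi).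
Proof.
move=> /test_function_smooth sphi; apply: primitive_C1.
  by move=> x; exact: smooth_is_derive.
exact/smooth_continuous/smooth_derive1.
Qed.

(** Lebesgue differentiation: almost everywhere to the right of a base point, [k] is the derivative
    of its integral from there, which vanishes. The base points [-n] exhaust the line. *)
Lemma locint_itv0_ae0 k : locint k ->
  (forall a b, a < b -> \int[mu]_(x in `[a, b]) k x = 0) ->
  {ae mu, forall x, k x = 0}.
Proof.
move=> [mk ki] k0.
have lk : locally_integrable setT k.
  split=> //; first exact: openT.
  move=> K _ cK; have [M [_ MP]] := compact_bounded cK.
  have KI : K `<=` `[- (`|M| + 1), `|M| + 1].
    move=> x Kx; rewrite /= in_itv/= -ler_norml; apply: (MP (`|M| + 1)) => //.
    by rewrite (le_lt_trans (ler_norm _))// ltrDl.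
  have mK : measurable K by exact: compact_measurable.
  have /integrableP[_] : mu.-integrable K (EFin \o k).
    by apply: (@integrableS _ _ _ mu `[- (`|M| + 1), `|M| + 1]).
  by [].
have H (n : nat) : {ae mu, forall x, - n%:R < x -> k x = 0}.
  have := @FTC1 R k (BLeft (- n%:R)) (fun y => ki _ _) lk.
  apply: ae_imp => x /= + nx; rewrite lte_fin => /(_ nx)[_ <-].
  rewrite (_ : (fun y => _) = cst 0) ?derive1_cst//.
  apply/funext => y; have [ny|yn] := ltP (- n%:R) y; first exact: k0.
  have := yn; rewrite le_eqVlt => /predU1P[->|yn'].
    by rewrite set_itv1 Rintegral_set1.
  by rewrite set_itv_ge ?Rintegral_set0// -leNgt bnd_simp.
have := ae_foralln H; apply: ae_imp => x /(_ (Num.bound `|x|)); apply.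
have := archi_boundP (normr_ge0 x); rewrite ltrNl; apply: le_lt_trans.
by rewrite -normrN ler_norm.
Qed.

(** [bump a b n] tends to the indicator of []a, b[], so dominated convergence turns vanishing
    against test functions into vanishing over intervals. *)
Lemma locint_test0_ae0 k : locint k ->
  (forall phi, test_function phi -> \int[mu]_x (k x * phi x) = 0) ->
  {ae mu, forall x, k x = 0}.
Proof.
move=> kl k0; apply: locint_itv0_ae0 => // a b ab.
have [mk ki] := kl.
have H : \int[mu]_(x in `]a, b[) (k x * bump a b n x) @[n --> \oo] -->
    \int[mu]_(x in `]a, b[) k x.
  apply: (@Rintegral_dominated _ _ _ _ (fun x => `|k x|)) => //.
  - move=> n; apply: measurable_funM; first exact: measurable_funTS.
    apply: measurable_funTS; apply: continuous_measurable_fun.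
    exact/smooth_continuous/test_function_smooth/bump_test.
  - exact: measurable_funTS.
  - by apply: intg_norm => //; apply: intgS (ki a b) => //; exact: subset_itv_oo_cc.
  - move=> x /=; rewrite in_itv/= => xab; rewrite -[X in _ --> X]mulr1.
    apply: cvgMr; have := @bump_cvg _ a b x.
    by rewrite indicE mem_setE in_itv/= xab.
  - move=> n x _; rewrite normrM ler_piMr//.
    by have /andP[? ?] := bump_itv a b n x; rewrite ger0_norm.
have {}H : \int[mu]_(x in `]a, b[) k x = 0.
  rewrite -(cvg_lim _ H)//; apply/cvg_lim => //.
  rewrite (_ : (fun n => _) = cst 0); first exact: cvg_cst.
  apply/funext => n; rewrite -[RHS](k0 _ (bump_test a b n)) Rintegral_mkcond.
  apply: eq_Rintegral => x _; rewrite patchE mem_setE in_itv/=.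
  by case: ifPn => // /bump_out ->; rewrite mulr0.
rewrite -H -Rintegral_itv_bndo_bndc//; last first.
  by apply: intgS (ki a b) => //; exact: subset_itv_co_cc.
rewrite -Rintegral_itv_obnd_cbnd//.
by apply: intgS (ki a b) => //; exact: subset_itv_oo_cc.
Qed.

Lemma locint_primitive q : locint q -> exists F, primitive F q.
Proof.
move=> [mq qi].
(* One of the two intervals is always empty or a point; the difference is the oriented integral from
   [0] to [x]. *)
exists (fun x => \int[mu]_(t in `[0, x]) q t - \int[mu]_(t in `[x, 0]) q t).
split=> // a b ab.
have split3 x y z : x <= y -> y <= z -> \int[mu]_(t in `[x, z]) q t =
    \int[mu]_(t in `[x, y]) q t + \int[mu]_(t in `[y, z]) q t.
  move=> xy yz; rewrite -[X in _ + X]Rintegral_itv_obnd_cbnd; last first.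
    by apply: intgS (qi y z) => //; exact: subset_itv_oc_cc.
  by rewrite -(@Rintegral_itvB _ q (BLeft x) (BRight z) y)// ?bnd_simp//; ring.
have zero x y : y <= x -> \int[mu]_(t in `[x, y]) q t = 0.
  rewrite le_eqVlt => /predU1P[->|yx].
    by rewrite set_itv1 Rintegral_set1.
  by rewrite set_itv_ge ?Rintegral_set0// -leNgt bnd_simp.
have [a0|a0] := leP 0 a.
  by rewrite (split3 0 a b)// (zero b 0) ?(zero a 0)//; [ring|lra].
have [b0|b0] := leP b 0.
  by rewrite (split3 a b 0)// (zero 0 b) ?(zero 0 a)//; [ring|lra].
by rewrite (split3 a 0 b) ?(zero 0 a) ?(zero b 0); [ring|lra..].
Qed.

Lemma primitive_wder F q : primitive F q -> wder F q.
Proof.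
move=> pF phi tphi.
have pphi := test_primitive tphi; have tphi' := test_function_derive1 tphi.
have lF := continuous_locint (primitive_continuous pF).
have lq := primitive_locint pF.
have i1 := intg_test lq tphi; have i2 := intg_test lF tphi'.
have := primitive_Rintegral0 (primitiveM pF pphi) (intg_test lF tphi)
  (intgD measurableT i1 i2).
by rewrite RintegralD// => /eqP; rewrite addrC addr_eq0 => /eqP.
Qed.

Lemma primitive_is_derive F q (x : R) : primitive F q -> continuous q ->
  is_derive x 1 F (q x).
Proof.
move=> [mq qi Fq] cq.
have xx : x < x + 1 by lra.
have [|dG G'] := @continuous_FTC1_closed R q (x - 1) x (x + 1) xx (qi _ _) _ (cq x).
  by lra.
pose G y := F (x - 1) + \int[mu]_(t in `[x - 1, y]) q t.
apply: (@near_eq_is_derive _ _ _ G).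
  near=> y; rewrite /G -Fq ?subrKC//.
  near: y; exists 1 => //= t; rewrite /ball_/= ltr_norml => /andP[]; lra.
have := is_deriveD (is_derive_cst (F (x - 1)) x 1) (DeriveDef dG _).
by move=> /(_ (q x)); rewrite add0r; apply; rewrite -derive1E.
Unshelve. all: by end_near. Qed.

Lemma smooth_primitive F q : (forall x : R, is_derive x 1 F (q x)) ->
  smooth q -> smooth F.
Proof.
move=> dF sq; apply: (@smooth_class R (fun h => smooth h \/ h = F)); last by right.
move=> h [sh|->]; last by exists q => //; left.
exists (derive1 h); first by left; exact: smooth_derive1.
by move=> x; exact: smooth_is_derive.
Qed.

(** A test function of integral zero is the derivative of a test function. Subtracting from [phi] a
    multiple of the fixed bump [b0] reaches this case, and what remains of the integral of [k phi]
    is [C] times the integral of [phi]. *)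
Lemma wder_zero_cst k : locint k -> wder k (cst 0) ->
  exists C, {ae mu, forall x, k x = C}.
Proof.
move=> kl k0.
pose b0 : R -> R := bump 0 1 0.
have tb0 : test_function b0 by exact: bump_test.
have b0_int : 0 < \int[mu]_x b0 x.
  have b0i : intg setT b0.
    have := intg_test (continuous_locint (@cst_continuous _ _ (1 : R))) tb0.
    by apply: eq_intg => // x _; rewrite /= mul1r.
  (* A lower bound of [b0] on [[1/4, 3/4]], where [1/x] and [1/(1 - x)] are at most [4]. *)
  pose K := expR (- 4) * expR (- 4) : R.
  have K0 : 0 < K by rewrite mulr_gt0 ?expR_gt0.
  apply: (@lt_le_trans _ _ (K * (3 / 4 - 1 / 4))); first by rewrite mulr_gt0//; lra.
  apply: le_trans (intg_lower_bound b0i _ _) _ => [|x /andP[x1 x2]|]; first lra.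
    have x0 : 0 < x by lra.
    have x0' : 0 < 1 - x by lra.
    rewrite ger0_norm; last by have /andP[] := bump_itv 0 1 0 x.
    rewrite /b0 /bump /flat !mul1r subr0 x0 x0' ?expr0 ?mul1r.
    apply: ler_pM; rewrite ?expR_ge0// ler_expR lerN2.
      by rewrite -[leLHS]div1r ler_pdivrMr//; lra.
    by rewrite -[leLHS]div1r ler_pdivrMr//; lra.
  by under eq_Rintegral do rewrite ger0_norm ?(andP (bump_itv 0 1 0 _)).1//.
pose c0 := \int[mu]_x b0 x.
exists (\int[mu]_x (k x * b0 x) / c0).
set C := _ / c0.
have lC : locint (fun _ => C) by apply: continuous_locint; exact: cst_continuous.
suff : {ae mu, forall x, k x - C = 0}.
  by apply: ae_imp => x /eqP; rewrite subr_eq0 => /eqP.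
apply: locint_test0_ae0; first exact: locintB.
move=> phi tphi.
have l1 : locint (fun _ => 1 : R) by apply: continuous_locint; exact: cst_continuous.
have phii : intg setT phi.
  by have := intg_test l1 tphi; apply: eq_intg => // x _; rewrite mul1r.
have b0i : intg setT b0.
  by have := intg_test l1 tb0; apply: eq_intg => // x _; rewrite mul1r.
pose c := \int[mu]_x phi x / c0.
pose chi x := phi x - c * b0 x.
have schi : smooth chi.
  rewrite (_ : chi = (fun x => phi x + (- c) * b0 x)).
    apply: smoothD; first exact: test_function_smooth.
    by apply: smoothZ; exact: test_function_smooth.
  by apply/funext => x; rewrite /chi mulNr.
have [N1 N10 phiN] := test_function_supp tphi.
have [N2 N20 b0N] := test_function_supp tb0.
pose N := N1 + N2.
have chiN x : N < `|x| -> chi x = 0.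
  by move=> Nx; rewrite /chi phiN ?b0N ?mulr0 ?subr0//; move: Nx; rewrite /N; lra.
have chii : intg setT chi by apply: intgB => //; exact: intgZ.
have chi0 : \int[mu]_x chi x = 0.
  rewrite RintegralB//; last exact: intgZ.
  by rewrite RintegralZl// /c divfK ?subrr// gt_eqF.
have [F pF] := locint_primitive (intg_locint chii).
have [_ _ FF] := pF.
have dF (x : R) : is_derive x 1 F (chi x).
  exact: primitive_is_derive pF (smooth_continuous schi).
(* Normalised to vanish to the left of the support of [chi]; it vanishes to the right as well
   because [chi] has integral zero. *)
pose psi x := F x - F (- (N + 1)).
have ipsi (x : R) : is_derive x 1 psi (chi x).
  have := is_deriveB (dF x) (is_derive_cst (F (- (N + 1))) x 1).
  by rewrite subr0.
have dpsi : derive1 psi = chi.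
  by apply/funext => x; rewrite derive1E; case: (ipsi x).
have N0 : 0 < N by rewrite addr_gt0.
have tpsi : test_function psi.
  apply: (@test_functionP _ _ (N + 1)); first exact: smooth_primitive ipsi schi.
  move=> x; rewrite /psi ltr_normr => /orP[Nx|Nx].
    rewrite FF; last lra.
    rewrite -[RHS]chi0 Rintegral_mkcond; apply: eq_Rintegral => y _.
    rewrite patchE; case: ifPn => //; rewrite notin_setE/= in_itv/= => /negP H.
    rewrite chiN// ltr_normr; move: H; rewrite negb_and -!ltNge => /orP[]; lra.
  apply/eqP; rewrite -oppr_eq0 opprB FF; last lra.
  rewrite (_ : Rintegral _ _ _ = \int[mu]_(x in `[x, - (N + 1)]) cst 0 x).
    by rewrite Rintegral_cst// mul0r.
  apply: eq_Rintegral => y; rewrite inE/= in_itv/= => /andP[_ yN].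
  by rewrite chiN// ltr_normr; apply/orP; right; lra.
have := k0 _ tpsi; rewrite dpsi.
have kphii := intg_test kl tphi; have kb0i := intg_test kl tb0.
rewrite (_ : \int[mu]_x (cst 0 x * psi x) = 0); last first.
  rewrite (_ : Rintegral _ _ _ = \int[mu]_x cst 0 x); last first.
    by apply: eq_Rintegral => x _; rewrite mul0r.
  by rewrite Rintegral_cst// mul0r.
rewrite oppr0.
rewrite (_ : \int[mu]_x _ = \int[mu]_x (k x * phi x - c * (k x * b0 x))); last first.
  by apply: eq_Rintegral => x _; rewrite /chi; ring.
rewrite RintegralB//; last exact: intgZ.
rewrite RintegralZl// => E.
rewrite (_ : \int[mu]_x _ = \int[mu]_x (k x * phi x - C * phi x)); last first.
  by apply: eq_Rintegral => x _; rewrite mulrBl.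
rewrite RintegralB//; last exact: intgZ.
by rewrite RintegralZl// -[RHS]E /c /C; congr (_ - _); ring.
Qed.

(** The difference between [f] and any primitive of [q] has weak derivative zero, hence is constant
    almost everywhere. This is the regularity tool for weak solutions. *)
Lemma du_Bois_Reymond f q : locint f -> locint q -> wder f q ->
  exists2 F, primitive F q & {ae mu, forall x, f x = F x}.
Proof.
move=> fl ql fq; have [F pF] := locint_primitive ql.
have lF := continuous_locint (primitive_continuous pF).
have [C HC] : exists C, {ae mu, forall x, f x - F x = C}.
  apply: wder_zero_cst; first exact: locintB.
  move=> phi tphi; have tphi' := test_function_derive1 tphi.
  have i1 := intg_test fl tphi'; have i2 := intg_test lF tphi'.
  rewrite (_ : Rintegral _ _ _ =
      \int[mu]_x (f x * derive1 phi x - F x * derive1 phi x)); last first.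
    by apply: eq_Rintegral => x _; rewrite mulrBl.
  rewrite RintegralB// fq// (primitive_wder pF)// subrr.
  rewrite (_ : Rintegral _ _ _ = \int[mu]_x cst 0 x); last first.
    by apply: eq_Rintegral => x _; rewrite mul0r.
  by rewrite Rintegral_cst// mul0r oppr0.
exists (fun x => F x + C).
  have pC : primitive (cst C) (cst 0).
    by apply: primitive_C1; exact: cst_continuous.
  by apply: eq_primitive (primitiveD pF pC) _ _ => x //=; rewrite addr0.
by apply: ae_imp HC => x <-; rewrite subrKC.
Qed.

Lemma wder_unique f q1 q2 : locint q1 -> locint q2 -> wder f q1 -> wder f q2 ->
  {ae mu, forall x, q1 x = q2 x}.
Proof.
move=> l1 l2 h1 h2.
suff : {ae mu, forall x, q1 x - q2 x = 0}.
  by apply: ae_imp => x /eqP; rewrite subr_eq0 => /eqP.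
apply: locint_test0_ae0; first exact: locintB.
move=> phi tphi.
rewrite (_ : Rintegral _ _ _ = \int[mu]_x (q1 x * phi x - q2 x * phi x)); last first.
  by apply: eq_Rintegral => x _; rewrite mulrBl.
have i1 := intg_test l1 tphi; have i2 := intg_test l2 tphi.
rewrite RintegralB//; apply/eqP; rewrite subr_eq0 -eqr_opp; apply/eqP.
by rewrite -h1// -h2.
Qed.

End weak_derivatives.

(** * Real square-integrable functions *)

Section square_integrable.
Context {R : realType}.
Local Notation mu := (@lebesgue_measure R).
Implicit Types (f g h : R -> R).
Local Notation intg A f := (mu.-integrable (A : set R) (EFin \o f)).

Definition sqi f := measurable_fun setT f /\ intg setT (fun x => f x ^+ 2).

Lemma sqiM f g : sqi f -> sqi g -> intg setT (fun x => f x * g x).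
Proof.
move=> [mf fi] [mg gi].
apply: (@intg_le _ _ _ (fun x => f x ^+ 2 + g x ^+ 2)) => //.
- exact: measurable_funM.
- exact: intgD.
move=> x _; rewrite ler_norml; apply/andP; split.
  by have := sqr_ge0 (f x + g x); have := sqr_ge0 (f x); have := sqr_ge0 (g x); nra.
by have := sqr_ge0 (f x - g x); have := sqr_ge0 (f x); have := sqr_ge0 (g x); nra.
Qed.

Lemma sqiZ (c : R) f : sqi f -> sqi (fun x => c * f x).
Proof.
move=> [mf fi]; split; first exact: measurable_funM.
by under eq_fun do rewrite exprMn; exact: intgZ.
Qed.

Lemma sqiD f g : sqi f -> sqi g -> sqi (fun x => f x + g x).
Proof.
move=> sf sg; have [mf fi] := sf; have [mg gi] := sg.
split; first exact: measurable_funD.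
rewrite (_ : (fun x => _) = (fun x => f x ^+ 2 + 2 * (f x * g x) + g x ^+ 2)).
  by apply: intgD => //; apply: intgD => //; apply: intgZ => //; exact: sqiM.
by apply/funext => x; ring.
Qed.

Lemma sqiN f : sqi f -> sqi (fun x => - f x).
Proof. by move=> /(sqiZ (-1)); under eq_fun do rewrite mulN1r. Qed.

Lemma sqiB f g : sqi f -> sqi g -> sqi (fun x => f x - g x).
Proof. by move=> sf /sqiN; exact: sqiD. Qed.

Lemma sqi0 : sqi (cst 0).
Proof.
split; first exact: measurable_cst.
by under eq_fun do rewrite /= expr0n/=; exact: (@integrable0 _ _ _ mu).
Qed.

Lemma sqi_ae f g : measurable_fun setT g -> {ae mu, forall x, f x = g x} ->
  sqi f -> sqi g.
Proof.
move=> mg fg [mf fi]; split=> //.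
apply: (@intg_ae _ _ (fun x => f x ^+ 2)) => //; first exact: measurable_funX.
by apply: ae_imp fg => x ->.
Qed.

Lemma sqi_itv f a b : sqi f -> intg `[a, b] f.
Proof.
move=> [mf fi]; have fab : intg `[a, b] (fun x => f x ^+ 2) by apply: intgS fi.
apply: (@intg_le _ _ _ (fun x => 1 + f x ^+ 2)) => //.
- exact: measurable_funTS.
- apply: intgD => //; apply: (@intg_itv_bnd _ _ _ _ 1) => //.
  by move=> x _; rewrite normr1.
move=> x _; rewrite -[f x ^+ 2]real_normK ?num_real//.
by have := sqr_ge0 (`|f x| - 1); have := sqr_ge0 (`|f x|); nra.
Qed.

Lemma sqi_locint f : sqi f -> locint f.
Proof. by move=> sf; split; [case: sf|move=> a b; exact: sqi_itv]. Qed.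

Lemma continuous_supp_sqi f (N : R) : continuous f ->
  (forall x, N < `|x| -> f x = 0) -> sqi f.
Proof.
move=> cf fN; split; first exact: continuous_measurable_fun.
apply: (@intg_supp _ _ N).
  rewrite (_ : (fun x => f x ^+ 2) = (fun x => f x * f x)).
    by apply: locintM => //; exact: continuous_locint.
  by apply/funext => x; rewrite expr2.
by move=> x /fN ->; rewrite expr0n.
Qed.

End square_integrable.

(** * The a priori estimate *)

Section pointwise_bounds.
Context {R : realType}.
Implicit Types (y h W s f k g j v w : R).

(** Completing a square bounds the exponential by [exp (kap^2 / 2) exp (- y^2 / 2)], whose last
    factor beats the polynomial. Degree four is the highest growth among the coefficients of the
    flux. *)
Lemma gauss_weight_bound (kap y : R) :
  expR (kap * y - y ^+ 2) * (1 + y ^+ 2) ^+ 2 <= 16 * expR (kap ^+ 2 / 2).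
Proof.
have -> : kap * y - y ^+ 2 = kap ^+ 2 / 2 - (kap - y) ^+ 2 / 2 - y ^+ 2 / 2 by field.
rewrite expRD [expR (- (y ^+ 2 / 2))]expRN mulrAC ler_pdivrMr ?expR_gt0//.
have y2 : 0 <= y ^+ 2 / 2 by rewrite mulr_ge0 ?sqr_ge0.
have := expR_ge1Dxn 1 y2; set E := expR (y ^+ 2 / 2).
rewrite (_ : 2`!%:R = 2 :> R)// => HE.
rewrite (_ : 16 * _ * _ = expR (kap ^+ 2 / 2) * (16 * E)); last by ring.
apply: ler_pM; rewrite ?expR_ge0 ?sqr_ge0//.
  by rewrite ler_expR gerBl mulr_ge0 ?sqr_ge0.
apply: le_trans (_ : 16 * (1 + (y ^+ 2 / 2) ^+ 2 / 2) <= _); last by rewrite ler_wpM2l.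
by have := sqr_ge0 (y ^+ 2 - 1); have := sqr_ge0 (y ^+ 2); nra.
Qed.

Lemma normrM_le (a m n X : R) : `|a| <= X -> `|m| <= n -> `|a * m| <= X * n.
Proof. by move=> aX mn; rewrite normrM; exact: ler_pM. Qed.

Lemma normr_weight_le (W a e t K0 : R) : 0 <= W -> W * t ^+ 2 <= K0 ->
  `|a| <= e * t ^+ 2 -> 0 <= e -> `|W * a| <= e * K0.
Proof.
move=> W0 WK ae e0; rewrite normrM ger0_norm//.
apply: (@le_trans _ _ (W * (e * t ^+ 2))); first by rewrite ler_wpM2l.
by rewrite mulrCA ler_wpM2l.
Qed.

Lemma young_le (a b c d al : R) : 0 < al ->
  `|a * c + b * d| <= (al * (c ^+ 2 + d ^+ 2) + (a ^+ 2 + b ^+ 2) / al) / 2.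
Proof.
move=> al0; have i0 : 0 < al^-1 by rewrite invr_gt0.
have ali : al * al^-1 = 1 by rewrite divff ?gt_eqF.
rewrite ler_norml; apply/andP; split; rewrite -subr_ge0.
- rewrite (_ : _ - _ = al * ((c + a / al) ^+ 2 + (d + b / al) ^+ 2) / 2).
    by rewrite !mulr_ge0 ?addr_ge0 ?sqr_ge0 ?ltW.
  by field; rewrite gt_eqF.
- rewrite (_ : _ - _ = al * ((c - a / al) ^+ 2 + (d - b / al) ^+ 2) / 2).
    by rewrite !mulr_ge0 ?addr_ge0 ?sqr_ge0 ?ltW.
  by field; rewrite gt_eqF.
Qed.

(** [K0] bounds the weight times [(1 + y^2)^2]. The bracket dominates the coefficients of all
    remaining terms of the flux, so that one constant serves the errors in [N + q] and those due to
    the right-hand side. *)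
Definition weight_const (c1 c2 C0 kap K0 : R) : R :=
  K0 * ((1 + c1) * (c2 + C0 + kap + 4) + (kap + 2) * (c2 + C0) + 2 * c2 + 3).

(** Here [y = x / lam], [h = eta / lam^2] and [(g, j)] is [u' / lam^3], so that [q + N + 2 s l] is
    [|u' / lam^3 + i s u|^2]. The first term on the right dominates this square because
    [s d + p >= 1]. Every other term either is smaller by [lam^-4] or contains [v] and [w]; the
    latter are split by Young's inequality with the free parameter [del]. *)
Lemma flux_pointwise (c1 c2 C0 kap K0 lam del s h W y f k g j v w : R) :
  0 < c1 -> 0 < c2 -> 0 < C0 -> kap = C0 + 1 + c2^-1 -> 1 <= lam -> 0 < del ->
  s = 1 \/ s = -1 -> `|h| <= C0 -> 0 <= W -> W * (1 + y ^+ 2) ^+ 2 <= K0 ->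
  let N := f ^+ 2 + k ^+ 2 in let q := g ^+ 2 + j ^+ 2 in
  let V := v ^+ 2 + w ^+ 2 in let m := f * g + k * j in
  let l := f * j - k * g in let p := c2 * y ^+ 2 - h in
  let d := kap * s - 2 * y in
  let K := weight_const c1 c2 C0 kap K0 in
  is_true (lam ^+ 5 * W * (q + N + 2 * s * l) - K * lam * (N + q)
    - (K * del * lam ^+ 5 * (N + q) + K * lam * V / del)
  <= W * (lam ^+ 5 * (s * d + p) * (q + N + 2 * s * l)
    + lam * c1 * (p * y ^+ 2 - s * (2 * y + y ^+ 2 * d)) * N
    + lam * (d * p + 2 * c2 * y) * m - p / lam * (v * f + w * k)
    - 2 * lam ^+ 3 * s * (v * g + w * j) - 2 * lam ^+ 3 * (w * f - v * k))).
Proof.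
move=> c10 c20 C00 kapE lam1 del0 s1 hC W0 WK N q V m l p d K.
set t := 1 + y ^+ 2 in WK.
have lam0 : 0 < lam by lra.
have s2 : s ^+ 2 = 1 by case: s1 => ->; ring.
have ss : `|s| = 1 by case: s1 => ->; rewrite ?normrN normr1.
have ci0 : 0 < c2^-1 by rewrite invr_gt0.
have kap0 : 0 < kap by rewrite kapE; lra.
have t1 : 1 <= t by rewrite /t lerDl sqr_ge0.
have yt : `|y| <= t.
  by rewrite ler_norml /t; apply/andP; split;
    have := sqr_ge0 (y + 1/2); have := sqr_ge0 (y - 1/2); nra.
have y2t : y ^+ 2 <= t by rewrite /t; lra.
have t2t : t <= t ^+ 2 by nra.
have yt2 : `|y| <= t ^+ 2 by exact: le_trans yt t2t.
have y20 := sqr_ge0 y.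
have N0 : 0 <= N by rewrite addr_ge0 ?sqr_ge0.
have q0 : 0 <= q by rewrite addr_ge0 ?sqr_ge0.
have V0 : 0 <= V by rewrite addr_ge0 ?sqr_ge0.
have K00 : 0 <= K0 by rewrite (le_trans _ WK)// mulr_ge0 ?sqr_ge0.
have WK' : W <= K0 by rewrite (le_trans _ WK)// ler_peMr//; nra.
have G0 : 0 <= q + N + 2 * s * l.
  rewrite (_ : _ + _ = (g - s * k) ^+ 2 + (j + s * f) ^+ 2).
    by rewrite addr_ge0 ?sqr_ge0.
  rewrite /q /N /l; have -> : (g - s * k) ^+ 2 + (j + s * f) ^+ 2 =
    g ^+ 2 + j ^+ 2 + s ^+ 2 * (f ^+ 2 + k ^+ 2) + 2 * s * (f * j - k * g) by ring.
  by rewrite s2 mul1r.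
(* Of the three parts of [kap], [1 / c2] completes the square [(c2 y - s)^2 / c2], [C0] pays for
   [h], and [1] is the margin. *)
have main : 1 <= s * d + p.
  rewrite -subr_ge0 (_ : _ - 1 = (c2 * y - s) ^+ 2 / c2 + (C0 - h)).
    rewrite addr_ge0 ?divr_ge0 ?sqr_ge0 ?(ltW c20)//.
    by move: hC; rewrite ler_norml => /andP[]; lra.
  rewrite /d /p kapE.
  have -> : s * ((C0 + 1 + c2^-1) * s - 2 * y) + (c2 * y ^+ 2 - h) - 1 =
     s ^+ 2 * (C0 + 1 + c2^-1) - 2 * s * y + c2 * y ^+ 2 - h - 1 by ring.
  have -> : (c2 * y - s) ^+ 2 / c2 = c2 * y ^+ 2 - 2 * s * y + s ^+ 2 * c2^-1.
    by field; rewrite gt_eqF.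
  by rewrite s2; ring.
have T1 : lam ^+ 5 * W * (q + N + 2 * s * l) <=
    W * (lam ^+ 5 * (s * d + p) * (q + N + 2 * s * l)).
  rewrite [leRHS](_ : _ = lam ^+ 5 * W * (q + N + 2 * s * l) * (s * d + p)).
    by rewrite ler_peMr// (mulr_ge0 (mulr_ge0 (exprn_ge0 _ (ltW lam0)) W0) G0).
  by ring.
have pt : `|p| <= (c2 + C0) * t.
  rewrite (le_trans (ler_normB _ _))// [leRHS]mulrDl lerD//.
    by rewrite normrM ger0_norm ?(ltW c20)// (ger0_norm y20) ler_pM2l.
  by rewrite (le_trans hC)// ler_peMr// ltW.
have dt : `|d| <= (kap + 2) * t.
  rewrite (le_trans (ler_normB _ _))// [leRHS]mulrDl lerD//.
    by rewrite normrM ss mulr1 gtr0_norm// ler_peMr// ltW.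
  by rewrite normrM ger0_norm// ler_pM2l.
have cC0 : 0 < c2 + C0 by lra.
have k20 : 0 < kap + 2 by lra.
have k40 : 0 < c2 + C0 + kap + 4 by lra.
have e1 : `|W * (c1 * (p * y ^+ 2 - s * (2 * y + y ^+ 2 * d)))| <=
    c1 * (c2 + C0 + kap + 4) * K0.
  apply: (@normr_weight_le _ _ _ t) => //; last by rewrite mulr_ge0// ltW.
  rewrite normrM gtr0_norm// -mulrA ler_pM2l//.
  apply: le_trans (ler_normB _ _) _.
  have -> : (c2 + C0 + kap + 4) * t ^+ 2 =
    (c2 + C0) * t * t + (2 * t ^+ 2 + t * ((kap + 2) * t)) by ring.
  rewrite lerD//.
    by rewrite normrM (ger0_norm y20) ler_pM.
  rewrite normrM ss mul1r.
  rewrite (le_trans (ler_normD _ _))// lerD//.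
    by rewrite normrM ger0_norm// ler_pM2l.
  by rewrite normrM (ger0_norm y20) ler_pM.
have e2 : `|W * (d * p + 2 * c2 * y)| <= ((kap + 2) * (c2 + C0) + 2 * c2) * K0.
  apply: (@normr_weight_le _ _ _ t) => //; last by rewrite addr_ge0 ?mulr_ge0// ltW.
  rewrite (le_trans (ler_normD _ _))// [leRHS]mulrDl lerD//.
    rewrite normrM (_ : _ * _ * _ = (kap + 2) * t * ((c2 + C0) * t)); last by ring.
    by rewrite ler_pM.
  by rewrite normrM ger0_norm ?mulr_ge0 ?(ltW c20)// ler_wpM2l// mulr_ge0// ltW.
have e3 : `|W * (p / lam)| <= (c2 + C0) * K0.
  apply: (@normr_weight_le _ _ _ t) => //; last by rewrite ltW.
  rewrite normrM (le_trans (ler_wpM2r _ pt))// normfV gtr0_norm//.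
  rewrite ler_pdivrMr// -mulrA ler_pM2l// (le_trans t2t)// ler_peMr// sqr_ge0.
  by [].
(* With this Young parameter, [lam^3] times the bound on a product is half of
   [del lam^5 N + lam V / del] (or the same with [q]), at the order [lam^5] of the main term. *)
have al0 : 0 < del * lam ^+ 2 by rewrite mulr_gt0// exprn_gt0.
have Y1 := young_le v w f k al0.
have Y2 := young_le v w g j al0.
have Y3 : `|w * f - v * k| <=
    (del * lam ^+ 2 * (f ^+ 2 + k ^+ 2) + (v ^+ 2 + w ^+ 2) / (del * lam ^+ 2)) / 2.
  have := young_le w (- v) f k al0.
  by rewrite sqrrN [w ^+ 2 + _]addrC mulNr.
have mle : `|m| <= (N + q) / 2.
  have := @young_le f k g j 1 ltr01.
  by rewrite divr1 mul1r [_ + (f ^+ 2 + _)]addrC.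
have NN : `|N| <= N by rewrite ger0_norm.
have W2 : `|W * (2 * s)| <= 2 * K0.
  by rewrite normrM normrM ss mulr1 !ger0_norm// mulrC ler_pM2l.
have W3 : `|W * 2| <= 2 * K0 by rewrite normrM !ger0_norm// mulrC ler_pM2l.
have B1 := normrM_le e1 NN; have B2 := normrM_le e2 mle.
have B3 := normrM_le e3 Y1; have B4 := normrM_le W2 Y2; have B5 := normrM_le W3 Y3.
move: B1 B2 B3 B4 B5; rewrite -/N -/q -/V.
set n1 := (del * lam ^+ 2 * N + V / (del * lam ^+ 2)) / 2.
set n2 := (del * lam ^+ 2 * q + V / (del * lam ^+ 2)) / 2.
set b1 := W * (c1 * _) * N; set b2 := W * (_ + _) * m.
set b3 := W * _ * _; set b4 := W * _ * _; set b5 := W * _ * _.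
move=> B1 B2 B3 B4 B5.
clearbody N q V m l p d.
pose S := del * lam ^+ 5 * (N + q) + lam * V / del.
have L0 n : 0 <= lam ^+ n by rewrite exprn_ge0// ltW.
have Vd0 : 0 <= lam * V / del by rewrite !mulr_ge0 ?invr_ge0// ltW.
have dN0 : 0 <= del * lam ^+ 5 * N by rewrite (mulr_ge0 (mulr_ge0 (ltW del0) (L0 _))).
have dq0 : 0 <= del * lam ^+ 5 * q by rewrite (mulr_ge0 (mulr_ge0 (ltW del0) (L0 _))).
have n10 : 0 <= n1.
  by rewrite divr_ge0// addr_ge0 ?divr_ge0 ?(mulr_ge0 (ltW al0))// ltW.
have S1 : lam ^+ 3 * n1 <= S / 2.
  rewrite (_ : lam ^+ 3 * n1 = (del * lam ^+ 5 * N + lam * V / del) / 2).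
    by move: Vd0 dN0 dq0; rewrite /S mulrDr; clear; lra.
  by rewrite /n1; field; rewrite !gt_eqF.
have S2 : lam ^+ 3 * n2 <= S / 2.
  rewrite (_ : lam ^+ 3 * n2 = (del * lam ^+ 5 * q + lam * V / del) / 2).
    by move: Vd0 dN0 dq0; rewrite /S mulrDr; clear; lra.
  by rewrite /n2; field; rewrite !gt_eqF.
have S0 : 0 <= S by move: Vd0 dN0 dq0; rewrite /S mulrDr; clear; lra.
have L3 : 1 <= lam ^+ 3 by rewrite exprn_ege1.
have C3 : b3 <= (c2 + C0) * K0 * (S / 2).
  apply: le_trans (ler_norm _) _; apply: le_trans B3 _.
  rewrite ler_wpM2l ?mulr_ge0//; first exact: ltW.
  by apply: le_trans S1; rewrite ler_peMl.
have C4 : lam ^+ 3 * b4 <= K0 * S.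
  have : lam ^+ 3 * b4 <= lam ^+ 3 * (2 * K0 * n2).
    by rewrite ler_wpM2l// (le_trans (ler_norm _)).
  have : K0 * (lam ^+ 3 * n2) <= K0 * (S / 2) by rewrite ler_wpM2l.
  by clear; lra.
have C5 : lam ^+ 3 * b5 <= K0 * S.
  have : lam ^+ 3 * b5 <= lam ^+ 3 * (2 * K0 * n1).
    by rewrite ler_wpM2l// (le_trans (ler_norm _)).
  have : K0 * (lam ^+ 3 * n1) <= K0 * (S / 2) by rewrite ler_wpM2l.
  by clear; lra.
have C1 : - (lam * (c1 * (c2 + C0 + kap + 4) * K0 * (N + q))) <= lam * b1.
  rewrite -mulrN ler_wpM2l ?(ltW lam0)//.
  move: B1; rewrite ler_norml => /andP[+ _]; apply: le_trans.
  rewrite lerN2 ler_wpM2l//; last by rewrite lerDl.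
  by rewrite (mulr_ge0 (mulr_ge0 (ltW c10) (ltW k40)) K00).
have C2 : - (lam * (((kap + 2) * (c2 + C0) + 2 * c2) * K0 * (N + q))) <= lam * b2.
  rewrite -mulrN ler_wpM2l ?(ltW lam0)//.
  move: B2; rewrite ler_norml => /andP[+ _]; apply: le_trans.
  rewrite lerN2 ler_wpM2l//; last by move: N0 q0; clear; lra.
  by rewrite mulr_ge0// addr_ge0 ?mulr_ge0// ltW.
rewrite [leRHS](_ : _ = W * (lam ^+ 5 * (s * d + p) * (q + N + 2 * s * l)) + lam * b1
  + lam * b2 - b3 - lam ^+ 3 * b4 - lam ^+ 3 * b5); last first.
  by rewrite /b1 /b2 /b3 /b4 /b5; ring.
have X : 0 <= lam * (N + q) by rewrite mulr_ge0 ?addr_ge0// ltW.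
have KX : (c1 * (c2 + C0 + kap + 4) * K0 + ((kap + 2) * (c2 + C0) + 2 * c2) * K0) * (lam * (N + q))
    <= K * (lam * (N + q)).
  rewrite ler_wpM2r// /K /weight_const -subr_ge0.
  rewrite (_ : _ - _ = K0 * (c2 + C0 + kap + 7)); last by ring.
  by rewrite mulr_ge0//; move: c20 C00 kap0; clear; lra.
have KS : (c2 + C0) * K0 * (S / 2) + 2 * (K0 * S) <= K * S.
  rewrite -subr_ge0 /K /weight_const.
  rewrite (_ : _ - _ = K0 * S * ((c2 + C0) / 2 + kap + 5 + c1 * (c2 + C0 + kap + 4)
     + (kap + 2) * (c2 + C0) + 2 * c2)); last by field.
  have k5 : 0 <= c1 * (c2 + C0 + kap + 4) by rewrite mulr_ge0 ?ltW.
  have k6 : 0 <= (kap + 2) * (c2 + C0) by rewrite mulr_ge0 ?ltW.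
  by rewrite (mulr_ge0 (mulr_ge0 K00 S0))//; move: c20 C00 kap0 k5 k6; clear; lra.
have -> : K * del * lam ^+ 5 * (N + q) + K * lam * V / del = K * S.
  by rewrite /S; ring.
move: T1 C1 C2 C3 C4 C5 KX KS; clear; lra.
Qed.

(** Where [c2 y^2 < C0 + 1] one has [|y| <= Y] for [Y = 1 + (C0 + 1) / c2], and both weights are at
    least [exp (- kap Y - Y^2)]. The factor [1 + C0] compensates [c2 y^2 - h], which may be as low
    as [- C0]. *)
Definition localization_const (c2 C0 kap : R) : R :=
  (1 + C0) * expR (kap * (1 + (C0 + 1) / c2) + (1 + (C0 + 1) / c2) ^+ 2).

Lemma localization_const_ge1 (c2 C0 kap : R) : 0 < c2 -> 0 < C0 -> 0 < kap ->
  1 <= localization_const c2 C0 kap.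
Proof.
move=> c20 C00 kap0; rewrite /localization_const.
have Y0 : 0 <= 1 + (C0 + 1) / c2 by rewrite addr_ge0 ?divr_ge0//; lra.
rewrite mulr_ege1//; first by lra.
by rewrite -[leLHS]expR0 ler_expR addr_ge0 ?sqr_ge0 ?mulr_ge0// ltW.
Qed.

(** Two regimes. If [c2 y^2 >= C0 + 1], then [c2 y^2 - h >= 1] and the last term suffices. Otherwise
    both weights are bounded below, and the two squares add up to [2 (q + N)]. *)
Lemma localization_pointwise (c2 C0 kap h y f k g j : R) :
  0 < c2 -> 0 < C0 -> 0 < kap -> `|h| <= C0 ->
  let N := f ^+ 2 + k ^+ 2 in let q := g ^+ 2 + j ^+ 2 in
  let l := f * j - k * g in
  is_true (2 * N <= localization_const c2 C0 kap *
    (expR (kap * y - y ^+ 2) * (q + N + 2 * 1 * l) +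
     expR (kap * - y - y ^+ 2) * (q + N + 2 * -1 * l)) +
    2 * (c2 * y ^+ 2 - h) * N).
Proof.
move=> c20 C00 kap0 hC N q l.
have A1 := localization_const_ge1 c20 C00 kap0.
have N0 : 0 <= N by rewrite addr_ge0 ?sqr_ge0.
have Gp : 0 <= q + N + 2 * 1 * l.
  rewrite (_ : _ + _ = (g - k) ^+ 2 + (j + f) ^+ 2); first by rewrite addr_ge0 ?sqr_ge0.
  by rewrite /q /N /l; ring.
have Gm : 0 <= q + N + 2 * -1 * l.
  rewrite (_ : _ + _ = (g + k) ^+ 2 + (j - f) ^+ 2); first by rewrite addr_ge0 ?sqr_ge0.
  by rewrite /q /N /l; ring.
have GG : (q + N + 2 * 1 * l) + (q + N + 2 * -1 * l) = 2 * (q + N) by ring.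
have q0 : 0 <= q by rewrite addr_ge0 ?sqr_ge0.
have hC' : h <= C0 by rewrite (le_trans (ler_norm _)).
move: Gp Gm GG; set gp := q + N + 2 * 1 * l; set gm := q + N + 2 * -1 * l => Gp Gm GG.
clearbody gp gm N q.
have [yC|yC] := leP (C0 + 1) (c2 * y ^+ 2).
  rewrite (@le_trans _ _ (2 * (c2 * y ^+ 2 - h) * N))//.
    by rewrite ler_wpM2r//; move: yC hC'; clear; lra.
  rewrite lerDr; apply: mulr_ge0; first exact: le_trans A1.
  by rewrite addr_ge0 ?(mulr_ge0 (expR_ge0 _)).
pose Y := 1 + (C0 + 1) / c2.
have e0 : 0 < (C0 + 1) / c2 by rewrite divr_gt0//; lra.
have y2e : y ^+ 2 <= (C0 + 1) / c2 by rewrite ler_pdivlMr// mulrC ltW.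
have yY : `|y| <= Y.
  rewrite ler_norml /Y; move: e0 y2e; clear; set e := (_ / _) => e0 y2e.
  by apply/andP; split; have := sqr_ge0 (y + 1 / 2); have := sqr_ge0 (y - 1 / 2); lra.
have y2Y : y ^+ 2 <= Y ^+ 2.
  by rewrite -[leLHS]real_normK ?num_real// ler_sqr ?nnegrE// (le_trans (normr_ge0 y)).
have Wlow z : `|z| <= Y -> 1 + C0 <=
    localization_const c2 C0 kap * expR (kap * z - y ^+ 2).
  move=> zY; rewrite /localization_const -/Y -mulrA -expRD ler_peMr//.
    by move: C00; clear; lra.
  rewrite -[leLHS]expR0 ler_expR.
  have : - Y <= z by move: zY; rewrite ler_norml => /andP[].
  by rewrite -(ler_pM2l kap0); move: y2Y; clear; lra.
have Wp := Wlow _ yY.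
have Wm : 1 + C0 <= localization_const c2 C0 kap * expR (kap * - y - y ^+ 2).
  by apply: Wlow; rewrite normrN.
have C10 : 0 <= 1 + C0 by lra.
rewrite mulrDr 2!mulrA.
have P1 : (1 + C0) * gp <= localization_const c2 C0 kap * expR (kap * y - y ^+ 2) * gp.
  by rewrite ler_wpM2r.
have P2 : (1 + C0) * gm <= localization_const c2 C0 kap * expR (kap * - y - y ^+ 2) * gm.
  by rewrite ler_wpM2r.
have P3 : (1 + C0) * (gp + gm) = (1 + C0) * (2 * (q + N)) by rewrite GG.
have P4 : - (C0 * N) <= (c2 * y ^+ 2 - h) * N.
  rewrite -mulNr ler_wpM2r// lerNl opprB (le_trans _ hC')// gerBl.
  by rewrite mulr_ge0 ?sqr_ge0// ltW.
have P5 : 0 <= C0 * q by rewrite mulr_ge0// ltW.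
by move: P1 P2 P3 P4 P5 q0; clear; lra.
Qed.

Definition flux_const (c1 c2 C0 kap : R) : R :=
  weight_const c1 c2 C0 kap (16 * expR (kap ^+ 2 / 2)).

(** The derivative at [x = lam y] of the quantity [Phi s] below, after second derivatives are
    eliminated through the equation; [(g, j)] stands for [u' / lam^3]. *)
Definition flux_rhs (c1 c2 kap lam s h W y f k g j v w : R) : R :=
  let N := f ^+ 2 + k ^+ 2 in let q := g ^+ 2 + j ^+ 2 in
  let m := f * g + k * j in
  let l := f * j - k * g in let p := c2 * y ^+ 2 - h in
  let d := kap * s - 2 * y in
  W * (lam ^+ 5 * (s * d + p) * (q + N + 2 * s * l)
    + lam * c1 * (p * y ^+ 2 - s * (2 * y + y ^+ 2 * d)) * N
    + lam * (d * p + 2 * c2 * y) * m - p / lam * (v * f + w * k)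
    - 2 * lam ^+ 3 * s * (v * g + w * j) - 2 * lam ^+ 3 * (w * f - v * k)).

End pointwise_bounds.

(** * Lower bound for the combined flux *)

Section total_flux.
Context {R : realType}.
Implicit Types (y h W s f k g j v w : R).

(** Multiples of [m'] and [l'] are added to the two fluxes. The [l'] term completes the localization
    to [2 N]; the [m'] term, which contains [lam^5 (q - N)], trades half of this for [q], so that
    [lam^5 / A] times [N + q] is available to absorb errors in both. *)
Lemma total_flux_pointwise (c1 c2 C0 kap lam h y f k g j v w : R) :
  0 < c1 -> 0 < c2 -> 0 < C0 -> kap = C0 + 1 + c2^-1 -> 1 <= lam ->
  let K := flux_const c1 c2 C0 kap in let A := localization_const c2 C0 kap in
  8 * K * A <= lam ^+ 4 -> `|h| <= C0 ->
  let N := f ^+ 2 + k ^+ 2 in let q := g ^+ 2 + j ^+ 2 in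
  let V := v ^+ 2 + w ^+ 2 in
  is_true (lam ^+ 5 / (2 * A) * N - 4 * A * (2 * K + 2) ^+ 2 * lam * V <=
    flux_rhs c1 c2 kap lam 1 h (expR (kap * y - y ^+ 2)) y f k g j v w +
    flux_rhs c1 c2 kap lam (-1) h (expR (kap * - y - y ^+ 2)) y f k g j v w +
    A^-1 * (lam ^+ 5 * (q - N) + c1 * lam * y ^+ 2 * N - (v * f + w * k) / lam) +
    2 * A^-1 * (lam ^+ 5 * (c2 * y ^+ 2 - h) * N - lam ^+ 3 * (w * f - v * k))).
Proof.
move=> c10 c20 C00 kapE lam1 K A lamK hC N q V.
have lam0 : 0 < lam by lra.
have ci0 : 0 < c2^-1 by rewrite invr_gt0.
have kap0 : 0 < kap by rewrite kapE; lra.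
have A1 : 1 <= A := localization_const_ge1 c20 C00 kap0.
have A0 : 0 < A by lra.
have K0 : 0 <= K.
  rewrite /K /flux_const /weight_const mulr_ge0 ?mulr_ge0 ?expR_ge0//.
  by rewrite !addr_ge0 ?mulr_ge0 ?addr_ge0// ltW.
(* The two fluxes cost [2 K] times the Young error and the two added identities less than twice it.
   This [del] makes the total cost in [N + q] equal to [lam^5 / (4 A)]; the hypothesis on [lam^4]
   limits the errors of order [lam] to as much, and half of the main term survives. *)
pose del := (4 * A * (2 * K + 2))^-1.
have K2 : 0 < 2 * K + 2 by lra.
have del0 : 0 < del by rewrite invr_gt0 (mulr_gt0 (mulr_gt0 _ A0) K2).
have Wp := gauss_weight_bound kap y.
have Wm := gauss_weight_bound kap (- y); rewrite sqrrN in Wm.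
have Fp := flux_pointwise f k g j v w c10 c20 C00 kapE lam1 del0 (or_introl erefl)
  hC (expR_ge0 _) Wp.
have Fm := flux_pointwise f k g j v w c10 c20 C00 kapE lam1 del0 (or_intror erefl)
  hC (expR_ge0 _) Wm.
have Loc : 2 * N <= A *
    (expR (kap * y - y ^+ 2) * (q + N + 2 * 1 * (f * j - k * g)) +
     expR (kap * - y - y ^+ 2) * (q + N + 2 * -1 * (f * j - k * g))) +
    2 * (c2 * y ^+ 2 - h) * N.
  exact: localization_pointwise.
move: Fp Fm Loc; rewrite -/(flux_const c1 c2 C0 kap) -/K -/A -/N -/q -/V.
rewrite -[W in _ <= W -> _]/(flux_rhs c1 c2 kap lam 1 h (expR (kap * y - y ^+ 2)) y f k g j v w).
rewrite -[W in _ -> _ <= W -> _]/(flux_rhs c1 c2 kap lam (-1) h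
  (expR (kap * - y - y ^+ 2)) y f k g j v w).
set Rp := flux_rhs _ _ _ _ 1 _ _ _ _ _ _ _ _ _.
set Rm := flux_rhs _ _ _ _ (-1) _ _ _ _ _ _ _ _ _.
set gp := q + N + 2 * 1 * _; set gm := q + N + 2 * -1 * _.
set Ep := expR _; set Em := expR _.
have L0 n : 0 <= lam ^+ n by rewrite exprn_ge0// ltW.
have N0 : 0 <= N by rewrite addr_ge0 ?sqr_ge0.
have q0 : 0 <= q by rewrite addr_ge0 ?sqr_ge0.
have V0 : 0 <= V by rewrite addr_ge0 ?sqr_ge0.
have al0 : 0 < del * lam ^+ 2 by rewrite mulr_gt0// exprn_gt0.
have Y1 := young_le v w f k al0.
have Y3 : `|w * f - v * k| <=
    (del * lam ^+ 2 * (f ^+ 2 + k ^+ 2) + (v ^+ 2 + w ^+ 2) / (del * lam ^+ 2)) / 2.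
  have := young_le w (- v) f k al0.
  by rewrite sqrrN [w ^+ 2 + _]addrC mulNr.
move: Y1 Y3; rewrite -/N -/V.
set rho := v * f + w * k; set sg := w * f - v * k.
clearbody Rp Rm gp gm Ep Em N q V rho sg K A.
set n1 := (_ + _) / 2 => Y1 Y3 Fp Fm Loc.
pose S := del * lam ^+ 5 * (N + q) + lam * V / del.
have Vd0 : 0 <= lam * V / del := divr_ge0 (mulr_ge0 (ltW lam0) V0) (ltW del0).
have dN0 : 0 <= del * lam ^+ 5 * N by rewrite (mulr_ge0 (mulr_ge0 (ltW del0) (L0 _))).
have dq0 : 0 <= del * lam ^+ 5 * q by rewrite (mulr_ge0 (mulr_ge0 (ltW del0) (L0 _))).
have S1 : lam ^+ 3 * n1 <= S / 2.
  rewrite (_ : lam ^+ 3 * n1 = (del * lam ^+ 5 * N + lam * V / del) / 2).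
    by move: Vd0 dN0 dq0; rewrite /S mulrDr; clear; lra.
  by rewrite /n1; field; rewrite !gt_eqF.
have S0 : 0 <= S by move: Vd0 dN0 dq0; rewrite /S mulrDr; clear; lra.
have L3 : 1 <= lam ^+ 3 by rewrite exprn_ege1.
have n10 : 0 <= n1 by exact: le_trans (normr_ge0 _) Y1.
have Ai1 : A^-1 <= 1 by rewrite invf_le1.
have Ai0 : 0 <= A^-1 by rewrite invr_ge0 ltW.
have C1 : A^-1 * (rho / lam) <= S / 2.
  have H : rho / lam <= S / 2.
    apply: le_trans S1; rewrite ler_pdivrMr//.
    apply: le_trans (le_trans (ler_norm _) Y1) _.
    by rewrite mulrAC ler_peMl// -exprSr exprn_ege1.
  have [r0|r0] := leP 0 (rho / lam); first by apply: le_trans H; rewrite ler_piMl.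
  apply: (@le_trans _ _ 0); last exact: divr_ge0.
  by rewrite mulr_ge0_le0// ltW.
have C2 : 2 * A^-1 * (lam ^+ 3 * sg) <= S.
  have H : lam ^+ 3 * sg <= S / 2.
    by apply: le_trans S1; rewrite ler_wpM2l// (le_trans (ler_norm _)).
  have [r0|r0] := leP 0 (lam ^+ 3 * sg).
    have : A^-1 * (lam ^+ 3 * sg) <= S / 2 by apply: le_trans H; rewrite ler_piMl.
    by clear; lra.
  apply: (@le_trans _ _ 0) => //; rewrite mulr_ge0_le0 ?(ltW r0)//.
  exact: mulr_ge0.
have C3 : 0 <= A^-1 * (c1 * lam * y ^+ 2 * N).
  exact: mulr_ge0 Ai0 (mulr_ge0 (mulr_ge0 (mulr_ge0 (ltW c10) (ltW lam0)) (sqr_ge0 y)) N0).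
have C4 : 2 * (lam ^+ 5 / A) * N <= lam ^+ 5 * (Ep * gp + Em * gm) +
    2 * (lam ^+ 5 / A) * (c2 * y ^+ 2 - h) * N.
  have LA : 0 <= lam ^+ 5 / A by rewrite divr_ge0// ltW.
  have := ler_wpM2l LA Loc.
  rewrite (_ : lam ^+ 5 / A * (2 * N) = 2 * (lam ^+ 5 / A) * N); last by ring.
  move=> /le_trans; apply; rewrite le_eqVlt; apply/orP; left; apply/eqP.
  by field; rewrite gt_eqF.
have C5 : 2 * K * (lam * (N + q)) <= lam ^+ 5 / (4 * A) * (N + q).
  rewrite mulrA ler_wpM2r ?addr_ge0//.
  rewrite ler_pdivlMr ?mulr_gt0// [leLHS](_ : _ = lam * (8 * K * A)); last by ring.
  by rewrite exprS ler_wpM2l// ltW.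
have C6 : (2 * K + 2) * S = lam ^+ 5 / (4 * A) * (N + q) +
    4 * A * (2 * K + 2) ^+ 2 * lam * V.
  by rewrite /S /del; field; rewrite !gt_eqF.
have e1 : K * del * lam ^+ 5 * (N + q) + K * lam * V / del = K * S by rewrite /S; ring.
move: Fp Fm; rewrite e1 => Fp Fm.
have e2 : lam ^+ 5 / (2 * A) = 2 * (lam ^+ 5 / (4 * A)) by field; rewrite gt_eqF.
have e3 : lam ^+ 5 / A = 4 * (lam ^+ 5 / (4 * A)) by field; rewrite gt_eqF.
have C7 : 0 <= lam ^+ 5 / (4 * A) * q by rewrite mulr_ge0// divr_ge0// mulr_ge0// ltW.
rewrite e2.
rewrite (_ : A^-1 * _ = lam ^+ 5 / A * (q - N) + A^-1 * (c1 * lam * y ^+ 2 * N)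
  - A^-1 * (rho / lam)); last by ring.
rewrite (_ : 2 * A^-1 * _ = 2 * (lam ^+ 5 / A) * (c2 * y ^+ 2 - h) * N -
  2 * A^-1 * (lam ^+ 3 * sg)); last by ring.
move: C1 C2 C3 C4 C5 C6 C7 Fp Fm S0; rewrite e3.
set L := lam ^+ 5 / (4 * A); set X1 := A^-1 * _; set X2 := 2 * A^-1 * _.
set X3 := A^-1 * _; clear; lra.
Qed.

End total_flux.

Lemma normr_le1Dsqr (R : realType) (y : R) : `|y| <= 1 + y ^+ 2.
Proof.
by rewrite ler_norml; apply/andP; split;
  have := sqr_ge0 (y + 1/2); have := sqr_ge0 (y - 1/2); lra.
Qed.

(** * Integration of the flux identities *)

Section a_priori.
Context {R : realType}.
Local Notation mu := (@lebesgue_measure R).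
Local Notation intg A f := (mu.-integrable (A : set R) (EFin \o f)).
Variables (c1 c2 C0 lam eta : R) (f k f1 k1 v w : R -> R).
Hypotheses (c10 : 0 < c1) (c20 : 0 < c2) (C00 : 0 < C0) (lam1 : 1 <= lam).
Hypothesis etaC : `|eta| <= C0 * lam ^+ 2.
Hypotheses (ff1 : primitive f f1) (kk1 : primitive k k1).
Hypothesis f1f2 : primitive f1
  (fun x => (c1 * x ^+ 2 - lam ^+ 6) * f x - (c2 * x ^+ 2 - eta) * k x - v x).
Hypothesis k1k2 : primitive k1
  (fun x => (c1 * x ^+ 2 - lam ^+ 6) * k x + (c2 * x ^+ 2 - eta) * f x - w x).
Hypotheses (sf : sqi f) (sk : sqi k) (sf1 : sqi f1) (sk1 : sqi k1)
  (sxf : sqi (fun x => x * f x)) (sxk : sqi (fun x => x * k x))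
  (sv : sqi v) (sw : sqi w).

Let kap := C0 + 1 + c2^-1.
Let h := eta / lam ^+ 2.

Let lam0 : 0 < lam. Proof. exact: lt_le_trans lam1. Qed.

Let weight s x := expR (kap * (s * (x / lam)) - (x / lam) ^+ 2).

Let is_derive_continuous (F F' : R -> R) :
  (forall x : R, is_derive x 1 F (F' x)) -> continuous F.
Proof.
by move=> dF x; apply/differentiable_continuous/derivable1_diffP; case: (dF x).
Qed.

Let is_derive_weight s (x : R) : is_derive x 1 (weight s)
  ((kap * s / lam - 2 * x / lam ^+ 2) * weight s x).
Proof.
pose u (x : R) := kap * (s * (x / lam)) - (x / lam) ^+ 2.
have du : is_derive x 1 u (kap * s / lam - 2 * x / lam ^+ 2).
  rewrite (_ : u = fun x => (kap * s / lam) * x - (lam ^- 2) * x ^+ 2).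
    by apply: is_derive_eq; rewrite /GRing.scale/=; field; rewrite gt_eqF.
  by apply/funext => y; rewrite /u; field; rewrite gt_eqF.
have := is_derive1_comp (is_derive_expR (u x)) du.
by rewrite mulrC.
Qed.

Let weight_cont s : continuous (weight s).
Proof.
exact: is_derive_continuous (is_derive_weight s).
Qed.

Let primitive_weight s : primitive (weight s)
  (fun x => (kap * s / lam - 2 * x / lam ^+ 2) * weight s x).
Proof.
apply: primitive_C1; first exact: is_derive_weight.
have dA (x : R) : is_derive x 1 (fun y : R => kap * s / lam - 2 * y / lam ^+ 2)
    (- 2 / lam ^+ 2).
  by apply: is_derive_eq; rewrite /GRing.scale/=; field; rewrite gt_eqF.
move=> x; apply: cvgM; last exact: weight_cont.
exact: (is_derive_continuous dA).
Qed.

(** [Phi] and [flux] are sums of integrable quadratic expressions in [u], [u'], [v], with the weight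
    times a polynomial of degree at most four in [x / lam] in front. This bound gives the
    integrability of them all. *)
Let intg_weight s (e0 e1 e2 e3 e4 : R) F : s = 1 \/ s = -1 -> intg setT F ->
  intg setT (fun x => weight s x * (e0 + e1 * (x / lam) + e2 * (x / lam) ^+ 2
    + e3 * (x / lam) ^+ 3 + e4 * (x / lam) ^+ 4) * F x).
Proof.
move=> s1 Fi.
apply: (@intg_bound _ _ _ _ ((`|e0| + `|e1| + `|e2| + `|e3| + `|e4|)
   * (16 * expR (kap ^+ 2 / 2)))) => //.
  apply: measurable_funM; first exact: continuous_measurable_fun.
  by repeat (apply: measurable_funD || apply: measurable_funM || apply: measurable_funX).
move=> x _; set y := x / lam.
have := gauss_weight_bound kap (s * y).
have -> : (s * y) ^+ 2 = y ^+ 2 by case: s1 => ->; ring.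
rewrite -/(weight s x) => Wb.
set t := 1 + y ^+ 2 in Wb.
have t1 : 1 <= t by rewrite /t lerDl sqr_ge0.
have t0 : 0 <= t by exact: le_trans t1.
have t2t : t <= t ^+ 2 by rewrite expr2 ler_peMr.
have yt : `|y| <= t by exact: normr_le1Dsqr.
have y2t : `|y| ^+ 2 <= t by rewrite real_normK ?num_real// /t lerDr.
apply: normr_weight_le Wb _ _; rewrite ?expR_ge0//.
apply: le_trans (ler_normD _ _) _; rewrite mulrDl lerD//; last first.
  rewrite normrM normrX ler_wpM2l// -[4%N]/(2 * 2)%N exprM ler_pXn2r ?nnegrE//.
apply: le_trans (ler_normD _ _) _; rewrite mulrDl lerD//; last first.
  rewrite normrM normrX ler_wpM2l// exprS expr2.
  by apply: ler_pM => //; rewrite mulr_ge0.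
apply: le_trans (ler_normD _ _) _; rewrite mulrDl lerD//; last first.
  by rewrite normrM normrX ler_wpM2l// (le_trans y2t).
apply: le_trans (ler_normD _ _) _; rewrite mulrDl lerD//; last first.
  by rewrite normrM ler_wpM2l// (le_trans yt).
by rewrite ler_peMr// (le_trans t1).
Qed.

Let flux s x := flux_rhs c1 c2 kap lam s h (weight s x) (x / lam) (f x) (k x)
  (f1 x / lam ^+ 3) (k1 x / lam ^+ 3) (v x) (w x).

Let N x := f x ^+ 2 + k x ^+ 2.
Let Q x := f1 x ^+ 2 + k1 x ^+ 2.
Let m x := f x * f1 x + k x * k1 x.
Let l x := f x * k1 x - k x * f1 x.

Let Ni : intg setT N. Proof. by apply: intgD => //; [case: sf|case: sk]. Qed.
Let Qi : intg setT Q. Proof. by apply: intgD => //; [case: sf1|case: sk1]. Qed.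
Let mi : intg setT m. Proof. by apply: intgD => //; exact: sqiM. Qed.
Let li : intg setT l. Proof. by apply: intgB => //; exact: sqiM. Qed.
Let rhoi : intg setT (fun x => v x * f x + w x * k x).
Proof. by apply: intgD => //; exact: sqiM. Qed.
Let rho1i : intg setT (fun x => v x * f1 x + w x * k1 x).
Proof. by apply: intgD => //; exact: sqiM. Qed.
Let sgi : intg setT (fun x => w x * f x - v x * k x).
Proof. by apply: intgB => //; exact: sqiM. Qed.
Let x2Ni : intg setT (fun x => x ^+ 2 * N x).
Proof.
have [_ i1] := sxf; have [_ i2] := sxk.
by apply: eq_intg (intgD measurableT i1 i2) => // x _; rewrite /N; ring.
Qed.

Let flux_intg s : s = 1 \/ s = -1 -> intg setT (flux s).
Proof.
move=> s1; have iw e0 e1 e2 e3 e4 F (Fi : intg setT F) := intg_weight e0 e1 e2 e3 e4 s1 Fi.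
have j1 := iw ((kap * s * s - h) / lam) (- 2 * s / lam) (c2 / lam) 0 0 _ Qi.
have j2 := iw (lam ^+ 5 * (kap * s * s - h)) (- 2 * s * (lam ^+ 5 + lam * c1))
  (lam ^+ 5 * c2 - lam * c1 * (h + kap * s * s)) (lam * c1 * 2 * s) (lam * c1 * c2) _ Ni.
have j3 := iw (- kap * s * h / lam ^+ 2) (2 * (h + c2) / lam ^+ 2)
  (kap * s * c2 / lam ^+ 2) (- 2 * c2 / lam ^+ 2) 0 _ mi.
have j4 := iw (lam ^+ 2 * 2 * s * (kap * s * s - h)) (lam ^+ 2 * 2 * s * (- 2 * s))
  (lam ^+ 2 * 2 * s * c2) 0 0 _ li.
have j5 := iw (h / lam) 0 (- c2 / lam) 0 0 _ rhoi.
have j6 := iw (- 2 * s) 0 0 0 0 _ rho1i.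
have j7 := iw (- 2 * lam ^+ 3) 0 0 0 0 _ sgi.
have := intgD measurableT (intgD measurableT (intgD measurableT (intgD measurableT
  (intgD measurableT (intgD measurableT j1 j2) j3) j4) j5) j6) j7.
apply: eq_intg => // x _; rewrite /flux /flux_rhs /N /Q /m /l /=.
by set W := weight s x; clearbody W; field; rewrite gt_eqF.
Qed.

(* [Q + lam^6 N + 2 s lam^3 l = |u' + i s lam^3 u|^2]; the term in [m] turns the
   part of the derivative coming from [c2 x^2 - eta] into a multiple of this square,
   and the last term cancels [2 s c1 x^2 m]. *)
Let Phi s x := s * (weight s x * (Q x + lam ^+ 6 * N x + 2 * s * lam ^+ 3 * l x))
  + weight s x * (c2 * x ^+ 2 - eta) * m x / lam ^+ 3
  - s * (c1 * (x ^+ 2 * (weight s x * N x))).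

Let Phi_intg s : s = 1 \/ s = -1 -> intg setT (Phi s).
Proof.
move=> s1; have iw e0 e1 e2 e3 e4 F (Fi : intg setT F) := intg_weight e0 e1 e2 e3 e4 s1 Fi.
have j1 := iw s 0 0 0 0 _ Qi.
have j2 := iw (s * lam ^+ 6) 0 (- s * c1 * lam ^+ 2) 0 0 _ Ni.
have j3 := iw (- eta / lam ^+ 3) 0 (c2 * lam ^+ 2 / lam ^+ 3) 0 0 _ mi.
have j4 := iw (2 * s * s * lam ^+ 3) 0 0 0 0 _ li.
have := intgD measurableT (intgD measurableT (intgD measurableT j1 j2) j3) j4.
apply: eq_intg => // x _; rewrite /Phi /=.
by set W := weight s x; clearbody W; field; rewrite gt_eqF.
Qed.

Let primitive_sqr : primitive (fun x : R => x ^+ 2) (fun x => 2 * x).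
Proof.
apply: primitive_C1 => [x|x].
  by apply: is_derive_eq; rewrite /GRing.scale/=; ring.
by apply: cvgM; [exact: cvg_cst|exact: cvg_id].
Qed.

Let primitive_cst (a : R) : primitive (fun=> a) (fun=> 0).
Proof. by apply: primitive_C1; exact: cst_continuous. Qed.

Let primitive_Phi s : s = 1 \/ s = -1 -> primitive (Phi s) (flux s).
Proof.
move=> s1.
have pN := primitiveD (primitiveM ff1 ff1) (primitiveM kk1 kk1).
have pQ := primitiveD (primitiveM f1f2 f1f2) (primitiveM k1k2 k1k2).
have pm := primitiveD (primitiveM ff1 f1f2) (primitiveM kk1 k1k2).
have pl := primitiveB (primitiveM ff1 k1k2) (primitiveM kk1 f1f2).
have pG := primitiveD (primitiveD pQ (primitiveZ (lam ^+ 6) pN))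
  (primitiveZ (2 * s * lam ^+ 3) pl).
have p1 := primitiveZ s (primitiveM (primitive_weight s) pG).
have pp := primitiveB (primitiveZ c2 primitive_sqr) (primitive_cst eta).
have p2 := primitiveZ (lam ^- 3) (primitiveM (primitiveM (primitive_weight s) pp) pm).
have p3 := primitiveZ s (primitiveZ c1 (primitiveM primitive_sqr
  (primitiveM (primitive_weight s) pN))).
apply: eq_primitive (primitiveB (primitiveD p1 p2) p3) _ _ => x /=.
  by rewrite /Phi /N /Q /m /l; ring.
rewrite /flux /flux_rhs /h; set W := weight s x; clearbody W.
(* The identity uses [s^2 = 1], hence the substitution of each sign. *)
by case: s1 => ->; field; rewrite gt_eqF.
Qed.

(** [P] combines both [Phi], [m] and [l] so that its derivative [T] is the expression bounded in
    [total_flux_pointwise]. Both are integrable, so [T] has integral zero, and its pointwise lower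
    bound integrates to the estimate. *)
Lemma a_priori_pos : 8 * flux_const c1 c2 C0 kap * localization_const c2 C0 kap <= lam ^+ 4 ->
  lam ^+ 4 * \int[mu]_x (f x ^+ 2 + k x ^+ 2) <=
  8 * localization_const c2 C0 kap ^+ 2 * (2 * flux_const c1 c2 C0 kap + 2) ^+ 2 *
    \int[mu]_x (v x ^+ 2 + w x ^+ 2).
Proof.
set K := flux_const _ _ _ _; set A := localization_const _ _ _ => lamK.
have kap0 : 0 < kap by rewrite /kap !addr_gt0 ?invr_gt0.
have A1 : 1 <= A := localization_const_ge1 c20 C00 kap0.
have A0 : 0 < A by exact: lt_le_trans A1.
have pm := primitiveD (primitiveM ff1 f1f2) (primitiveM kk1 k1k2).
have pl := primitiveB (primitiveM ff1 k1k2) (primitiveM kk1 f1f2).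
have s1 : (1 : R) = 1 \/ (1 : R) = -1 by left.
have sN1 : (-1 : R) = 1 \/ (-1 : R) = -1 by right.
pose T x := flux 1 x + flux (-1) x
  + A^-1 * (lam ^+ 5 * (Q x / lam ^+ 6 - N x) + c1 * lam * (x / lam) ^+ 2 * N x
     - (v x * f x + w x * k x) / lam)
  + 2 * A^-1 * (lam ^+ 5 * (c2 * (x / lam) ^+ 2 - h) * N x
     - lam ^+ 3 * (w x * f x - v x * k x)).
pose P x := Phi 1 x + Phi (-1) x + A^-1 / lam * m x + 2 * A^-1 * lam ^+ 3 * l x.
have PT : primitive P T.
  apply: eq_primitive (primitiveD (primitiveD (primitiveD (primitive_Phi s1)
    (primitive_Phi sN1)) (primitiveZ (A^-1 / lam) pm))
    (primitiveZ (2 * A^-1 * lam ^+ 3) pl)) _ _ => x //=.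
  rewrite /T /N /Q /h; set F1 := flux 1 x; set F2 := flux (-1) x.
  by clearbody F1 F2 A; field; rewrite !gt_eqF.
have Pi : intg setT P.
  apply: intgD => //; last exact: intgZ.
  apply: intgD => //; last exact: intgZ.
  by apply: intgD => //; exact: Phi_intg.
have Ti : intg setT T.
  have j1 := intgD measurableT (flux_intg s1) (flux_intg sN1).
  have j2 := intgZ (A^-1 / lam) measurableT Qi.
  have j3 := intgZ (- (A^-1 * lam ^+ 5) - 2 * A^-1 * lam ^+ 5 * h) measurableT Ni.
  have j4 := intgZ (A^-1 * c1 / lam + 2 * A^-1 * lam ^+ 3 * c2) measurableT x2Ni.
  have j5 := intgZ (- A^-1 / lam) measurableT rhoi.
  have j6 := intgZ (- 2 * A^-1 * lam ^+ 3) measurableT sgi.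
  have := intgD measurableT (intgD measurableT (intgD measurableT (intgD measurableT
    (intgD measurableT j1 j2) j3) j4) j5) j6.
  apply: eq_intg => // x _; rewrite /T; set F1 := flux 1 x; set F2 := flux (-1) x.
  by clearbody F1 F2 A; field; rewrite !gt_eqF.
have Vi : intg setT (fun x => v x ^+ 2 + w x ^+ 2).
  by apply: intgD => //; [case: sv|case: sw].
have hC : `|h| <= C0.
  by rewrite /h normrM normfV (ger0_norm (sqr_ge0 lam)) ler_pdivrMr// exprn_gt0.
pose a := lam ^+ 5 / (2 * A); pose b := 4 * A * (2 * K + 2) ^+ 2 * lam.
have low x : a * N x - b * (v x ^+ 2 + w x ^+ 2) <= T x.
  have := total_flux_pointwise (x / lam) (f x) (k x) (f1 x / lam ^+ 3)
    (k1 x / lam ^+ 3) (v x) (w x) c10 c20 C00 erefl lam1 lamK hC.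
  rewrite -/kap -/K -/A -/(N x) -/a -/b /T /flux /weight mul1r mulN1r.
  by rewrite (_ : (f1 x / _) ^+ 2 + _ = Q x / lam ^+ 6)// /Q; field; rewrite gt_eqF.
have := primitive_Rintegral0 PT Pi Ti.
have LB : \int[mu]_x (a * N x - b * (v x ^+ 2 + w x ^+ 2)) <= \int[mu]_x T x.
  by apply: le_Rintegral => //; apply: intgB => //; exact: intgZ.
move=> T0; move: LB; rewrite T0 RintegralB//; [|exact: intgZ|exact: intgZ].
rewrite !RintegralZl// subr_le0 /a /b -/N.
set n2 := \int[mu]_x _; set V2 := \int[mu]_x _ => H.
have E : lam * (lam ^+ 4 * n2) <= lam * (8 * A ^+ 2 * (2 * K + 2) ^+ 2 * V2).
  have A2 : 0 <= 2 * A by rewrite mulr_ge0// ltW.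
  have := ler_wpM2l A2 H; clearbody A n2 V2 K.
  rewrite (_ : 2 * A * (_ * n2) = lam * (lam ^+ 4 * n2)); last first.
    by field; rewrite gt_eqF.
  by move=> /le_trans; apply; rewrite le_eqVlt; apply/orP; left; apply/eqP; ring.
by move: E; rewrite ler_pM2l.
Qed.

End a_priori.

(** * Hilbert spaces *)

(* The form need not be definite, since functions that agree almost everywhere are
   not identified. *)
Record semi_hilbert {R : realType} {V : lmodType R} (D : set V) (ip : V -> V -> R) :
    Prop := SemiHilbert {
  sh_DL : forall (a : R) u v, D u -> D v -> D (a *: u + v);
  sh_D0 : D 0;
  sh_C : forall u v, D u -> D v -> ip u v = ip v u;
  sh_L : forall (a : R) u v w, D u -> D v -> D w ->
    ip (a *: u + v) w = a * ip u w + ip v w;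
  sh_ge0 : forall u, D u -> 0 <= ip u u;
  sh_complete : forall u_ : nat -> V, (forall n, D (u_ n)) ->
    (forall e, 0 < e -> exists n0 : nat, forall i j, (n0 <= i)%N -> (n0 <= j)%N ->
      ip (u_ i - u_ j) (u_ i - u_ j) <= e) ->
    exists2 u, D u & forall e, 0 < e -> exists n0 : nat, forall i, (n0 <= i)%N ->
      ip (u_ i - u) (u_ i - u) <= e }.

Section semi_hilbert.
Context {R : realType} {V : lmodType R}.
Variables (D : set V) (ip : V -> V -> R).
Hypothesis shD : semi_hilbert D ip.
Let DL := sh_DL shD.
Let D0 := sh_D0 shD.
Let ipC := sh_C shD.
Let ipL := sh_L shD.
Let ip_ge0 := sh_ge0 shD.
Let ip_complete := sh_complete shD.

Lemma sh_DB u v : D u -> D v -> D (u - v).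
Proof. by move=> Du Dv; rewrite addrC -scaleN1r; exact: DL. Qed.

Lemma sh_DZ (a : R) u : D u -> D (a *: u).
Proof. by move=> Du; rewrite -[_ *: _]addr0; exact: DL. Qed.

Lemma ipLr (a : R) u v w : D u -> D v -> D w ->
  ip w (a *: u + v) = a * ip w u + ip w v.
Proof.
by move=> Du Dv Dw; rewrite ipC// ?ipL// 1?[ip u w]ipC// 1?[ip v w]ipC//; exact: DL.
Qed.

Lemma ipB u v w : D u -> D v -> D w -> ip (u - v) w = ip u w - ip v w.
Proof. by move=> Du Dv Dw; rewrite addrC -scaleN1r ipL// mulN1r addrC. Qed.

Lemma ip_sqrL (a : R) u v : D u -> D v ->
  ip (a *: u + v) (a *: u + v) = a ^+ 2 * ip u u + 2 * a * ip u v + ip v v.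
Proof.
move=> Du Dv; rewrite ipL//; last exact: DL.
by rewrite !ipLr// [ip v u]ipC//; ring.
Qed.

Lemma ip_CauchySchwarz u v : D u -> D v -> ip u v ^+ 2 <= ip u u * ip v v.
Proof.
move=> Du Dv; set a := ip u u; set b := ip u v; set c := ip v v.
have a0 : 0 <= a := ip_ge0 Du; have c0 : 0 <= c := ip_ge0 Dv.
have quad t : 0 <= t ^+ 2 * a + 2 * t * b + c.
  by rewrite -ip_sqrL//; apply: ip_ge0; exact: DL.
have [a00|an0] := eqVneq a 0.
  rewrite a00 mul0r; have [->|bn0] := eqVneq b 0; first by rewrite expr0n.
  (* A vector of norm zero need not vanish; if [b] were nonzero, the quadratic polynomial would take
     the value [-1] at this point. *)
  have := quad (- (c + 1) / (2 * b)); rewrite a00 mulr0 add0r.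
  rewrite (_ : 2 * _ * b = - (c + 1)); first by lra.
  by field.
have a_gt0 : 0 < a by rewrite lt_neqAle eq_sym an0.
have := quad (- b / a); rewrite (_ : _ + c = (a * c - b ^+ 2) / a); last by field.
by rewrite ler_pdivlMr// mul0r subr_ge0.
Qed.

Definition ipnorm u := Num.sqrt (ip u u).

Lemma ipnorm_ge0 u : 0 <= ipnorm u. Proof. exact: sqrtr_ge0. Qed.

Lemma sqr_ipnorm u : D u -> ipnorm u ^+ 2 = ip u u.
Proof. by move=> Du; rewrite sqr_sqrtr// ip_ge0. Qed.

Lemma ip_le_ipnorm u v : D u -> D v -> `|ip u v| <= ipnorm u * ipnorm v.
Proof.
move=> Du Dv; rewrite -sqrtrM ?ip_ge0// -sqrtr_sqr ler_wsqrtr//.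
exact: ip_CauchySchwarz.
Qed.

Lemma ipnormD u v : D u -> D v -> ipnorm (u + v) <= ipnorm u + ipnorm v.
Proof.
move=> Du Dv; rewrite -[leRHS]ger0_norm ?addr_ge0 ?ipnorm_ge0//.
rewrite -sqrtr_sqr ler_wsqrtr// -{1 2}[u]scale1r ip_sqrL// sqrrD !sqr_ipnorm//.
by have := ip_le_ipnorm Du Dv; rewrite ler_norml => /andP[]; lra.
Qed.

Lemma ip0r u : D u -> ip u 0 = 0.
Proof. by move=> Du; rewrite ipC// -(subrr u) ipB// subrr. Qed.

Lemma ipnormBC u v : D u -> D v -> ipnorm (u - v) = ipnorm (v - u).
Proof.
move=> Du Dv; have Dvu := sh_DB Dv Du.
have -> : u - v = (-1) *: (v - u) + 0 by rewrite scaleN1r opprB addr0.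
rewrite /ipnorm ip_sqrL// !ip0r//; by congr Num.sqrt; ring.
Qed.

Lemma ipnorm_complete (u_ : nat -> V) : (forall n, D (u_ n)) ->
  (forall e, 0 < e -> exists n0 : nat, forall i j, (n0 <= i)%N -> (n0 <= j)%N ->
    ipnorm (u_ i - u_ j) <= e) ->
  exists2 u, D u & forall e, 0 < e -> exists n0 : nat, forall i, (n0 <= i)%N ->
    ipnorm (u_ i - u) <= e.
Proof.
move=> Du cu; have [|u Dl ul] := ip_complete Du.
  move=> e e0; have [n0 H] := cu (Num.sqrt e) ltac:(by rewrite sqrtr_gt0).
  exists n0 => i j ni nj; rewrite -sqr_ipnorm; last exact: sh_DB.
  by rewrite -(sqr_sqrtr (ltW e0)) ler_sqr ?nnegrE ?sqrtr_ge0//; exact: H.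
exists u => // e e0; have [n0 H] := ul (e ^+ 2) ltac:(by rewrite exprn_gt0).
exists n0 => i ni; rewrite -(ger0_norm (ltW e0)) -sqrtr_sqr.
by rewrite ler_wsqrtr ?H.
Qed.

(** Banach's iteration from [0]. The limit is fixed only up to norm zero, because the norm does not
    separate points. *)
Lemma contraction_fixpoint (T : V -> V) (q : R) : 0 <= q < 1 ->
  (forall u, D u -> D (T u)) ->
  (forall u v, D u -> D v -> ipnorm (T u - T v) <= q * ipnorm (u - v)) ->
  exists2 u, D u & ipnorm (T u - u) = 0.
Proof.
move=> /andP[q0 q1] DT Tq; pose u_ n := iter n T 0.
have Du n : D (u_ n) by elim: n => //= n; exact: DT.
pose d := ipnorm (u_ 1%N - u_ 0%N).
have q1' : 0 < 1 - q by rewrite subr_gt0.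
have step n : ipnorm (u_ n.+1 - u_ n) <= q ^+ n * d.
  elim: n => [|n IH]; first by rewrite expr0 mul1r.
  rewrite exprS -mulrA.
  exact: le_trans (Tq _ _ (Du _) (Du _)) (ler_wpM2l q0 IH).
have d0 : 0 <= d by exact: ipnorm_ge0.
have far k n : ipnorm (u_ (n + k)%N - u_ n) <= q ^+ n * d / (1 - q).
  elim: k n => [|k IH] n.
    rewrite addn0 subrr /ipnorm ip0r// sqrtr0.
    by rewrite divr_ge0 ?mulr_ge0 ?exprn_ge0// ltW.
  rewrite addnS -addSn -(subrKA (u_ n.+1)).
  apply: le_trans (ipnormD (sh_DB (Du _) (Du _)) (sh_DB (Du _) (Du _))) _.
  apply: le_trans (lerD (IH _) (step _)) _.
  rewrite le_eqVlt; apply/orP; left; apply/eqP; rewrite exprS; field.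
  by rewrite gt_eqF.
have small e : 0 < e -> exists n0 : nat, forall n, (n0 <= n)%N -> q ^+ n * d / (1 - q) <= e.
  move=> e0; have : (fun n => q ^+ n * (d / (1 - q))) @ \oo --> 0 * (d / (1 - q)).
    by apply: cvgMl; apply: cvg_expr; rewrite ger0_norm.
  rewrite mul0r => /cvgrPdist_le /(_ e e0)[n0 _ H]; exists n0 => n nn.
  have := H n nn; rewrite /= sub0r normrN mulrA; apply: le_trans; exact: ler_norm.
have [|u Dl ul] := ipnorm_complete Du.
  move=> e e0; have [n0 H] := small (e / 2) ltac:(by rewrite divr_gt0).
  exists n0 => i j ni nj.
  have Hi : ipnorm (u_ i - u_ n0) <= e / 2.
    by rewrite -(subnKC ni) (le_trans (far _ _))// H.
  have Hj : ipnorm (u_ n0 - u_ j) <= e / 2.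
    by rewrite ipnormBC// -(subnKC nj) (le_trans (far _ _))// H.
  rewrite -(subrKA (u_ n0)).
  apply: le_trans (ipnormD (sh_DB (Du _) (Du _)) (sh_DB (Du _) (Du _))) _.
  by rewrite [leRHS]splitr; exact: lerD.
exists u => //; apply/eqP; rewrite eq_le ipnorm_ge0 andbT.
apply/ler_addgt0Pr => e e0; rewrite add0r.
have [n0 H] := ul (e / 2) ltac:(by rewrite divr_gt0).
have H0 := H n0 (leqnn _); have H1 := H n0.+1 (leqnSn _).
have DTu := DT _ Dl.
have H2 : ipnorm (T u - u_ n0.+1) <= e / 2.
  apply: le_trans (Tq _ _ Dl (Du _)) _; rewrite ipnormBC//.
  apply: le_trans H0; rewrite ler_piMl ?ipnorm_ge0//; exact: ltW.
rewrite -(subrKA (u_ n0.+1)).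
apply: le_trans (ipnormD (sh_DB DTu (Du _)) (sh_DB (Du _) Dl)) _.
by rewrite [leRHS]splitr; exact: lerD.
Qed.

(** Minimisation of [J]: the parallelogram identity makes a minimising sequence Cauchy, and varying
    [J] in the direction [g] identifies its limit. *)
Lemma Riesz (F : V -> R) (K : R) :
  (forall (a : R) u v, D u -> D v -> F (a *: u + v) = a * F u + F v) ->
  (forall u, D u -> `|F u| <= K * ipnorm u) ->
  exists2 u, D u & forall g, D g -> ip u g = F g.
Proof.
move=> FL FK; pose J u := ip u u - 2 * F u.
have Jlow u : D u -> - K ^+ 2 <= J u.
  move=> Du; rewrite /J -sqr_ipnorm//; have := FK _ Du; rewrite ler_norml => /andP[_].
  by have := sqr_ge0 (ipnorm u - K); lra.
pose E := [set J u | u in D].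
have Ei : has_inf E.
  split; first by exists (J 0), 0.
  by exists (- K ^+ 2) => _ [u Du <-]; exact: Jlow.
pose d := inf E.
have dJ u : D u -> d <= J u by move=> Du; apply: (ge_inf Ei.2); exists u.
have near n : exists u, D u /\ J u < d + n.+1%:R^-1.
  have n0 : 0 < n.+1%:R^-1 :> R by rewrite invr_gt0.
  by have [_ [u Du <-] H] := inf_adherent n0 Ei; exists u.
have [u_ /all_and2[Du Ju]] := choice near.
have par u v : D u -> D v -> ip (u - v) (u - v) <= 2 * J u + 2 * J v - 4 * d.
  move=> Duu Dvv; have := dJ (2^-1 *: u + 2^-1 *: v) (DL _ Duu (sh_DZ _ Dvv)).
  rewrite /J ip_sqrL//; last exact: sh_DZ.
  rewrite FL//; last exact: sh_DZ.
  rewrite -[2^-1 *: v]addr0 ip_sqrL// ipLr// !ip0r// FL//.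
  have -> : F 0 = 0.
    by have := FL (-1) _ _ D0 D0; rewrite scaler0 addr0 mulN1r addNr.
  have -> : ip (u - v) (u - v) = ip u u - 2 * ip u v + ip v v.
    by rewrite addrC -scaleN1r ip_sqrL// [ip v u]ipC//; ring.
  by lra.
have small e : 0 < e -> exists n0 : nat, forall n, (n0 <= n)%N -> n.+1%:R^-1 <= e :> R.
  move=> e0; have := @cvg_harmonic R => /cvgrPdist_le /(_ e e0)[n0 _ H].
  exists n0 => n nn; have := H n nn; rewrite /= sub0r normrN; apply: le_trans.
  exact: ler_norm.
have [|u Dl ul] := ip_complete Du.
  move=> e e0; have [n0 H] := small (e / 4) ltac:(by rewrite divr_gt0).
  exists n0 => i j ni nj; apply: (le_trans (par _ _ (Du i) (Du j))).
  move: (H i ni) (H j nj) (Ju i) (Ju j).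
  by move: (J (u_ i)) (J (u_ j)) (i.+1%:R^-1) (j.+1%:R^-1) => a1 a2 a3 a4; lra.
exists u => // g Dg; pose G := ip g g; pose r n := ip (u_ n) g - F g.
have G0 : 0 <= G := ip_ge0 Dg.
have rn n : r n ^+ 2 <= n.+1%:R^-1 * (G + 1).
  have H0 t : - (t ^+ 2 * G + 2 * t * r n) <= n.+1%:R^-1.
    have := dJ (t *: g + u_ n) (DL _ Dg (Du n)); rewrite /J ip_sqrL// FL//.
    have := Ju n; rewrite /J [ip g (u_ n)]ipC// -/G /r.
    move: (ip (u_ n) g) (ip (u_ n) (u_ n)) (F (u_ n)) (F g) (n.+1%:R^-1) (G) (d).
    by move=> a1 a2 a3 a4 a5 a6 a7; lra.
  (* The variation is taken at [t = - r n / (G + 1)]; the denominator [G + 1] in place of [G] covers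
     directions of norm zero. *)
  have H : r n ^+ 2 / (G + 1) * (2 - G / (G + 1)) <= n.+1%:R^-1.
    apply: le_trans (H0 (- r n / (G + 1))).
    by rewrite le_eqVlt; apply/orP; left; apply/eqP; field; rewrite gt_eqF//; lra.
  have G1 : 0 < G + 1 by lra.
  rewrite -ler_pdivrMr// (le_trans _ H)// ler_peMr ?divr_ge0 ?sqr_ge0 ?(ltW G1)//.
  have : G / (G + 1) <= 1 by rewrite ler_pdivrMr// mul1r; lra.
  by lra.
apply/eqP; rewrite -subr_eq0 -sqrf_eq0 eq_le sqr_ge0 andbT.
apply/ler_addgt0Pr => e e0; rewrite add0r.
have G1 : 0 < G + 1 by lra.
have e4 : 0 < e / (4 * (G + 1)) by rewrite divr_gt0// mulr_gt0.
have [n1 H1] := ul _ e4; have [n2 H2] := small _ e4.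
pose n := maxn n1 n2.
have A1 := H1 n (leq_maxl _ _); have A2 := H2 n (leq_maxr _ _).
have A3 := ip_CauchySchwarz (sh_DB (Du n) Dl) Dg; rewrite -/G in A3.
have A4 : ip (u_ n - u) (u_ n - u) * G <= e / 4.
  apply: (le_trans (ler_wpM2r G0 A1)).
  rewrite mulrAC ler_pdivrMr ?mulr_gt0//.
  by rewrite (_ : _ / 4 * _ = e * G + e) ?lerDl ?ltW//; field.
have A5 : n.+1%:R^-1 * (G + 1) <= e / 4.
  apply: (le_trans (ler_wpM2r (ltW G1) A2)).
  by rewrite le_eqVlt; apply/orP; left; apply/eqP; field; rewrite gt_eqF.
have A6 := rn n; rewrite ipB// in A3.
have : ip u g - F g = r n - (ip (u_ n) g - ip u g) by rewrite /r; ring.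
move=> ->; set a := r n in A6 *; set b := _ - ip u g in A3 *.
have := sqr_ge0 (a + b).
move: (le_trans A3 A4) (le_trans A6 A5) e0.
by move: (a) (b) => a' b'; lra.
Qed.

(** Riesz represents [B u] by [A u], and the equation becomes a fixed point problem for
    [u - rho (A u - f)]. For [rho = al / K'^2] the squared contraction factor
    [1 - 2 rho al + rho^2 K'^2] is [1 - al^2 / K'^2]. *)
Lemma Lax_Milgram (B : V -> V -> R) (F : V -> R) (K KF al : R) :
  (forall (a : R) u v w, D u -> D v -> D w ->
    B (a *: u + v) w = a * B u w + B v w) ->
  (forall (a : R) u v w, D u -> D v -> D w ->
    B w (a *: u + v) = a * B w u + B w v) ->
  (forall u v, D u -> D v -> `|B u v| <= K * ipnorm u * ipnorm v) ->
  0 < al -> (forall u, D u -> al * ip u u <= B u u) ->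
  (forall (a : R) u v, D u -> D v -> F (a *: u + v) = a * F u + F v) ->
  (forall u, D u -> `|F u| <= KF * ipnorm u) ->
  exists2 u, D u & forall g, D g -> B u g = F g.
Proof.
move=> BL BR BK al0 Bal FL FK.
(* Adding [al] makes the bound positive and at least [al], so that the radicand in [q] below is
   nonnegative. *)
pose K' := `|K| + al.
have K'0 : 0 < K' by rewrite ltr_wpDl.
have BK' u v : D u -> D v -> `|B u v| <= K' * ipnorm u * ipnorm v.
  move=> Du Dv; apply: le_trans (BK _ _ Du Dv) _.
  rewrite !ler_wpM2r ?ipnorm_ge0// (le_trans (ler_norm K))// lerDl ltW//.
have [f Df Ff] := Riesz FL FK.
have RB u : exists Au, D u -> D Au /\ forall g, D g -> ip Au g = B u g.
  have [Du|nDu] := pselect (D u); last by exists 0.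
  have BuL a v w (Dv : D v) (Dw : D w) := BR a v w u Dv Dw Du.
  have [Au DA HA] := @Riesz (B u) (K' * ipnorm u) BuL (fun v => BK' u v Du).
  by exists Au.
have [A HA] := choice RB.
have DA u : D u -> D (A u) by move=> /HA[].
have AB u g : D u -> D g -> ip (A u) g = B u g by move=> /HA[_]; exact.
pose rho := al / K' ^+ 2.
pose q := Num.sqrt (1 - al ^+ 2 / K' ^+ 2).
have alK : al ^+ 2 / K' ^+ 2 <= 1.
  by rewrite ler_pdivrMr ?exprn_gt0// mul1r ler_sqr ?nnegrE ?(ltW al0) ?(ltW K'0)// lerDr.
have q01 : 0 <= q < 1.
  rewrite sqrtr_ge0/= -sqrtr1 ltr_sqrt ?ltr01// gtrBl.
  by rewrite divr_gt0 ?exprn_gt0.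
pose T u := (- rho) *: (A u - f) + u.
have DT u : D u -> D (T u).
  by move=> Du; apply: DL => //; apply: sh_DB => //; exact: DA.
have Tq u v : D u -> D v -> ipnorm (T u - T v) <= q * ipnorm (u - v).
  move=> Du Dv.
  have Dd := sh_DB Du Dv; have De := sh_DB (DA _ Du) (DA _ Dv).
  have -> : T u - T v = (- rho) *: (A u - A v) + (u - v).
    by rewrite /T opprD addrACA -scalerBr opprB subrKA.
  rewrite -[q * _]ger0_norm ?mulr_ge0 ?ipnorm_ge0 ?sqrtr_ge0//.
  rewrite -sqrtr_sqr ler_wsqrtr// exprMn sqr_ipnorm// /q sqr_sqrtr ?subr_ge0//.
  rewrite ip_sqrL//.
  set e := A u - A v in De *; set dd := u - v in Dd *.
  have eB g : D g -> ip e g = B dd g.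
    move=> Dg; rewrite /e ipB ?AB//; try exact: DA.
    have -> : dd = (-1) *: v + u by rewrite scaleN1r addrC.
    by rewrite BL// mulN1r addrC.
  have eK : ipnorm e <= K' * ipnorm dd.
    have := BK' _ _ Dd De; rewrite -eB// -sqr_ipnorm//.
    rewrite ger0_norm ?sqr_ge0// expr2.
    have [->|en0] := eqVneq (ipnorm e) 0; first by rewrite mulr_ge0 ?ipnorm_ge0// ltW.
    by rewrite ler_pM2r// lt_neqAle eq_sym en0 ipnorm_ge0.
  have e2 : ip e e <= K' ^+ 2 * ip dd dd.
    rewrite -!sqr_ipnorm// -exprMn ler_sqr ?nnegrE ?ipnorm_ge0//.
    by rewrite mulr_ge0 ?ipnorm_ge0// ltW.
  have Bd := Bal _ Dd; rewrite -eB// in Bd.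
  have rho0 : 0 < rho by rewrite divr_gt0 ?exprn_gt0.
  have E1 : rho ^+ 2 * ip e e <= rho * al * ip dd dd.
    apply: le_trans (ler_wpM2l (sqr_ge0 rho) e2) _.
    by rewrite le_eqVlt; apply/orP; left; apply/eqP; rewrite /rho; field; rewrite gt_eqF.
  have E2 := ler_wpM2l (ltW rho0) Bd.
  have -> : al ^+ 2 / K' ^+ 2 = rho * al by rewrite /rho; ring.
  by move: E1 E2; rewrite sqrrN; lra.
have [u Du Tu] := contraction_fixpoint q01 DT Tq.
exists u => // g Dg.
have DAf : D (A u - f) by apply: sh_DB => //; exact: DA.
have rho0 : 0 < rho by rewrite divr_gt0 ?exprn_gt0.
have Z : ip ((- rho) *: (A u - f)) g = 0.
  have DTu : D ((- rho) *: (A u - f)) by exact: sh_DZ.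
  have := ip_le_ipnorm DTu Dg.
  have -> : ipnorm ((- rho) *: (A u - f)) = 0 by rewrite -Tu /T addrK.
  by rewrite mul0r normr_le0 => /eqP.
have : - rho * ip (A u - f) g = 0.
  by rewrite -Z -[_ *: _]addr0 ipL// [ip 0 g]ipC// ip0r// addr0.
move/eqP; rewrite mulf_eq0 oppr_eq0 (gt_eqF rho0)/= ipB ?AB//; last exact: DA.
by rewrite Ff// subr_eq0 => /eqP.
Qed.

End semi_hilbert.

(** * Completeness of [L^2] *)

Section Riesz_Fischer.
Context {R : realType}.
Local Notation mu := (@lebesgue_measure R).
Local Notation intg A f := (mu.-integrable (A : set R) (EFin \o f)).

Lemma geometric_increments_cvg (u : nat -> R) (H : R) :
  (forall k, 4 ^+ k * (u k.+1 - u k) ^+ 2 <= H) -> cvgn u.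
Proof.
move=> uH; have H0 : 0 <= H.
  by apply: le_trans (uH 0%N); rewrite expr0 mul1r sqr_ge0.
have D k : `|u k.+1 - u k| <= geometric (Num.sqrt H) (2^-1) k.
  rewrite /geometric /= -sqrtr_sqr exprVn ler_pdivlMr ?exprn_gt0//.
  rewrite -[2 ^+ k]ger0_norm ?exprn_ge0// -sqrtr_sqr -sqrtrM ?sqr_ge0//.
  rewrite ler_wsqrtr// mulrC; apply: le_trans (uH k).
  rewrite ler_wpM2r ?sqr_ge0// -exprM mulnC exprM.
  by rewrite (_ : 2 ^+ 2 = 4 :> R)//; ring.
have ns : cvgn [normed series (telescope u)].
  apply: (@series_le_cvg _ _ (geometric (Num.sqrt H) (2^-1))) => //.
  - by move=> n /=.
  - by move=> n; rewrite /geometric/= mulr_ge0 ?sqrtr_ge0 ?exprn_ge0.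
  - by apply: is_cvg_geometric_series; rewrite ger0_norm ?invf_lt1 ?ltr1n.
have /normed_cvg st := ns.
rewrite (_ : u = (fun n => u 0%N + series (telescope u) n)).
  by apply: is_cvgD => //; exact: is_cvg_cst.
by apply/funext => n; rewrite -eq_sum_telescope.
Qed.

Lemma sqi_le_of_Fatou (g_ : nat -> R -> R) (g : R -> R) (e : R) :
  (forall k, sqi (g_ k)) -> measurable_fun setT g ->
  {ae mu, forall x, g_ k x @[k --> \oo] --> g x} ->
  (exists n0 : nat, forall k, (n0 <= k)%N -> \int[mu]_x (g_ k x) ^+ 2 <= e) ->
  sqi g /\ \int[mu]_x (g x) ^+ 2 <= e.
Proof.
move=> sg mg gg [n0 ge].
have mgk k : measurable_fun setT (g_ k) by case: (sg k).
have fin k : (\int[mu]_x ((g_ k x) ^+ 2)%:E = (\int[mu]_x (g_ k x) ^+ 2)%:E)%E.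
  by rewrite fineK//; apply: (@integrable_fin_num _ _ _ mu) => //; case: (sg k).
have F := @fatou _ _ _ mu setT measurableT (fun k x => ((g_ (k + n0)%N x) ^+ 2)%:E) _ _.
have {F} F : (\int[mu]_x limn_einf (fun k => ((g_ (k + n0)%N x) ^+ 2)%:E) <=
  limn_einf (fun k => \int[mu]_x ((g_ (k + n0)%N x) ^+ 2)%:E))%E.
  apply: F => [k|k x _]; last by rewrite lee_fin sqr_ge0.
  by apply/measurable_EFinP/measurable_funX; exact: mgk.
have ub : (limn_einf (fun k => \int[mu]_x ((g_ (k + n0)%N x) ^+ 2)%:E) <= e%:E)%E.
  rewrite limn_einf_lim; apply: lime_le; first exact: is_cvg_einfs.
  apply: nearW => k; apply: ereal_inf_le.
  exists (\int[mu]_x ((g_ (k + n0)%N x) ^+ 2)%:E)%E; first by exists k => //=.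
  by rewrite fin lee_fin ge// leq_addl.
have LE : (\int[mu]_x ((g x) ^+ 2)%:E <= e%:E)%E.
  apply: le_trans (le_trans F ub).
  rewrite le_eqVlt; apply/orP; left; apply/eqP.
  apply: (@ae_eq_integral _ _ _ mu) => //.
  - by apply/measurable_EFinP/measurable_funX.
  - apply: (eq_measurable_fun (fun x => - limn_esup (fun k => - ((g_ (k + n0)%N x) ^+ 2)%:E))%E).
      by move=> x _; rewrite limn_esupN oppeK.
    apply: measurableT_comp => //; apply: measurable_fun_limn_esup => k.
    by apply: measurableT_comp => //; apply/measurable_EFinP/measurable_funX; exact: mgk.
  - apply: ae_imp gg => x gx _.
    have : (((g_ (k + n0)%N x) ^+ 2)%:E @[k --> \oo] --> ((g x) ^+ 2)%:E)%E.
      apply/fine_cvgP; split; first exact: nearW.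
      have g' : g_ (k + n0)%N x @[k --> \oo] --> g x.
        by rewrite (cvg_shiftn n0 (fun k => g_ k x)).
      by rewrite expr2; under eq_fun do rewrite /= expr2; apply: cvgM.
    by move=> /cvg_limn_einf_sup[->].
have gi : intg setT (fun x => (g x) ^+ 2).
  apply/integrableP; split; first by apply/measurable_EFinP/measurable_funX.
  under eq_integral do rewrite gee0_abs ?lee_fin ?sqr_ge0//.
  by rewrite (le_lt_trans LE)// ltry.
split; first by split.
by rewrite -lee_fin fineK//; exact: (@integrable_fin_num _ _ _ mu).
Qed.

(** Along a subsequence with squared increments of norm at most [8^-(k+1)], the sum of
    [4^k (g_(k+1) - g_k)^2] is integrable, hence finite almost everywhere. Pointwise increments are
    then at most a multiple of [2^-k], and the subsequence converges. Fatou's lemma carries the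
    Cauchy bounds to the limit. *)
Lemma sqi_complete (f_ : nat -> R -> R) : (forall n, sqi (f_ n)) ->
  (forall e, 0 < e -> exists n0 : nat, forall i j, (n0 <= i)%N -> (n0 <= j)%N ->
    \int[mu]_x (f_ i x - f_ j x) ^+ 2 <= e) ->
  exists2 f, sqi f & forall e, 0 < e -> exists n0 : nat, forall i, (n0 <= i)%N ->
    \int[mu]_x (f_ i x - f x) ^+ 2 <= e.
Proof.
move=> sf cf.
have sfB i j : sqi (fun x => f_ i x - f_ j x) by exact: sqiB.
have cf8 k : exists n0 : nat, forall i j, (n0 <= i)%N -> (n0 <= j)%N ->
    \int[mu]_x (f_ i x - f_ j x) ^+ 2 <= (8 ^+ k.+1)^-1.
  by apply: cf; rewrite invr_gt0 exprn_gt0.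
have [nk Hnk] := choice cf8.
(* Summing the ranks makes [s] nondecreasing with [s k >= nk k]; the added [k] sends it to
   infinity. *)
pose s k := (\sum_(j < k.+1) nk j + k)%N.
have s_nk k : (nk k <= s k)%N by rewrite /s big_ord_recr/= -addnA addnCA leq_addr.
have s_mono k : (s k <= s k.+1)%N.
  rewrite /s [in X in (_ <= X)%N]big_ord_recr/=.
  by rewrite addnS leqW// leq_add2r leq_addr.
have s_ge k : (k <= s k)%N by rewrite leq_addl.
pose g k := f_ (s k).
have gD k : \int[mu]_x (g k.+1 x - g k x) ^+ 2 <= (8 ^+ k.+1)^-1.
  by apply: (Hnk k) => //; exact: leq_trans (s_nk k) (s_mono k).
pose h k x := (4 ^+ k * (g k.+1 x - g k x) ^+ 2)%:E.
have mf n : measurable_fun setT (f_ n) by case: (sf n).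
have mh k : measurable_fun setT (h k).
  apply/measurable_EFinP/measurable_funM => //.
  by apply: measurable_funX; apply: measurable_funB; exact: mf.
have h0 k x : (0 <= h k x)%E by rewrite lee_fin mulr_ge0// ?sqr_ge0 ?exprn_ge0.
have hfin : {ae mu, forall x, (\sum_(0 <= k <oo) h k x \is a fin_num)%E}.
  have hi : mu.-integrable (setT : set R) (fun x => (\sum_(0 <= k <oo) h k x)%E).
    apply/integrableP; split.
      apply: (@ge0_emeasurable_sum _ _ _ _ h xpredT) => [k x _ _|k _].
        exact: h0.
      exact: mh.
    under eq_integral do rewrite gee0_abs ?nneseries_ge0//.
    rewrite integral_nneseries//.
    apply: (@le_lt_trans _ _ (\sum_(0 <= k <oo) (1 / (2 ^ k.+1)%:R)%:E)%E).
      apply: lee_nneseries => [k _ _|k _]; first exact: integral_ge0.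
      have hk : intg setT (fun x => 4 ^+ k * (g k.+1 x - g k x) ^+ 2).
        by apply: intgZ => //; case: (sfB (s k.+1) (s k)).
      rewrite -[leLHS]fineK; last exact: (@integrable_fin_num _ _ _ mu).
      rewrite lee_fin -/(Rintegral _ _ _) RintegralZl//; last by case: (sfB (s k.+1) (s k)).
      apply: le_trans (ler_wpM2l _ (gD k)) _; first by rewrite exprn_ge0.
      rewrite div1r natrX ler_pdivrMr ?exprn_gt0// mulrC ler_pdivlMr ?exprn_gt0//.
      rewrite (_ : 8 = 4 * 2 :> R); last by rewrite -natrM.
      rewrite exprMn ler_wpM2r ?exprn_ge0// exprS ler_peMl ?exprn_ge0//.
      by rewrite ler1n.
    by apply: le_lt_trans (epsilon_trick0 xpredT ler01) _; rewrite ltry.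
  have := @integrable_ae _ _ _ mu setT measurableT _ hi.
  by apply: ae_imp => x; apply.
have gcv : {ae mu, forall x, cvgn (fun k => g k x)}.
  apply: ae_imp hfin => x hx.
  apply: (@geometric_increments_cvg _ (fine (\sum_(0 <= k <oo) h k x)%E)) => k.
  rewrite -lee_fin fineK//.
  have := @nneseries_lim_ge R (fun k => h k x) xpredT 0%N k.+1 (fun n _ _ => h0 n x).
  apply: le_trans; rewrite big_nat_recr//= leeDr// sume_ge0//.
(* The upper limit is measurable and defined everywhere, and it is the limit wherever the
   subsequence converges. *)
pose f x := fine (limn_esup (fun k => (g k x)%:E)).
have mg k : measurable_fun setT (g k) by exact: mf.
have mff : measurable_fun setT f.
  apply: measurableT_comp => //; apply: measurable_fun_limn_esup => n.
  exact/measurable_EFinP.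
have gf : {ae mu, forall x, g k x @[k --> \oo] --> f x}.
  apply: ae_imp gcv => x gx.
  have := gx => /cvg_ex[l gl].
  have El : ((g k x)%:E @[k --> \oo] --> l%:E)%E.
    by apply/fine_cvgP; split; [exact: nearW|exact: gl].
  by rewrite /f (cvg_limn_einf_sup El).2.
have key e i : (exists n0 : nat, forall k, (n0 <= k)%N ->
      \int[mu]_x (g k x - f_ i x) ^+ 2 <= e) ->
    sqi (fun x => f x - f_ i x) /\ \int[mu]_x (f x - f_ i x) ^+ 2 <= e.
  move=> H; apply: (@sqi_le_of_Fatou (fun k x => g k x - f_ i x)) => //.
  - by move=> k; exact: sfB.
  - exact: measurable_funB.
  - by apply: ae_imp gf => x gx; apply: cvgB => //; exact: cvg_cst.
have conv e : 0 < e -> exists n0 : nat, forall i, (n0 <= i)%N ->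
    sqi (fun x => f x - f_ i x) /\ \int[mu]_x (f x - f_ i x) ^+ 2 <= e.
  move=> e0; have [n0 H] := cf e e0; exists n0 => i ni; apply: key.
  exists n0 => k nk0; apply: H => //; exact: leq_trans nk0 (s_ge k).
exists f.
  have [n0 H] := conv 1 ltr01; have [sB _] := H n0 (leqnn _).
  have := sqiD sB (sf n0); congr sqi.
  by apply/funext => x; rewrite subrK.
move=> e e0; have [n0 H] := conv e e0; exists n0 => i ni.
have [_] := H i ni; congr (_ <= _).
by apply: eq_Rintegral => x _; rewrite -sqrrN opprB.
Qed.

End Riesz_Fischer.

(** * Products of semi-Hilbert spaces *)

Section semi_hilbert_product.
Context {R : realType} {V W : lmodType R}.
Variables (D : set V) (ip : V -> V -> R) (E : set W) (jp : W -> W -> R).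

Definition prod_dom : set (V * W) := [set u | D u.1 /\ E u.2].
Definition prod_ip (u v : V * W) := ip u.1 v.1 + jp u.2 v.2.

Lemma semi_hilbert_prod : semi_hilbert D ip -> semi_hilbert E jp ->
  semi_hilbert prod_dom prod_ip.
Proof.
move=> HV HW; split.
- by move=> a u v [? ?] [? ?]; split; [exact: (sh_DL HV)|exact: (sh_DL HW)].
- by split; [exact: (sh_D0 HV)|exact: (sh_D0 HW)].
- by move=> u v [? ?] [? ?]; rewrite /prod_ip (sh_C HV)// (sh_C HW).
- move=> a u v w [? ?] [? ?] [? ?]; rewrite /prod_ip (sh_L HV)// (sh_L HW)//.
  by rewrite mulrDr addrACA.
- by move=> u [? ?]; rewrite addr_ge0// ?(sh_ge0 HV)// (sh_ge0 HW).
move=> u_ Du cu.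
have DVB i j : 0 <= ip (u_ i - u_ j).1 (u_ i - u_ j).1.
  apply: (sh_ge0 HV); have [[Di _] [Dj _]] := (Du i, Du j).
  by rewrite /= addrC -scaleN1r; exact: (sh_DL HV).
have DWB i j : 0 <= jp (u_ i - u_ j).2 (u_ i - u_ j).2.
  apply: (sh_ge0 HW); have [[_ Di] [_ Dj]] := (Du i, Du j).
  by rewrite /= addrC -scaleN1r; exact: (sh_DL HW).
have [||a Da ua] := sh_complete HV (u_ := fun n => (u_ n).1).
- by move=> n; case: (Du n).
- move=> e e0; have [n0 H] := cu e e0; exists n0 => i j ni nj.
  by apply: le_trans (H i j ni nj); rewrite /prod_ip lerDl; exact: DWB.
have [||b Db ub] := sh_complete HW (u_ := fun n => (u_ n).2).
- by move=> n; case: (Du n).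
- move=> e e0; have [n0 H] := cu e e0; exists n0 => i j ni nj.
  by apply: le_trans (H i j ni nj); rewrite /prod_ip lerDr; exact: DVB.
exists (a, b) => // e e0; have e20 : 0 < e / 2 by rewrite divr_gt0.
have [[n1 H1] [n2 H2]] := (ua _ e20, ub _ e20); exists (maxn n1 n2) => i.
rewrite geq_max => /andP[i1 i2]; rewrite [leRHS]splitr.
by apply: lerD; [exact: H1|exact: H2].
Qed.

End semi_hilbert_product.

(** * The real [L^2] inner product *)

Section L2_product.
Context {R : realType}.
Local Notation mu := (@lebesgue_measure R).
Local Notation intg A f := (mu.-integrable (A : set R) (EFin \o f)).
Implicit Types f g h : R -> R.

Definition dotp f g : R := \int[mu]_x (f x * g x).

Lemma dotpC f g : dotp f g = dotp g f.
Proof. by apply: eq_Rintegral => x _; rewrite mulrC. Qed.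

Lemma dotp_ge0 f : 0 <= dotp f f.
Proof. by apply: Rintegral_ge0 => x _; rewrite -expr2 sqr_ge0. Qed.

Lemma dotpE f : dotp f f = \int[mu]_x (f x ^+ 2).
Proof. by apply: eq_Rintegral => x _; rewrite expr2. Qed.

Lemma dotpL (a : R) f g h : sqi f -> sqi g -> sqi h ->
  dotp (fun x => a * f x + g x) h = a * dotp f h + dotp g h.
Proof.
move=> sf sg sh; rewrite /dotp -RintegralZl//; last exact: sqiM.
rewrite -RintegralD//; [|exact/intgZ/sqiM|exact: sqiM].
by apply: eq_Rintegral => x _; rewrite mulrDl mulrA.
Qed.

Lemma dotpD f g h : sqi f -> sqi g -> sqi h ->
  dotp (fun x => f x + g x) h = dotp f h + dotp g h.
Proof.
move=> sf sg sh; rewrite -[dotp f h]mul1r -dotpL//.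
by congr dotp; apply/funext => x; rewrite mul1r.
Qed.

Lemma dotpZ (a : R) f h : sqi f -> sqi h ->
  dotp (fun x => a * f x) h = a * dotp f h.
Proof.
move=> sf sh; rewrite /dotp -RintegralZl//; last exact: sqiM.
by apply: eq_Rintegral => x _; rewrite mulrA.
Qed.

Lemma dotpB f g h : sqi f -> sqi g -> sqi h ->
  dotp (fun x => f x - g x) h = dotp f h - dotp g h.
Proof.
move=> sf sg sh; have -> : dotp f h - dotp g h = -1 * dotp g h + dotp f h by ring.
by rewrite -dotpL//; congr dotp; apply/funext => x; rewrite mulN1r addrC.
Qed.

Lemma dotp_ae f g h k : sqi f -> sqi g -> measurable_fun setT h -> measurable_fun setT k ->
  {ae mu, forall x, f x = h x} -> {ae mu, forall x, g x = k x} ->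
  dotp f g = dotp h k.
Proof.
move=> [mf _] [mg _] mh mk fh gk; apply: Rintegral_ae_eq => //.
- exact: measurable_funM.
- exact: measurable_funM.
- by apply: ae_imp2 fh gk => x -> ->.
Qed.

Lemma sqi_semi_hilbert : @semi_hilbert R (R -> R^o) (sqi : set (R -> R)) dotp.
Proof.
split.
- by move=> a f g sf sg; apply: sqiD => //; exact: sqiZ.
- exact: sqi0.
- by move=> f g _ _; exact: dotpC.
- by move=> a f g h sf sg sh; exact: dotpL.
- by move=> f _; exact: dotp_ge0.
move=> f_ sf cf; have [|f sf' fl] := sqi_complete sf.
  by move=> e /cf[n0 H]; exists n0 => i j ni nj; rewrite -dotpE; exact: H.
exists f => // e /fl[n0 H]; exists n0 => i ni; rewrite dotpE; exact: H.
Qed.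

Lemma dotp_CauchySchwarz f g : sqi f -> sqi g -> dotp f g ^+ 2 <= dotp f f * dotp g g.
Proof.
move=> sf sg; exact: (ip_CauchySchwarz sqi_semi_hilbert).
Qed.

Lemma dotp_cvg (f_ : nat -> R -> R) f g : (forall n, sqi (f_ n)) -> sqi f -> sqi g ->
  (forall e, 0 < e -> exists n0 : nat, forall i, (n0 <= i)%N ->
    dotp (fun x => f_ i x - f x) (fun x => f_ i x - f x) <= e) ->
  dotp (f_ n) g @[n --> \oo] --> dotp f g.
Proof.
move=> sfn sf sg fn; apply/cvgrPdist_le => e e0.
have g1 : 0 < 1 + dotp g g by rewrite ltr_pwDl// dotp_ge0.
have [|n0 H] := fn (e ^+ 2 / (1 + dotp g g)); first by rewrite divr_gt0 ?exprn_gt0.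
exists n0 => // i /= ni; rewrite distrC -dotpB// -(ger0_norm (ltW e0)) -ler_sqr ?nnegrE//.
rewrite -!normrX !ger0_norm ?sqr_ge0//.
apply: le_trans (dotp_CauchySchwarz _ sg) _; first exact: sqiB.
apply: (@le_trans _ _ (e ^+ 2 / (1 + dotp g g) * (1 + dotp g g))).
  by apply: ler_pM; rewrite ?dotp_ge0 ?H// lerDr.
by rewrite divfK// gt_eqF.
Qed.

End L2_product.

(** * The form domain and its norm *)

Section form_space.
Context {R : realType}.
Local Notation mu := (@lebesgue_measure R).
Local Notation intg A f := (mu.-integrable (A : set R) (EFin \o f)).
Implicit Types f g h : R -> R.

Lemma test_sqi (phi : R -> R) : test_function phi -> sqi phi.
Proof.
move=> tphi; have [N _ phiN] := test_function_supp tphi.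
apply: (continuous_supp_sqi _ phiN).
exact: primitive_continuous (test_primitive tphi).
Qed.

Lemma test_mulx_sqi (phi : R -> R) : test_function phi -> sqi (fun x => x * phi x).
Proof.
move=> tphi; have [N _ phiN] := test_function_supp tphi.
apply: (@continuous_supp_sqi _ _ N) => [x|x /phiN ->]; last by rewrite mulr0.
apply: cvgM; first exact: cvg_id.
exact: primitive_continuous (test_primitive tphi) x.
Qed.

Lemma wderL (a : R) f f' g g' : sqi f -> sqi f' -> sqi g -> sqi g' ->
  wder f f' -> wder g g' -> wder (fun x => a * f x + g x) (fun x => a * f' x + g' x).
Proof.
move=> sf sf' sg sg' ff' gg' phi tphi.
have sphi := test_sqi tphi; have sphi' := test_sqi (test_function_derive1 tphi).
rewrite -!/(dotp _ _) !dotpL//.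
have := ff' _ tphi; have := gg' _ tphi; rewrite -!/(dotp _ _) => -> ->.
by rewrite opprD mulrN.
Qed.

(** The second component carries a weak derivative of the first. As it is unique only up to null
    sets, keeping it as a datum makes the form an explicit expression, linear in the pair. *)
Definition form_dom : set ((R -> R^o) * (R -> R^o)) :=
  [set a | [/\ sqi a.1, sqi a.2, sqi (fun x => x * a.1 x) & wder a.1 a.2]].

Definition form_ip (a b : (R -> R^o) * (R -> R^o)) : R :=
  dotp a.1 b.1 + dotp (fun x => x * a.1 x) (fun x => x * b.1 x) + dotp a.2 b.2.

Lemma mulxL (a : R) f g :
  (fun x => x * (a * f x + g x)) = (fun x => a * (x * f x) + x * g x).
Proof. by apply/funext => x; rewrite mulrDr mulrCA. Qed.

(** For completeness, [f_n], [x f_n] and [f_n'] converge separately in [L^2]; testing against smooth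
    functions of compact support identifies the last two limits with [x f] and with a weak
    derivative of [f]. *)
Lemma form_semi_hilbert : semi_hilbert form_dom form_ip.
Proof.
split.
- move=> a u v [sf sf1 sxf ff1] [sg sg1 sxg gg1]; split.
  + by apply: sqiD => //; exact: sqiZ.
  + by apply: sqiD => //; exact: sqiZ.
  + rewrite /GRing.scale/= mulxL.
    by apply: sqiD => //; exact: sqiZ.
  + exact: wderL.
- split; try exact: sqi0.
  + rewrite (_ : (fun x => _) = cst 0); first exact: sqi0.
    by apply/funext => x /=; rewrite mulr0.
  + move=> phi _; rewrite !(@eq_Rintegral _ _ _ mu setT (cst 0)) ?Rintegral_cst//=.
    * by rewrite mul0r oppr0.
    * by move=> x _; rewrite mul0r.
    * by move=> x _; rewrite mul0r.
- by move=> u v _ _; rewrite /form_ip !(dotpC (u : _ * _).1) !(dotpC u.2)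
    (dotpC (fun x => x * u.1 x)).
- move=> a u v w [sf sf1 sxf _] [sg sg1 sxg _] [sh sh1 sxh _].
  rewrite /form_ip /GRing.scale/= [X in _ + X + _ = _](_ : _ =
    dotp (fun x => a * (x * u.1 x) + x * v.1 x) (fun x => x * w.1 x)).
    have -> := dotpL a sf sg sh; have -> := dotpL a sf1 sg1 sh1.
    have -> := dotpL a sxf sxg sxh.
    by ring.
  by rewrite -mulxL.
- by move=> u _; rewrite !addr_ge0// dotp_ge0.
move=> a_ Da ca.
have sf n : sqi (a_ n).1 by case: (Da n).
have sf1 n : sqi (a_ n).2 by case: (Da n).
have sxf n : sqi (fun x => x * (a_ n).1 x) by case: (Da n).
have mulxB (i j : nat) : (fun x => x * ((a_ i).1 x - (a_ j).1 x)) =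
    (fun x => x * (a_ i).1 x - x * (a_ j).1 x).
  by apply/funext => x; rewrite mulrBr.
have [|f sf' fl] := sh_complete sqi_semi_hilbert (u_ := fun n => (a_ n).1) sf.
  move=> e /ca[n0 H]; exists n0 => i j ni nj; apply: le_trans (H i j ni nj).
  by rewrite /form_ip -addrA lerDl addr_ge0// dotp_ge0.
have [|f1 sf1' f1l] := sh_complete sqi_semi_hilbert (u_ := fun n => (a_ n).2) sf1.
  move=> e /ca[n0 H]; exists n0 => i j ni nj; apply: le_trans (H i j ni nj).
  by rewrite /form_ip lerDr addr_ge0// dotp_ge0.
have [|g sg' gl] := sh_complete sqi_semi_hilbert
    (u_ := fun n => (fun x => x * (a_ n).1 x)) sxf.
  move=> e /ca[n0 H]; exists n0 => i j ni nj; apply: le_trans (H i j ni nj).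
  rewrite /form_ip addrAC -[leRHS]/(_ + dotp (fun x => x * ((a_ i).1 x - (a_ j).1 x))
    (fun x => x * ((a_ i).1 x - (a_ j).1 x))) mulxB.
  by rewrite lerDr addr_ge0// dotp_ge0.
have mf : measurable_fun setT f by case: sf'.
have mxf : measurable_fun setT (fun x : R => x * f x) by exact: measurable_funM.
have xfg : {ae mu, forall x, g x = x * f x}.
  suff : {ae mu, forall x : R, x * f x - g x = 0}.
    by apply: ae_imp => x /eqP; rewrite subr_eq0 => /eqP.
  have lxf : locint (fun x => x * f x).
    have := locintM (sqi_locint sf') (fun x : R => @cvg_id _ (nbhs x)).
    by congr locint; apply/funext => x; rewrite mulrC.
  apply: locint_test0_ae0 => [|phi tphi].
    by apply: locintB => //; exact: sqi_locint.
  have sphi := test_sqi tphi; have sxphi := test_mulx_sqi tphi.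
  have E h : dotp (fun x => x * h x) phi = dotp h (fun x => x * phi x).
    by apply: eq_Rintegral => x _; rewrite mulrCA mulrA.
  have c1 := dotp_cvg sf sf' sxphi fl.
  have c2 := dotp_cvg sxf sg' sphi gl.
  have eq : dotp f (fun x => x * phi x) = dotp g phi.
    apply: (norm_cvg_unique c1); apply: cvg_trans c2; apply: near_eq_cvg.
    by apply: nearW => n; exact: E.
  under eq_Rintegral do rewrite mulrBl.
  rewrite RintegralB//; [|exact: intg_test|exact: sqiM].
  by rewrite -!/(dotp _ _) E eq subrr.
have sxf' : sqi (fun x => x * f x) by exact: sqi_ae xfg sg'.
exists (f, f1).
  split=> //= phi tphi.
  have sphi := test_sqi tphi; have sphi' := test_sqi (test_function_derive1 tphi).
  have c1 := dotp_cvg sf sf' sphi' fl.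
  have c2 : - dotp (a_ n).2 phi @[n --> \oo] --> - dotp f1 phi.
    by apply: cvgN; exact: dotp_cvg.
  apply: (norm_cvg_unique c1); apply: cvg_trans c2; apply: near_eq_cvg.
  by apply: nearW => n; have [_ _ _ H] := Da n; exact: esym (H _ tphi).
move=> e e0; have e3 : 0 < e / 3 by rewrite divr_gt0.
have [[n1 H1] [n2 H2]] := (fl _ e3, f1l _ e3); have [n3 H3] := gl _ e3.
exists (maxn n1 (maxn n2 n3)) => i; rewrite !geq_max => /and3P[i1 i2 i3].
rewrite (_ : e = e / 3 + e / 3 + e / 3); last by field.
rewrite /form_ip; apply: lerD; [apply: lerD|]; [exact: H1| |exact: H2].
apply: le_trans (H3 i i3); rewrite le_eqVlt; apply/orP; left; apply/eqP.
have sB : sqi (fun x => x * (a_ i).1 x - x * f x) by exact: sqiB.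
have mB := measurable_funB (sxf i).1 sg'.1.
have ae : {ae mu, forall x : R, x * (a_ i).1 x - x * f x = x * (a_ i).1 x - g x}.
  by apply: ae_imp xfg => x ->.
rewrite -(dotp_ae sB sB mB mB ae ae).
by congr dotp; apply/funext => x; rewrite -mulrBr.
Qed.

End form_space.

(** * Weak solutions of the resolvent equation *)

Section bounded_forms.
Context {R : realType} {V : lmodType R} (D : set V) (ip : V -> V -> R).
Hypothesis HD : semi_hilbert D ip.
Implicit Types (B : V -> V -> R) (F : V -> R) (T : V -> R -> R^o).

Definition bounded_form B := [/\
  forall (a : R) u v w, D u -> D v -> D w -> B (a *: u + v) w = a * B u w + B v w,
  forall (a : R) u v w, D u -> D v -> D w -> B w (a *: u + v) = a * B w u + B w v &
  exists K, forall u v, D u -> D v -> `|B u v| <= K * ipnorm ip u * ipnorm ip v].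

Definition bounded_functional F :=
  (forall (a : R) u v, D u -> D v -> F (a *: u + v) = a * F u + F v) /\
  exists K, forall u, D u -> `|F u| <= K * ipnorm ip u.

(** Satisfied by the maps from an element to [u], [x u] and [u']. Every term of the forms below is
    an [L^2] product of two such maps, so boundedness is checked term by term. *)
Definition L2_bounded T := [/\ forall u, D u -> sqi (T u),
  forall u, D u -> dotp (T u) (T u) <= ip u u &
  forall (a : R) u v, D u -> D v -> T (a *: u + v) = (fun x => a * T u x + T v x)].

Lemma bounded_formD B1 B2 : bounded_form B1 -> bounded_form B2 ->
  bounded_form (fun u v => B1 u v + B2 u v).
Proof.
move=> [l1 r1 [K1 b1]] [l2 r2 [K2 b2]]; split.
- by move=> a u v w Du Dv Dw; rewrite l1// l2//; ring.
- by move=> a u v w Du Dv Dw; rewrite r1// r2//; ring.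
exists (K1 + K2) => u v Du Dv; rewrite !mulrDl (le_trans (ler_normD _ _))//.
by rewrite lerD ?b1 ?b2.
Qed.

Lemma bounded_formZ (k : R) B : bounded_form B -> bounded_form (fun u v => k * B u v).
Proof.
move=> [l r [K b]]; split.
- by move=> a u v w Du Dv Dw; rewrite l//; ring.
- by move=> a u v w Du Dv Dw; rewrite r//; ring.
exists (`|k| * K) => u v Du Dv; rewrite normrM -!mulrA ler_wpM2l// mulrA.
exact: b.
Qed.

Lemma bounded_formN B : bounded_form B -> bounded_form (fun u v => - B u v).
Proof.
move=> /(bounded_formZ (-1)); congr bounded_form.
by apply/funext => u; apply/funext => v; rewrite mulN1r.
Qed.

Lemma bounded_functionalD F1 F2 : bounded_functional F1 -> bounded_functional F2 ->
  bounded_functional (fun u => F1 u + F2 u).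
Proof.
move=> [l1 [K1 b1]] [l2 [K2 b2]]; split.
- by move=> a u v Du Dv; rewrite l1// l2//; ring.
exists (K1 + K2) => u Du; rewrite mulrDl (le_trans (ler_normD _ _))//.
by rewrite lerD ?b1 ?b2.
Qed.

Lemma bounded_functionalZ (k : R) F : bounded_functional F ->
  bounded_functional (fun u => k * F u).
Proof.
move=> [l [K b]]; split.
- by move=> a u v Du Dv; rewrite l//; ring.
exists (`|k| * K) => u Du; rewrite normrM -!mulrA ler_wpM2l//.
exact: b.
Qed.

Lemma bounded_functionalN F : bounded_functional F ->
  bounded_functional (fun u => - F u).
Proof.
move=> /(bounded_functionalZ (-1)); congr bounded_functional.
by apply/funext => u; rewrite mulN1r.
Qed.

Lemma dotp_le_ipnorm (f g : R -> R) : sqi f -> sqi g ->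
  `|dotp f g| <= Num.sqrt (dotp f f) * Num.sqrt (dotp g g).
Proof. by move=> sf sg; exact: (ip_le_ipnorm (@sqi_semi_hilbert R)). Qed.

Lemma L2_bounded_form T1 T2 : L2_bounded T1 -> L2_bounded T2 ->
  bounded_form (fun u v => dotp (T1 u) (T2 v)).
Proof.
move=> [s1 b1 l1] [s2 b2 l2]; split.
- by move=> a u v w Du Dv Dw; rewrite l1// dotpL; [|exact: s1|exact: s1|exact: s2].
- move=> a u v w Du Dv Dw; rewrite l2// !(dotpC (T1 w)) dotpL//;
    [exact: s2|exact: s2|exact: s1].
exists 1 => u v Du Dv; rewrite mul1r.
apply: le_trans (dotp_le_ipnorm (s1 _ Du) (s2 _ Dv)) _.
by apply: ler_pM; rewrite ?sqrtr_ge0// ler_wsqrtr// ?b1 ?b2.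
Qed.

Lemma L2_bounded_functional (f : R -> R) T : sqi f -> L2_bounded T ->
  bounded_functional (fun u => dotp f (T u)).
Proof.
move=> sf [s b l]; split.
- move=> a u v Du Dv; rewrite l// !(dotpC f) dotpL//; exact: s.
exists (Num.sqrt (dotp f f)) => u Du.
apply: le_trans (dotp_le_ipnorm sf (s _ Du)) _.
by rewrite ler_wpM2l ?sqrtr_ge0// ler_wsqrtr// b.
Qed.

Lemma Lax_Milgram_bounded B F (al : R) : bounded_form B -> 0 < al ->
  (forall u, D u -> al * ip u u <= B u u) -> bounded_functional F ->
  exists2 u, D u & forall g, D g -> B u g = F g.
Proof.
move=> [Bl Br [K BK]] al0 Bal [Fl [KF FK]].
exact: (Lax_Milgram HD Bl Br BK al0 Bal Fl FK).
Qed.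

End bounded_forms.

Local Ltac bounded_form5 :=
  apply: bounded_formD; [apply: bounded_formD; [apply: bounded_formD;
    [apply: bounded_formD|]|]|];
  do ?[exact: L2_bounded_form];
  do ?[exact: (bounded_formZ _ (L2_bounded_form _ _))];
  exact: (bounded_formN (bounded_formZ _ (L2_bounded_form _ _))).

(** * Existence, regularity and a priori bound of weak solutions *)

Section weak_solutions.
Context {R : realType}.
Local Notation mu := (@lebesgue_measure R).
Local Notation intg A f := (mu.-integrable (A : set R) (EFin \o f)).
Local Notation fspace := ((R -> R^o) * (R -> R^o))%type.
Implicit Types (a b p q : fspace) (f k v w : R -> R).

Let E a p := dotp a.2 p.2.
Let X a p := dotp (fun x => x * a.1 x) (fun x => x * p.1 x).
Let L a p := dotp a.1 p.1.

(* Real and imaginary parts of [h_c(a + ib, p) - z <a + ib, p>] for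
   [c = c1 + i c2], [z = r + i eta] and a real test element [p]. *)
Definition form_re (c1 c2 r eta : R) a b p :=
  dotp a.2 p.2 + c1 * dotp (fun x => x * a.1 x) (fun x => x * p.1 x)
  - c2 * dotp (fun x => x * b.1 x) (fun x => x * p.1 x)
  - r * dotp a.1 p.1 + eta * dotp b.1 p.1.
Definition form_im (c1 c2 r eta : R) a b p :=
  dotp b.2 p.2 + c1 * dotp (fun x => x * b.1 x) (fun x => x * p.1 x)
  + c2 * dotp (fun x => x * a.1 x) (fun x => x * p.1 x)
  - r * dotp b.1 p.1 - eta * dotp a.1 p.1.

(** The equation [(H_c - z)(a + i b) = v + i w] in the form sense. Real test elements suffice, since
    the two parts of a complex one can be tested separately. *)
Definition weak_solution (c1 c2 r eta : R) a b v w :=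
  [/\ form_dom a, form_dom b, sqi v, sqi w & forall p, form_dom p ->
    form_re c1 c2 r eta a b p = dotp v p.1 /\
    form_im c1 c2 r eta a b p = dotp w p.1].

Let DD := prod_dom (@form_dom R) (@form_dom R).
Let ip2 := prod_ip (@form_ip R) (@form_ip R).
Let HDD : semi_hilbert DD ip2 :=
  semi_hilbert_prod (@form_semi_hilbert R) (@form_semi_hilbert R).

Let nonneg a : [/\ 0 <= L a a, 0 <= X a a & 0 <= E a a].
Proof. by split; exact: dotp_ge0. Qed.

Let ip2E u : ip2 u u =
  L u.1 u.1 + X u.1 u.1 + E u.1 u.1 + (L u.2 u.2 + X u.2 u.2 + E u.2 u.2).
Proof. by []. Qed.

Let bddL1 : L2_bounded DD ip2 (fun u : fspace * fspace => u.1.1).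
Proof.
split=> [u [[]]//|u _|//]; rewrite ip2E -/(L u.1 u.1).
by have [? ? ?] := nonneg u.1; have [? ? ?] := nonneg u.2; lra.
Qed.

Let bddL2 : L2_bounded DD ip2 (fun u : fspace * fspace => u.2.1).
Proof.
split=> [u [_ []]//|u _|//]; rewrite ip2E -/(L u.2 u.2).
by have [? ? ?] := nonneg u.1; have [? ? ?] := nonneg u.2; lra.
Qed.

Let bddE1 : L2_bounded DD ip2 (fun u : fspace * fspace => u.1.2).
Proof.
split=> [u [[]]//|u _|//]; rewrite ip2E -/(E u.1 u.1).
by have [? ? ?] := nonneg u.1; have [? ? ?] := nonneg u.2; lra.
Qed.

Let bddE2 : L2_bounded DD ip2 (fun u : fspace * fspace => u.2.2).
Proof.
split=> [u [_ []]//|u _|//]; rewrite ip2E -/(E u.2 u.2).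
by have [? ? ?] := nonneg u.1; have [? ? ?] := nonneg u.2; lra.
Qed.

Let bddX1 : L2_bounded DD ip2 (fun (u : fspace * fspace) x => x * u.1.1 x).
Proof.
have [_ _ lin] := bddL1; split=> [u [[? ? ? _] _]|u _|k u v Du Dv].
- by [].
- rewrite ip2E -/(X u.1 u.1).
  by have [? ? ?] := nonneg u.1; have [? ? ?] := nonneg u.2; lra.
- by have -> := lin k u v Du Dv; exact: mulxL.
Qed.

Let bddX2 : L2_bounded DD ip2 (fun (u : fspace * fspace) x => x * u.2.1 x).
Proof.
have [_ _ lin] := bddL2; split=> [u [_ [? ? ? _]]|u _|k u v Du Dv].
- by [].
- rewrite ip2E -/(X u.2 u.2).
  by have [? ? ?] := nonneg u.1; have [? ? ?] := nonneg u.2; lra.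
- by have -> := lin k u v Du Dv; exact: mulxL.
Qed.

(** Here [z] and the numerical range lie on opposite sides of the real axis. The real part of the
    form multiplied by [eps - i c2] has coefficients [eps] on [u'], [eps c1 + c2^2] on [x u] and
    [- c2 eta - eps r] on [u], all positive for small [eps]. *)
Lemma weak_solution_coercive (c1 c2 r eta : R) v w : 0 < c1 -> 0 < r ->
  c2 * eta < 0 -> sqi v -> sqi w -> exists a b, weak_solution c1 c2 r eta a b v w.
Proof.
move=> c10 r0 c2eta sv sw.
have c20 : c2 != 0 by apply: contraTneq c2eta => ->; rewrite mul0r ltxx.
(* Half of [- c2 eta] pays for [eps r]; the other half remains as coercivity in the [L^2] norm. *)
pose eps := - (c2 * eta) / (2 * r).
have eps0 : 0 < eps by rewrite divr_gt0 ?mulr_gt0// oppr_gt0.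
pose re (u g : fspace * fspace) := form_re c1 c2 r eta u.1 u.2 g.1.
pose im (u g : fspace * fspace) := form_im c1 c2 r eta u.1 u.2 g.1.
pose re' (u g : fspace * fspace) := form_re c1 c2 r eta u.1 u.2 g.2.
pose im' (u g : fspace * fspace) := form_im c1 c2 r eta u.1 u.2 g.2.
have bre : bounded_form DD ip2 re by rewrite /re /form_re; bounded_form5.
have bim : bounded_form DD ip2 im by rewrite /im /form_im; bounded_form5.
have bre' : bounded_form DD ip2 re' by rewrite /re' /form_re; bounded_form5.
have bim' : bounded_form DD ip2 im' by rewrite /im' /form_im; bounded_form5.
(* [B u g] is the real part of [(eps - i c2) (h_c(u, g) - z <u, g>)]. *)
pose B u g := (eps * re u g + c2 * im u g) + (eps * im' u g - c2 * re' u g).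
pose F (g : fspace * fspace) := (eps * dotp v g.1.1 + c2 * dotp w g.1.1)
  + (eps * dotp w g.2.1 - c2 * dotp v g.2.1).
have bB : bounded_form DD ip2 B.
  apply: bounded_formD; apply: bounded_formD; try exact: bounded_formZ.
  exact/bounded_formN/bounded_formZ.
have bF : bounded_functional DD ip2 F.
  apply: bounded_functionalD; apply: bounded_functionalD;
    try exact: (bounded_functionalZ _ (L2_bounded_functional _ _)).
  exact: (bounded_functionalN (bounded_functionalZ _ (L2_bounded_functional _ _))).
pose al := Num.min eps (Num.min (c2 ^+ 2) (- (c2 * eta) / 2)).
have P0 : 0 < - (c2 * eta) by rewrite oppr_gt0.
have al0 : 0 < al by rewrite !lt_min eps0 (divr_gt0 P0)// andbT exprn_even_gt0.
have al1 : al <= eps by rewrite ge_min lexx.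
have al2 : al <= c2 ^+ 2 by rewrite !ge_min lexx orbT.
have al3 : al <= - (c2 * eta) / 2 by rewrite !ge_min lexx !orbT.
have [||||[a b] [Da Db] BF] := @Lax_Milgram_bounded _ _ DD ip2 HDD B F al => //.
  move=> u Du; have [L1 X1 E1] := nonneg u.1; have [L2 X2 E2] := nonneg u.2.
  have epsr : eps * r = - (c2 * eta) / 2 by rewrite /eps; field; rewrite gt_eqF.
  have -> : B u u = eps * (E u.1 u.1 + E u.2 u.2) +
      (eps * c1 + c2 ^+ 2) * (X u.1 u.1 + X u.2 u.2) +
      (- (c2 * eta) - eps * r) * (L u.1 u.1 + L u.2 u.2).
    rewrite /B /re /im /re' /im' /form_re /form_im /E /X /L.
    rewrite !(dotpC u.2.2) !(dotpC (fun x => x * u.2.1 x)) !(dotpC u.2.1).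
    ring.
  rewrite ip2E epsr.
  have e1 := ler_wpM2r (addr_ge0 E1 E2) al1.
  have e2 := ler_wpM2r (addr_ge0 X1 X2) al2.
  have e3 := ler_wpM2r (addr_ge0 L1 L2) al3.
  have e4 : 0 <= eps * c1 * (X u.1 u.1 + X u.2 u.2).
    by rewrite mulr_ge0 ?addr_ge0// mulr_ge0// ltW.
  lra.
exists a, b; split=> // p Dp.
have D0 := sh_D0 (@form_semi_hilbert R).
have d0 f : dotp f (fun=> 0) = 0.
  by rewrite /dotp (_ : (fun x => _) = cst 0) ?Rintegral_cst//= ?mul0r//;
    apply/funext => x /=; rewrite mulr0.
have x0 : (fun x : R => x * 0) = (fun=> 0) by apply/funext => x; rewrite mulr0.
have fr0 : form_re c1 c2 r eta a b 0 = 0.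
  by rewrite /form_re /= x0 !d0; ring.
have fi0 : form_im c1 c2 r eta a b 0 = 0.
  by rewrite /form_im /= x0 !d0; ring.
(* The two tests give the real and imaginary parts of [eps - i c2] times the equation, a linear
   system of determinant [eps^2 + c2^2]. *)
have := BF (p, 0) (conj Dp D0); have := BF (0, p) (conj D0 Dp).
rewrite /B /F /re /im /re' /im' /= fr0 fi0 !d0.
set a1 := form_re _ _ _ _ _ _ _; set a2 := form_im _ _ _ _ _ _ _.
set b1 := dotp v _; set b2 := dotp w _ => e1 e2.
have K0 : eps ^+ 2 + c2 ^+ 2 != 0 by rewrite gt_eqF// ltr_wpDr ?sqr_ge0// exprn_gt0.
split; apply: (mulfI K0).
- rewrite (_ : _ * a1 = eps * (eps * a1 + c2 * a2 + (eps * 0 - c2 * 0))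
    - c2 * (eps * 0 + c2 * 0 + (eps * a2 - c2 * a1))); last by ring.
  by rewrite e1 e2; ring.
- rewrite (_ : _ * a2 = c2 * (eps * a1 + c2 * a2 + (eps * 0 - c2 * 0))
    + eps * (eps * 0 + c2 * 0 + (eps * a2 - c2 * a1))); last by ring.
  by rewrite e1 e2; ring.
Qed.

(* Exchanging real and imaginary parts amounts to complex conjugation, up to
   the factor i. *)
Lemma weak_solution_swap (c1 c2 r eta : R) a b v w :
  weak_solution c1 c2 r eta a b v w -> weak_solution c1 (- c2) r (- eta) b a w v.
Proof.
move=> [Da Db sv sw H]; split=> // p /H[H1 H2].
by rewrite -H1 -H2 /form_re /form_im; split; ring.
Qed.

Lemma primitive_ae (F q q' : R -> R) : primitive F q -> measurable_fun setT q' ->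
  {ae mu, forall x, q x = q' x} -> primitive F q'.
Proof.
move=> [mq qi Fq] mq' qq'; split=> // [a b|a b ab].
  by apply: (intg_ae _ _ qq' (qi a b)) => //; exact: measurable_funTS.
by rewrite Fq//; apply: Rintegral_ae_eq => //; exact: measurable_funTS.
Qed.

Lemma weak_solution_locint (c1 c2 r eta : R) (f k v : R -> R) :
  locint f -> locint k -> locint v ->
  locint (fun x => (c1 * x ^+ 2 - r) * f x - (c2 * x ^+ 2 - eta) * k x - v x).
Proof.
move=> lf lk lv.
have cq (c e : R) : continuous (fun x : R => c * x ^+ 2 - e).
  move=> x; apply: cvgB; last exact: cvg_cst.
  by apply: cvgM; [exact: cvg_cst|exact: exprn_continuous].
by apply: locintB => //; apply: locintB; under eq_fun do rewrite mulrC;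
  exact: locintM.
Qed.

Lemma test_form_dom (phi : R -> R) : test_function phi ->
  form_dom (phi, derive1 phi).
Proof.
move=> tphi; split; [exact: test_sqi|exact/test_sqi/test_function_derive1|
  exact: test_mulx_sqi|exact/primitive_wder/test_primitive].
Qed.

(** The form is tested with [(phi, phi')], and the factor [x^2] is moved onto the compactly
    supported [phi], as [x^2 u] is not known to be square integrable. *)
Lemma weak_solution_wder (c1 c2 r eta : R) a b v w :
  weak_solution c1 c2 r eta a b v w ->
  wder a.2 (fun x => (c1 * x ^+ 2 - r) * a.1 x - (c2 * x ^+ 2 - eta) * b.1 x - v x).
Proof.
move=> [[sa sa2 sxa _] [sb sb2 sxb _] sv sw H] phi tphi.
have [sp sxp] := (test_sqi tphi, test_mulx_sqi tphi).
have sxxp : sqi (fun x => x * (x * phi x)).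
  have [N _ phiN] := test_function_supp tphi.
  apply: (@continuous_supp_sqi _ _ N) => [x|x /phiN ->]; last by rewrite !mulr0.
  apply: cvgM; first exact: cvg_id.
  apply: cvgM; first exact: cvg_id.
  exact: primitive_continuous (test_primitive tphi) x.
have X2 (f : R -> R) : dotp (fun x => x * f x) (fun x => x * phi x) =
    dotp f (fun x => x * (x * phi x)).
  by apply: eq_Rintegral => x _; ring.
pose psi (c e : R) x := c * (x * (x * phi x)) + - e * phi x.
have spsi c e : sqi (psi c e) by apply: sqiD; exact: sqiZ.
have dpsi f c e : sqi f ->
    dotp f (psi c e) = c * dotp f (fun x => x * (x * phi x)) - e * dotp f phi.
  move=> sf; rewrite dotpC dotpL//; last exact: sqiZ.
  by rewrite dotpZ// !(dotpC _ f) mulNr.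
have [H1 _] := H _ (test_form_dom tphi).
rewrite (_ : \int[mu]_x (_ * phi x) =
    dotp a.1 (psi c1 r) - dotp b.1 (psi c2 eta) - dotp v phi); last first.
  transitivity (\int[mu]_x
      (a.1 x * psi c1 r x - b.1 x * psi c2 eta x - v x * phi x)).
    by apply: eq_Rintegral => x _; rewrite /psi; ring.
  rewrite RintegralB//; [|by apply: intgB => //; exact: sqiM|exact: sqiM].
  by rewrite RintegralB//; exact: sqiM.
rewrite !dpsi//.
move: H1; rewrite /form_re /= !X2 -/(dotp a.2 _) => <-.
by ring.
Qed.

(** The du Bois-Reymond lemma applies to [u], whose weak derivative is square integrable, and again
    to [u'], whose weak derivative is locally integrable by the equation. The second component is
    handled by [weak_solution_swap]. *)
Lemma weak_solution_primitive (c1 c2 r eta : R) a b v w :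
  weak_solution c1 c2 r eta a b v w ->
  exists f k f1 k1, [/\ primitive f f1, primitive k k1,
    primitive f1 (fun x => (c1 * x ^+ 2 - r) * f x - (c2 * x ^+ 2 - eta) * k x - v x),
    primitive k1 (fun x => (c1 * x ^+ 2 - r) * k x + (c2 * x ^+ 2 - eta) * f x - w x) &
    [/\ {ae mu, forall x, a.1 x = f x}, {ae mu, forall x, b.1 x = k x},
      {ae mu, forall x, a.2 x = f1 x} & {ae mu, forall x, b.2 x = k1 x}]].
Proof.
move=> H; have [[sa sa2 sxa wa] [sb sb2 sxb wb] sv sw _] := H.
have [la lb lv lw] := And4 (sqi_locint sa) (sqi_locint sb) (sqi_locint sv) (sqi_locint sw).
have wa2 := weak_solution_wder H.
have wb2 := weak_solution_wder (weak_solution_swap H).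
have [f pf af] := du_Bois_Reymond la (sqi_locint sa2) wa.
have [k pk ak] := du_Bois_Reymond lb (sqi_locint sb2) wb.
have [f1 pf1 af1] := du_Bois_Reymond (sqi_locint sa2)
  (weak_solution_locint c1 c2 r eta la lb lv) wa2.
have [k1 pk1 ak1] := du_Bois_Reymond (sqi_locint sb2)
  (weak_solution_locint c1 (- c2) r (- eta) lb la lw) wb2.
have lF (F q : R -> R) : primitive F q -> locint F.
  by move=> /primitive_continuous/continuous_locint.
have [[lf lk] [lf1 lk1]] := ((lF _ _ pf, lF _ _ pk), (lF _ _ pf1, lF _ _ pk1)).
exists f, k, f1, k1; split=> //.
- by apply: primitive_ae pf _ af1; case: lf1.
- by apply: primitive_ae pk _ ak1; case: lk1.
- apply: primitive_ae pf1 _ _.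
    exact: (weak_solution_locint c1 c2 r eta lf lk lv).1.
  by apply: ae_imp2 af ak => x -> ->.
- rewrite (_ : (fun x => _) = (fun x => (c1 * x ^+ 2 - r) * k x -
      (- c2 * x ^+ 2 - - eta) * f x - w x)); last by apply/funext => x; ring.
  apply: primitive_ae pk1 _ _.
    exact: (weak_solution_locint c1 (- c2) r (- eta) lk lf lw).1.
  by apply: ae_imp2 af ak => x -> ->.
Qed.

(** The square of the constant in the resolvent bound; [|c2|] occurs because conjugation reduces to
    a positive [c2]. *)
Definition a_priori_const (c1 c2 C0 : R) : R :=
  let kap := C0 + 1 + `|c2|^-1 in
  8 * localization_const `|c2| C0 kap ^+ 2 * (2 * flux_const c1 `|c2| C0 kap + 2) ^+ 2.

Lemma a_priori_const_ge0 (c1 c2 C0 : R) : 0 <= a_priori_const c1 c2 C0.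
Proof. by rewrite /a_priori_const /= mulr_ge0 ?sqr_ge0// mulr_ge0 ?sqr_ge0. Qed.

Definition a_priori_threshold (c1 c2 C0 : R) : R :=
  let kap := C0 + 1 + `|c2|^-1 in
  8 * flux_const c1 `|c2| C0 kap * localization_const `|c2| C0 kap.

Lemma a_priori (c1 c2 C0 lam eta : R) a b v w :
  0 < c1 -> c2 != 0 -> 0 < C0 -> 1 <= lam ->
  a_priori_threshold c1 c2 C0 <= lam ^+ 4 -> `|eta| <= C0 * lam ^+ 2 ->
  weak_solution c1 c2 (lam ^+ 6) eta a b v w ->
  lam ^+ 4 * (dotp a.1 a.1 + dotp b.1 b.1) <=
    a_priori_const c1 c2 C0 * (dotp v v + dotp w w).
Proof.
rewrite /a_priori_threshold /a_priori_const/= => c10 c20 C00 lam1.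
wlog c2gt0 : c2 eta a b v w c20 / 0 < c2 => [gt0 thr etaC H|].
  have [c2p|c2n] := ltrP 0 c2; first exact: (gt0 _ _ _ _ _ _ c20 c2p thr etaC H).
  have c2n' : 0 < - c2 by rewrite oppr_gt0 lt_neqAle c20.
  rewrite (addrC (dotp a.1 _)) (addrC (dotp v _)) -[`|c2|]normrN.
  by apply: (@gt0 (- c2) (- eta)); rewrite ?oppr_eq0 ?normrN//;
    exact: weak_solution_swap.
rewrite (gtr0_norm c2gt0) => thr etaC H.
have [f [k [f1 [k1 [pf pk pf1 pk1 [af ak af1 ak1]]]]]] := weak_solution_primitive H.
have [[sa sa2 sxa wa] [sb sb2 sxb wb] sv sw _] := H.
have mP (F q : R -> R) : primitive F q -> measurable_fun setT F.
  by move=> /primitive_continuous/continuous_measurable_fun.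
have [sf sk] := (sqi_ae (mP _ _ pf) af sa, sqi_ae (mP _ _ pk) ak sb).
have [sf1 sk1] := (sqi_ae (mP _ _ pf1) af1 sa2, sqi_ae (mP _ _ pk1) ak1 sb2).
have sx (F q c : R -> R) : primitive F q -> {ae mu, forall x, c x = F x} ->
    sqi (fun x => x * c x) -> sqi (fun x => x * F x).
  move=> pF cF; apply: sqi_ae; last by apply: ae_imp cF => x ->.
  by apply: measurable_funM => //; exact: mP pF.
have := a_priori_pos c10 c2gt0 C00 lam1 etaC pf pk pf1 pk1 sf sk sf1 sk1
  (sx _ _ _ pf af sxa) (sx _ _ _ pk ak sxb) sv sw thr.
rewrite !RintegralD//; [|by case: sv|by case: sw|by case: sf|by case: sk].
rewrite -!dotpE; congr (_ * _ <= _).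
by congr (_ + _); apply/esym/dotp_ae => //; [case: sf|case: sf|case: sk|case: sk].
Qed.

End weak_solutions.

(** * Solvability by continuation in [eta] *)

Section continuation.
Context {R : realType}.
Local Notation mu := (@lebesgue_measure R).
Local Notation fspace := ((R -> R^o) * (R -> R^o))%type.
Implicit Types (a b p : fspace) (v w : R -> R).

Lemma weak_solutionB (c1 c2 r eta : R) a b a' b' v w v' w' :
  weak_solution c1 c2 r eta a b v w -> weak_solution c1 c2 r eta a' b' v' w' ->
  weak_solution c1 c2 r eta (a - a') (b - b')
    (fun x => v x - v' x) (fun x => w x - w' x).
Proof.
move=> [Da Db sv sw H] [Da' Db' sv' sw' H'].
have HF := @form_semi_hilbert R.
split; [exact: (sh_DB HF)|exact: (sh_DB HF)|exact: sqiB|exact: sqiB|move=> p Dp].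
have [[H1 H2] [H1' H2']] := (H p Dp, H' p Dp).
have [sp sp2 sxp _] := Dp.
have [[sa sa2 sxa _] [sb sb2 sxb _]] := (Da, Db).
have [[sa' sa2' sxa' _] [sb' sb2' sxb' _]] := (Da', Db').
have xB (f g : R -> R) : (fun x => x * (f x - g x)) = (fun x => x * f x - x * g x).
  by apply/funext => x; rewrite mulrBr.
rewrite !dotpB// -H1 -H2 -H1' -H2' /form_re /form_im.
rewrite -[(a - a').1]/(fun x => a.1 x - a'.1 x) -[(b - b').1]/(fun x => b.1 x - b'.1 x).
rewrite -[(a - a').2]/(fun x => a.2 x - a'.2 x) -[(b - b').2]/(fun x => b.2 x - b'.2 x).
by rewrite !xB !dotpB//; split; ring.
Qed.

Lemma dotpZZ (k : R) (f : R -> R) : sqi f ->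
  dotp (fun x => k * f x) (fun x => k * f x) = k ^+ 2 * dotp f f.
Proof.
move=> sf; have sk := sqiZ k sf.
by rewrite dotpZ// dotpC dotpZ// mulrA expr2.
Qed.

Variables (c1 c2 C0 lam : R).
Hypotheses (c10 : 0 < c1) (c20 : c2 != 0) (C00 : 0 < C0) (lam1 : 1 <= lam).
Hypothesis thr : a_priori_threshold c1 c2 C0 <= lam ^+ 4.

Let K := a_priori_const c1 c2 C0.

Let lam0 : 0 < lam. Proof. exact: lt_le_trans lam1. Qed.

Definition solvable (eta : R) := forall v w, sqi v -> sqi w ->
  exists a b, weak_solution c1 c2 (lam ^+ 6) eta a b v w.

(** The equation at [eta'] is the one at [eta] with [i (eta' - eta) u] added to the right-hand side.
    Solving at [eta] for a given [u] on the right is a contraction of factor [1/2] in [L^2], by the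
    a priori estimate applied to differences; the choice of solutions need not be linear. *)
Lemma solvable_step (eta eta' : R) : `|eta| <= C0 * lam ^+ 2 ->
  4 * K * (eta' - eta) ^+ 2 <= lam ^+ 4 -> solvable eta -> solvable eta'.
Proof.
move=> etaC small S v w sv sw.
pose del := eta' - eta.
pose D2 : set fspace := prod_dom (sqi : set (R -> R^o)) (sqi : set (R -> R^o)).
pose ip2 := prod_ip (@dotp R : (R -> R^o) -> (R -> R^o) -> R) (@dotp R).
have H2 : semi_hilbert D2 ip2.
  exact: semi_hilbert_prod (@sqi_semi_hilbert R) (@sqi_semi_hilbert R).
have ex (u : fspace) : exists s : fspace * fspace, D2 u ->
    weak_solution c1 c2 (lam ^+ 6) eta s.1 s.2
      (fun x => v x - del * u.2 x) (fun x => w x + del * u.1 x).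
  have [[su1 su2]|nDu] := pselect (D2 u); last by exists (0, 0).
  have [||a [b ab]] := S (fun x => v x - del * u.2 x) (fun x => w x + del * u.1 x).
  - by apply: sqiB => //; exact: sqiZ.
  - by apply: sqiD => //; exact: sqiZ.
  - by exists (a, b).
have [U HU] := boolp.choice ex.
have [|u Du|u u' Du Du'|u Du Tu] := @contraction_fixpoint _ _ D2 ip2 H2
  (fun u => ((U u).1.1, (U u).2.1)) (2^-1).
- by apply/andP; split; lra.
- by have [[? _ _ _] [? _ _ _] _ _ _] := HU u Du.
- have [[su1 su2] [su1' su2']] := (Du, Du').
  have sol := weak_solutionB (HU u Du) (HU u' Du').
  have := a_priori c10 c20 C00 lam1 thr etaC sol.
  have -> : (fun x => v x - del * u.2 x - (v x - del * u'.2 x)) =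
      (fun x => - del * (u.2 x - u'.2 x)) by apply/funext => x; ring.
  have -> : (fun x => w x + del * u.1 x - (w x + del * u'.1 x)) =
      (fun x => del * (u.1 x - u'.1 x)) by apply/funext => x; ring.
  have [sB1 sB2] := (sqiB su1 su1', sqiB su2 su2').
  rewrite !dotpZZ// sqrrN -mulrDr addrC (addrC (dotp (fun x => u.2 x - _) _)).
  rewrite -[X in del ^+ 2 * X]/(ip2 (u - u') (u - u')) => apr.
  have l4 : 0 < lam ^+ 4 by rewrite exprn_gt0.
  have H0 : 0 <= ip2 (u - u') (u - u').
    by apply: (sh_ge0 H2); exact: (sh_DB H2).
  have -> : 2^-1 = Num.sqrt (4^-1 : R).
    by rewrite -[LHS]ger0_norm ?invr_ge0// -sqrtr_sqr; congr Num.sqrt; field.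
  rewrite /ipnorm -sqrtrM ?invr_ge0// ler_wsqrtr//.
  rewrite -(ler_pM2l l4) [X in lam ^+ 4 * X <= _]addrC; apply: le_trans apr _.
  have := ler_wpM2r H0 small; rewrite -/del -/K; move: (ip2 _ _) => i Hi.
  lra.
have [[Da Db _ _ Hab] [su1 su2]] := (HU u Du, Du).
(* The image [U u] is taken instead of [u]: they differ by norm zero, and [U u] lies in the form
   domain. *)
exists (U u).1, (U u).2; split=> // p Dp; have [sp _ _ _] := Dp.
have DTu : D2 (((U u).1.1, (U u).2.1) - u).
  by apply: (sh_DB H2) => //; split; [case: Da|case: Db].
have Z (f g : R -> R) : sqi f -> sqi g ->
    dotp (fun x => f x - g x) (fun x => f x - g x) = 0 -> dotp g p.1 = dotp f p.1.
  move=> sf sg fg0; have := dotp_CauchySchwarz (sqiB sf sg) sp.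
  rewrite fg0 mul0r => /(conj (sqr_ge0 _))/andP/le_anti/esym/eqP.
  by rewrite sqrf_eq0 dotpB// subr_eq0 => /eqP.
have : ip2 (((U u).1.1, (U u).2.1) - u) (((U u).1.1, (U u).2.1) - u) = 0.
  by rewrite -(sqr_ipnorm H2 DTu) Tu expr0n.
move/eqP; rewrite paddr_eq0 ?dotp_ge0// => /andP[/eqP E1 /eqP E2].
have [sa sb] : sqi (U u).1.1 /\ sqi (U u).2.1 by split; [case: Da|case: Db].
have {}E1 := Z _ _ sa su1 E1; have {}E2 := Z _ _ sb su2 E2.
have [] := Hab p Dp.
have s1 := sqiZ del su1; have s2 := sqiZ del su2.
rewrite dotpB// dotpD// !dotpZ// E1 E2 /form_re /form_im /del => h1 h2.
by split; lra.
Qed.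

Lemma solvable_range (eta : R) : `|eta| <= C0 * lam ^+ 2 -> solvable eta.
Proof.
move=> etaC.
(* The end of the admissible range on the coercive side, where [c2 eta < 0]. *)
pose eta0 := - Num.sg c2 * C0 * lam ^+ 2.
have eta0C : `|eta0| <= C0 * lam ^+ 2.
  by rewrite /eta0 !normrM normrN normr_sg c20 mul1r !ger0_norm ?exprn_ge0// ltW.
have S0 : solvable eta0.
  move=> v w sv sw; apply: weak_solution_coercive => //; first exact: exprn_gt0.
  rewrite /eta0 mulNr mulNr mulrN oppr_lt0 !mulrA (mulrC c2) -normrEsg.
  by rewrite !mulr_gt0// ?normr_gt0// exprn_gt0.
have [d d0 Kd] : exists2 d, 0 < d & 4 * K * d ^+ 2 <= lam ^+ 4.
  have l2 : 1 <= lam ^+ 2 by rewrite exprn_ege1.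
  (* Admissible because [4 K <= (4 |K| + 1)^2], and proportional to [lam^2]. *)
  exists (lam ^+ 2 / (4 * `|K| + 1)).
    by rewrite divr_gt0 ?exprn_gt0// ltr_wpDl// mulr_ge0.
  rewrite exprMn -exprM exprVn.
  have k1 : 1 <= 4 * `|K| + 1 by rewrite lerDr mulr_ge0.
  have k0 : 0 < 4 * `|K| + 1 by exact: lt_le_trans k1.
  rewrite mulrCA ler_piMr ?exprn_ge0//; first exact: ltW.
  rewrite ler_pdivrMr ?exprn_gt0// mul1r.
  apply: (@le_trans _ _ (4 * `|K| + 1)); last by rewrite expr2 ler_peMr// ltW.
  by have := ler_norm K; lra.
have conv n : forall e, `|e| <= C0 * lam ^+ 2 -> `|e - eta0| <= n%:R * d -> solvable e.
  elim: n => [e _|n IH e eC en].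
    by rewrite mul0r normr_le0 subr_eq0 => /eqP ->.
  (* The last step covers the fraction [1 / (n + 1)] of the segment from [eta0] to [e]; convexity
     keeps [e'] in the admissible range. *)
  pose t := n%:R / n.+1%:R : R.
  have n1 : 0 < n.+1%:R :> R by rewrite ltr0n.
  have t01 : 0 <= t <= 1.
    by rewrite divr_ge0//= ler_pdivrMr// mul1r ler_nat.
  have t1 : 1 - t = n.+1%:R^-1 by rewrite /t -natr1; field; rewrite natr1 gt_eqF.
  pose e' := eta0 + t * (e - eta0).
  have e'C : `|e'| <= C0 * lam ^+ 2.
    rewrite (_ : e' = (1 - t) * eta0 + t * e); last by rewrite /e'; ring.
    apply: le_trans (ler_normD _ _) _; rewrite (normrM t) (normrM (1 - t)).
    have /andP[t0 t1'] := t01; rewrite (ger0_norm t0) (@ger0_norm _ (1 - t)) ?subr_ge0//.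
    have := ler_wpM2l t0 eC; have : 0 <= 1 - t by rewrite subr_ge0.
    by move=> /ler_wpM2l/(_ _ _ eta0C); lra.
  apply: (solvable_step e'C); last apply: IH => //.
    apply: le_trans Kd; rewrite ler_wpM2l//.
      by rewrite mulr_ge0// a_priori_const_ge0.
    rewrite -[leLHS]real_normK ?num_real// ler_sqr ?nnegrE//; last exact: ltW.
    rewrite (_ : e - e' = (1 - t) * (e - eta0)); last by rewrite /e'; ring.
    rewrite t1 normrM ger0_norm ?invr_ge0// mulrC ler_pdivrMr// mulrC.
    exact: en.
  rewrite /e' addrC addKr normrM ger0_norm; last by case/andP: t01.
  apply: le_trans (ler_wpM2l _ en) _; first by case/andP: t01.
  by rewrite /t mulrA divfK ?gt_eqF.
pose n := Num.truncn (`|eta - eta0| / d); apply: (conv n.+1) => //.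
by rewrite -ler_pdivrMr// ltW// truncnS_gt.
Qed.

End continuation.

(** * The operator *)

Section complex_L2.
Context {R : realType}.
Local Notation mu := (@lebesgue_measure R).
Local Notation intg A f := (mu.-integrable (A : set R) (EFin \o f)).
Implicit Types (u v g : R -> R[i]).

Local Notation re u := (fun x : R => complex.Re (u x)).
Local Notation im u := (fun x : R => complex.Im (u x)).

Lemma sqr_normc (z : R[i]) : Normc.normc z ^+ 2 = complex.Re z ^+ 2 + complex.Im z ^+ 2.
Proof. by case: z => x y /=; rewrite sqr_sqrtr// addr_ge0// sqr_ge0. Qed.

Lemma measurable_normc_sqr u : measurable_fun setT (re u) ->
  measurable_fun setT (im u) ->
  measurable_fun setT (fun x : R => complex.Re (u x) ^+ 2 + complex.Im (u x) ^+ 2).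
Proof.
by move=> mr mi; apply: measurable_funD; exact: measurable_funX.
Qed.

Lemma L2norm_poweR u : L2norm u =
  ((\int[mu]_x (complex.Re (u x) ^+ 2 + complex.Im (u x) ^+ 2)%:E) `^ 2^-1)%E.
Proof.
rewrite /L2norm unlock; congr (_ `^ _)%E; apply: eq_integral => x _ /=.
rewrite ger0_norm; last by case: (u x) => ? ?; exact: sqrtr_ge0.
by rewrite powR_mulrn ?sqr_normc//; case: (u x) => ? ?; exact: sqrtr_ge0.
Qed.

Lemma L2P u : L2 u <-> sqi (re u) /\ sqi (im u).
Proof.
split=> [[mr mi]|[[mr ri] [mi ii]]].
  rewrite /finite_norm -/(L2norm u) L2norm_poweR => fin.
  have fi : intg setT (fun x => complex.Re (u x) ^+ 2 + complex.Im (u x) ^+ 2).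
    apply/integrableP; split.
      by apply/measurable_EFinP; exact: measurable_normc_sqr.
    under eq_integral do rewrite gee0_abs ?lee_fin ?addr_ge0 ?sqr_ge0//.
    rewrite ltey; apply: contraTneq fin => fin.
    rewrite (_ : (\int[mu]_x _ = +oo)%E)//.
    by rewrite poweRyr ?invr_neq0// ltxx.
  split; split=> //; apply: (intg_le measurableT _ fi) => [|x _].
  - exact: measurable_funX.
  - by rewrite ger0_norm ?sqr_ge0// lerDl sqr_ge0.
  - exact: measurable_funX.
  - by rewrite ger0_norm ?sqr_ge0// lerDr sqr_ge0.
split=> //; rewrite /finite_norm -/(L2norm u) L2norm_poweR.
have fi : intg setT (fun x => complex.Re (u x) ^+ 2 + complex.Im (u x) ^+ 2).
  by apply: intgD.
have := @integrable_fin_num _ _ _ mu setT measurableT _ fi.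
by rewrite /= fin_numE; case: (\int[mu]_x _)%E => // r _; rewrite poweR_EFin ltry.
Qed.

Lemma L2normE u : L2 u -> L2norm u =
  (Num.sqrt (dotp (re u) (re u) + dotp (im u) (im u)))%:E.
Proof.
move=> /L2P[[mr ri] [mi ii]]; rewrite L2norm_poweR !dotpE -RintegralD//.
have fi : intg setT (fun x => complex.Re (u x) ^+ 2 + complex.Im (u x) ^+ 2).
  by apply: intgD.
rewrite -powR12_sqrt; last first.
  by apply: Rintegral_ge0 => x _; rewrite addr_ge0// sqr_ge0.
by rewrite -poweR_EFin fineK//; exact: (@integrable_fin_num _ _ _ mu).
Qed.

Lemma is_weak_derivativeP u v :
  is_weak_derivative u v <-> wder (re u) (re v) /\ wder (im u) (im v).
Proof.
have E g (phi : R -> R) : cintegral (fun x => g x * (phi x)%:C%C) =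
    ((\int[mu]_x (complex.Re (g x) * phi x)) +i*
     (\int[mu]_x (complex.Im (g x) * phi x)))%C.
  by rewrite /cintegral; congr (_ +i* _)%C; apply: eq_Rintegral => x _;
    case: (g x) => a b /=; rewrite mulr0 ?subr0 ?add0r.
split=> [H|[Hr Hi] phi tphi]; last first.
  by rewrite !E Hr// Hi.
by split=> phi tphi; have := H phi tphi; rewrite !E => /eqP;
  rewrite eq_complex => /andP[/eqP ? /eqP ?].
Qed.

Lemma cinnerE u v : L2 u -> L2 v -> cintegral (fun x => u x * (v x)^*%C) =
  ((dotp (re u) (re v) + dotp (im u) (im v)) +i*
   (dotp (im u) (re v) - dotp (re u) (im v)))%C.
Proof.
move=> /L2P[ur ui] /L2P[vr vi]; rewrite /cintegral /dotp.
rewrite -RintegralD//; [|exact: sqiM|exact: sqiM].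
rewrite -RintegralB//; [|exact: sqiM|exact: sqiM].
congr (_ +i* _)%C; apply: eq_Rintegral => x _; case: (u x) => a b;
  case: (v x) => a' b' /=; ring.
Qed.

End complex_L2.

(** * The operator in terms of weak solutions *)

Section oscillator.
Context {R : realType}.
Local Notation mu := (@lebesgue_measure R).
Local Notation intg A f := (mu.-integrable (A : set R) (EFin \o f)).
Local Notation fspace := ((R -> R^o) * (R -> R^o))%type.
Implicit Types (a b p q : fspace) (u v g : R -> R[i]).

Local Notation re u := (fun x : R => complex.Re (u x)).
Local Notation im u := (fun x : R => complex.Im (u x)).

Definition cfun a b : R -> R[i] := fun x => (a.1 x +i* b.1 x)%C.

Lemma cfun_re_im u (f k : R -> R) : u = cfun (re u, f) (im u, k).
Proof. by apply/funext => x; rewrite /cfun /=; case: (u x). Qed.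

Lemma weighted_sqi u : L2 u ->
  (\int[mu]_x (x ^+ 2 * Normc.normc (u x) ^+ 2)%:E < +oo)%E <->
  sqi (fun x => x * complex.Re (u x)) /\ sqi (fun x => x * complex.Im (u x)).
Proof.
move=> /L2P[[mr _] [mi _]].
have mrx : measurable_fun setT (fun x : R => x * complex.Re (u x)).
  exact: measurable_funM.
have mix : measurable_fun setT (fun x : R => x * complex.Im (u x)).
  exact: measurable_funM.
pose h x := (x * complex.Re (u x)) ^+ 2 + (x * complex.Im (u x)) ^+ 2.
have -> : (\int[mu]_x (x ^+ 2 * Normc.normc (u x) ^+ 2)%:E = \int[mu]_x (h x)%:E)%E.
  by apply: eq_integral => x _; rewrite sqr_normc /h; congr EFin; ring.
have mh : measurable_fun setT h by apply: measurable_funD; exact: measurable_funX.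
split=> [fin|[[_ ri] [_ ii]]]; last first.
  have := @integrable_fin_num _ _ _ mu setT measurableT _ (intgD measurableT ri ii).
  by rewrite fin_num_abs => /(le_lt_trans (lee_abs _)).
have fi : intg setT h.
  apply/integrableP; split; first exact/measurable_EFinP.
  by under eq_integral do rewrite gee0_abs ?lee_fin ?addr_ge0 ?sqr_ge0//.
split; split=> //; apply: (intg_le measurableT _ fi) => [|x _].
- exact: measurable_funX.
- by rewrite ger0_norm ?sqr_ge0// lerDl sqr_ge0.
- exact: measurable_funX.
- by rewrite ger0_norm ?sqr_ge0// lerDr sqr_ge0.
Qed.

Lemma weak_deriveP u : W12 u ->
  L2 (weak_derive u) /\ is_weak_derivative u (weak_derive u).
Proof.
move=> [_ [u' Lu' uu']]; rewrite /weak_derive.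
by apply: (@xgetPex _ _ [set f' | L2 f' /\ is_weak_derivative u f']); exists u'.
Qed.

Lemma oscillator_domainP u : oscillator_form_domain u ->
  form_dom (re u, re (weak_derive u)) /\ form_dom (im u, im (weak_derive u)).
Proof.
move=> [Wu fin]; have [/L2P[sr si] /is_weak_derivativeP[wr wi]] := weak_deriveP Wu.
have [Lu _] := Wu; have [ur ui] := (L2P u).1 Lu.
by have [xr xi] := (weighted_sqi Lu).1 fin; split; split.
Qed.

Lemma cfun_domain a b : form_dom a -> form_dom b -> oscillator_form_domain (cfun a b).
Proof.
move=> [sa sa2 sxa wa] [sb sb2 sxb wb].
have Lu : L2 (cfun a b) by apply/L2P.
split; last exact/weighted_sqi.
split=> //; exists (fun x => (a.2 x +i* b.2 x)%C); first exact/L2P.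
exact/is_weak_derivativeP.
Qed.

(** The form evaluates an arbitrarily chosen weak derivative; uniqueness up to null sets lets the
    carried derivatives replace it. *)
Lemma weak_derive_cfun a b : form_dom a -> form_dom b ->
  {ae mu, forall x, complex.Re (weak_derive (cfun a b) x) = a.2 x} /\
  {ae mu, forall x, complex.Im (weak_derive (cfun a b) x) = b.2 x}.
Proof.
move=> Da Db; have Du := cfun_domain Da Db.
have [[_ sr _ wr] [_ si _ wi]] := oscillator_domainP Du.
have [[_ sa _ wa] [_ sb _ wb]] := (Da, Db).
by split; apply: wder_unique; [exact: sqi_locint sr|exact: sqi_locint sa|
  exact: wr|exact: wa|exact: sqi_locint si|exact: sqi_locint sb|exact: wi|exact: wb].
Qed.

Lemma oscillator_formE (c1 c2 : R) a b p q :
  form_dom a -> form_dom b -> form_dom p -> form_dom q ->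
  oscillator_form (c1 +i* c2)%C (cfun a b) (cfun p q) =
  ((form_re c1 c2 0 0 a b p + form_im c1 c2 0 0 a b q) +i*
   (form_im c1 c2 0 0 a b p - form_re c1 c2 0 0 a b q))%C.
Proof.
move=> Da Db Dp Dq; have [da db] := weak_derive_cfun Da Db.
have [dp dq] := weak_derive_cfun Dp Dq.
have [Lu _] := weak_deriveP (cfun_domain Da Db).1.
have [Lg _] := weak_deriveP (cfun_domain Dp Dq).1.
have [[ur ui] [gr gi]] := ((L2P _).1 Lu, (L2P _).1 Lg).
have [[sa sa2 sxa _] [sb sb2 sxb _]] := (Da, Db).
have [[sp sp2 sxp _] [sq sq2 sxq _]] := (Dp, Dq).
have ae (f g h k : R -> R) : sqi f -> sqi g -> sqi h -> sqi k ->
    {ae mu, forall x, f x = h x} -> {ae mu, forall x, g x = k x} ->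
    dotp f g = dotp h k.
  by move=> sf sg [mh _] [mk _]; exact: dotp_ae.
rewrite /oscillator_form cinnerE//.
set wu := weak_derive (cfun a b) in ur ui da db *.
set wg := weak_derive (cfun p q) in gr gi dp dq *.
rewrite (ae (re wu) (re wg) a.2 p.2)// (ae (im wu) (im wg) b.2 q.2)//.
rewrite (ae (im wu) (re wg) b.2 p.2)// (ae (re wu) (im wg) a.2 q.2)//.
rewrite (_ : cintegral _ = cintegral (fun x =>
    (x * a.1 x +i* (x * b.1 x))%C * ((x * p.1 x +i* (x * q.1 x))^*)%C)); last first.
  congr cintegral; apply/funext => x; rewrite /cfun.
  by apply/eqP; rewrite eq_complex /=; apply/andP; split; apply/eqP; ring.
rewrite cinnerE; [|exact/L2P|exact/L2P].
by apply/eqP; rewrite eq_complex /form_re /form_im /=; apply/andP; split;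
  apply/eqP; ring.
Qed.

Section shift.
Variables (c1 c2 r eta : R).
Local Notation A := (complex_harmonic_oscillator (c1 +i* c2)%C).
Local Notation z := (r +i* eta)%C.

Let re_shift u v x :
  complex.Re (v x + z * u x) =
    complex.Re (v x) + (r * complex.Re (u x) - eta * complex.Im (u x)).
Proof. by case: (v x) (u x) => [? ?] [? ?]. Qed.

Let im_shift u v x :
  complex.Im (v x + z * u x) =
    complex.Im (v x) + (r * complex.Im (u x) + eta * complex.Re (u x)).
Proof. by case: (v x) (u x) => [? ?] [? ?]. Qed.

Let sqiL2 (f g : R -> R) (s t : R) : sqi f -> sqi g ->
  sqi (fun x => s * f x + t * g x).
Proof. by move=> sf sg; apply: sqiD; exact: sqiZ. Qed.

Let shift_inner a b p q v : form_dom a -> form_dom b -> form_dom p -> form_dom q ->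
  L2 v -> L2inner (fun x => v x + z * cfun a b x) (cfun p q) =
  ((dotp (re v) p.1 + (r * dotp a.1 p.1 - eta * dotp b.1 p.1)
   + (dotp (im v) q.1 + (r * dotp b.1 q.1 + eta * dotp a.1 q.1))) +i*
   (dotp (im v) p.1 + (r * dotp b.1 p.1 + eta * dotp a.1 p.1)
   - (dotp (re v) q.1 + (r * dotp a.1 q.1 - eta * dotp b.1 q.1))))%C.
Proof.
move=> [sa _ _ _] [sb _ _ _] [sp _ _ _] [sq _ _ _] /L2P[sv sv'].
have re_w : re (fun x => v x + z * cfun a b x) =
    (fun x => complex.Re (v x) + (r * a.1 x + - eta * b.1 x)).
  by apply/funext => x; rewrite re_shift mulNr.
have im_w : im (fun x => v x + z * cfun a b x) =
    (fun x => complex.Im (v x) + (r * b.1 x + eta * a.1 x)).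
  by apply/funext => x; rewrite im_shift.
rewrite /L2inner cinnerE; last exact/L2P.
  rewrite re_w im_w /=.
  rewrite !dotpD//; do ?[exact: sqiZ|exact: sqiL2].
  by rewrite !dotpZ// !mulNr.
by apply/L2P; rewrite re_w im_w; split; apply: sqiD => //; exact: sqiL2.
Qed.

(** The operator asserts square integrability of [u] and [v + z u] only; [v] is a combination of the
    two. *)
Lemma shifted_L2 u v : shifted A z u v -> L2 v.
Proof.
move=> [[[/L2P[sr si] _] _] /L2P[wr wi] _]; apply/L2P.
rewrite (_ : re v = fun x => complex.Re (v x + z * u x) -
    (r * complex.Re (u x) + - eta * complex.Im (u x))); last first.
  by apply/funext => x; rewrite re_shift mulNr addrK.
rewrite (_ : im v = fun x => complex.Im (v x + z * u x) -
    (r * complex.Im (u x) + eta * complex.Re (u x))); last first.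
  by apply/funext => x; rewrite im_shift addrK.
by split; apply: sqiB => //; exact: sqiL2.
Qed.

Lemma shifted_weak_solution u v : shifted A z u v ->
  weak_solution c1 c2 r eta (re u, re (weak_derive u)) (im u, im (weak_derive u))
    (re v) (im v).
Proof.
move=> Auv; have Lv := shifted_L2 Auv; have [Du _ H] := Auv.
have [sr si] := (L2P v).1 Lv; have [Da Db] := oscillator_domainP Du.
set a := (re u, _) in Da *; set b := (im u, _) in Db *.
(* The single test element [(1 + i) p] yields the sum and the difference of the two real
   identities. *)
split=> // p Dp; have := H _ (cfun_domain Dp Dp).
rewrite (cfun_re_im u (re (weak_derive u)) (im (weak_derive u))) -/a -/b.
rewrite oscillator_formE// shift_inner// => /eqP.
rewrite eq_complex /= => /andP[/eqP e1 /eqP e2].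
by move: e1 e2; rewrite /form_re /form_im /= => e1 e2; split; lra.
Qed.

Lemma weak_solution_shifted a b v :
  weak_solution c1 c2 r eta a b (re v) (im v) -> shifted A z (cfun a b) v.
Proof.
move=> [Da Db sr si H]; have Lv : L2 v by exact/L2P.
have [[sa _ _ _] [sb _ _ _]] := (Da, Db).
split; first exact: cfun_domain.
  apply/L2P; split.
    rewrite (_ : (fun x => _) = fun x => complex.Re (v x) + (r * a.1 x + - eta * b.1 x)).
      by apply: sqiD => //; exact: sqiL2.
    by apply/funext => x; rewrite re_shift mulNr.
  rewrite (_ : (fun x => _) = fun x => complex.Im (v x) + (r * b.1 x + eta * a.1 x)).
    by apply: sqiD => //; exact: sqiL2.
  by apply/funext => x; rewrite im_shift.
move=> g /oscillator_domainP[].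
rewrite [in oscillator_form _ _ _](cfun_re_im g (re (weak_derive g)) (im (weak_derive g))).
rewrite [in L2inner _ _](cfun_re_im g (re (weak_derive g)) (im (weak_derive g))).
set p := (re g, _); set q := (im g, _) => Dp Dq.
rewrite oscillator_formE// shift_inner//.
have [Hp Hp'] := H _ Dp; have [Hq Hq'] := H _ Dq.
rewrite -Hp -Hp' -Hq -Hq' /form_re /form_im.
by apply/eqP; rewrite eq_complex /=; apply/andP; split; apply/eqP; ring.
Qed.

End shift.

End oscillator.

(** * Resolvent set and resolvent norm *)

Section resolvent.
Context {R : realType}.
Local Notation mu := (@lebesgue_measure R).
Local Notation re u := (fun x : R => complex.Re (u x)).
Local Notation im u := (fun x : R => complex.Im (u x)).

Lemma dotp0_ae (f : R -> R) : sqi f -> dotp f f = 0 -> {ae mu, forall x, f x = 0}.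
Proof.
move=> [_ fi]; rewrite dotpE => f0.
have := ae_zero_Rintegral0 measurableT fi (fun x _ => sqr_ge0 _) f0.
by apply: ae_imp => x /(_ I)/eqP; rewrite sqrf_eq0 => /eqP.
Qed.

Variables (c1 c2 C0 lam eta : R).
Hypotheses (c10 : 0 < c1) (c20 : c2 != 0) (C00 : 0 < C0) (lam1 : 1 <= lam).
Hypothesis thr : a_priori_threshold c1 c2 C0 <= lam ^+ 4.
Hypothesis etaC : `|eta| <= C0 * lam ^+ 2.
Local Notation A := (complex_harmonic_oscillator (c1 +i* c2)%C).
Local Notation z := (lam ^+ 6 +i* eta)%C.
Let K := a_priori_const c1 c2 C0.
Let lam0 : 0 < lam. Proof. exact: lt_le_trans lam1. Qed.

Lemma resolvent_estimate (u v : R -> R[i]) : shifted A z u v ->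
  (L2norm u <= (Num.sqrt K / lam ^+ 2)%:E * L2norm v)%E.
Proof.
move=> Auv; have Lv := shifted_L2 Auv; have [[[Lu _] _] _ _] := Auv.
have := a_priori c10 c20 C00 lam1 thr etaC (shifted_weak_solution Auv).
rewrite !L2normE// -EFinM lee_fin /= -/K => apr.
have l2 : 0 < lam ^+ 2 by rewrite exprn_gt0.
have K0 : 0 <= K := a_priori_const_ge0 _ _ _.
rewrite mulrAC ler_pdivlMr// mulrC -[lam ^+ 2](ger0_norm (ltW l2)).
rewrite -sqrtr_sqr -!sqrtrM ?sqr_ge0// ler_wsqrtr// -exprM.
exact: apr.
Qed.

(** Surjectivity comes from the continuation in [eta], the bound from the a priori estimate; so does
    injectivity, as a difference of two solutions has right-hand side zero. *)
Lemma resolvent_set_oscillator : resolvent_set A z.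
Proof.
split.
- move=> v /L2P[sr si].
  have [a [b ab]] := solvable_range c10 c20 C00 lam1 thr etaC sr si.
  by exists (cfun a b); exact: weak_solution_shifted.
- move=> u1 u2 v A1 A2.
  have [H1 H2] := (shifted_weak_solution A1, shifted_weak_solution A2).
  have H := weak_solutionB H1 H2; have [[s1 _ _ _] [s2 _ _ _] _ _ _] := H.
  have := a_priori c10 c20 C00 lam1 thr etaC H.
  have d0 (f : R -> R) : dotp (fun x => f x - f x) (fun x => f x - f x) = 0.
    rewrite /dotp; under eq_Rintegral do rewrite subrr mulr0.
    by rewrite Rintegral_cst//= mul0r.
  rewrite !d0 addr0 mulr0 pmulr_rle0 ?exprn_gt0// => le0.
  have : dotp (re u1 - re u2 : R -> R^o) (re u1 - re u2 : R -> R^o) +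
      dotp (im u1 - im u2 : R -> R^o) (im u1 - im u2 : R -> R^o) == 0.
    by rewrite eq_le le0 addr_ge0// dotp_ge0.
  rewrite paddr_eq0 ?dotp_ge0// => /andP[/eqP/(dotp0_ae s1) e1 /eqP/(dotp0_ae s2) e2].
  apply: ae_imp2 e1 e2 => x /eqP; rewrite subr_eq0 => /eqP E1 /eqP.
  rewrite subr_eq0 => /eqP E2; apply/eqP; rewrite eq_complex; apply/andP.
  by split; apply/eqP; [exact: E1|exact: E2].
- by exists (Num.sqrt K / lam ^+ 2) => u v; exact: resolvent_estimate.
Qed.

Lemma resolvent_norm_oscillator :
  (resolvent_norm A z <= (Num.sqrt K / lam ^+ 2)%:E)%E.
Proof.
rewrite /resolvent_norm asboolT; last exact: resolvent_set_oscillator.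
apply: ge_ereal_sup => _ [u [v [v1 Auv]] <-].
apply: le_trans (resolvent_estimate Auv) _.
rewrite -[leRHS]mule1 lee_wpmul2l// lee_fin divr_ge0 ?sqrtr_ge0//.
by rewrite exprn_ge0// ltW.
Qed.

End resolvent.

Theorem theorem3p1 (R : realType) (c : R[i]) (C0 : R)
    (Rec_gt0 : 0 < complex.Re c) (Imc_neq0 : complex.Im c != 0)
    (C0_gt0 : 0 < C0) :
  exists M R0 : R, [/\ 0 < M, 0 < R0
    & forall z : R[i],
        0 < complex.Re z ->
        `|complex.Im z| <= C0 * complex.Re z `^ (1 / 3) ->
        R0 <= Normc.normc z ->
        resolvent_set (complex_harmonic_oscillator c) z /\
        (resolvent_norm (complex_harmonic_oscillator c) z
           <= (M * Normc.normc z `^ (- (1 / 3)))%:E)%E].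
Proof.
case: c Rec_gt0 Imc_neq0 => c1 c2 /= c10 c20.
pose T := a_priori_threshold c1 c2 C0; pose K := a_priori_const c1 c2 C0.
(* As [|z| <= r + C0 lam^2], the radius forces [lam >= 1 + |T|], hence [lam >= 1] and [lam^4 >= T].
   Then [|z| <= (1 + C0) r], so [lam^-2 = r^(-1/3)] is at most [(1 + C0)^(1/3) |z|^(-1/3)]. The
   summand [1] makes the constant positive. *)
exists ((Num.sqrt K + 1) * (1 + C0) `^ (1 / 3)), ((1 + C0) * (1 + `|T|) ^+ 6).
have C1 : 0 < 1 + C0 by rewrite addr_gt0.
have T1 : 1 <= 1 + `|T| by rewrite lerDl.
have T0 : 0 < 1 + `|T| by exact: lt_le_trans T1.
have K1 : 0 < Num.sqrt K + 1 by rewrite ltr_wpDl ?sqrtr_ge0.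
split; [by rewrite mulr_gt0 ?powR_gt0|by rewrite mulr_gt0 ?exprn_gt0|].
case=> r eta r0 etaC; set n := Normc.normc _ => nR; move: r0 etaC => /= r0 etaC.
pose lam := r `^ (1 / 6).
have lam0 : 0 < lam by rewrite powR_gt0.
have lam2 : lam ^+ 2 = r `^ (1 / 3).
  by rewrite -powR_mulrn ?ltW// -powRrM; congr (_ `^ _); field.
have lam6 : lam ^+ 6 = r.
  rewrite -powR_mulrn ?ltW// -powRrM (_ : 1 / 6 * 6%:R = 1) ?powRr1 ?ltW//.
  by field.
rewrite -lam2 in etaC.
have n_le : n <= r + C0 * lam ^+ 2.
  rewrite /n /=; apply: (@le_trans _ _ (r + `|eta|)); last by rewrite lerD2l.
  rewrite -[leRHS]ger0_norm; last by rewrite addr_ge0// ltW.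
  rewrite -sqrtr_sqr ler_wsqrtr//.
  rewrite sqrrD real_normK ?num_real// lerD2r lerDl.
  by rewrite mulrn_wge0// mulr_ge0// ltW.
have lamT : 1 + `|T| <= lam.
  rewrite leNgt; apply/negP => lamT.
  have : n < (1 + C0) * (1 + `|T|) ^+ 6.
    apply: le_lt_trans n_le _; rewrite mulrDl mul1r -{1}lam6 ltr_leD//.
      by rewrite ltrXn2r// ?nnegrE// ltW.
    rewrite ler_wpM2l//; first exact: ltW.
    apply: (@le_trans _ _ ((1 + `|T|) ^+ 2)).
      by rewrite lerXn2r// ?nnegrE// ltW.
    by rewrite ler_weXn2l.
  by rewrite ltNge nR.
have lam1 : 1 <= lam by exact: le_trans lamT.
have thr : T <= lam ^+ 4.
  apply: (@le_trans _ _ lam); last by rewrite ler_eXnr.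
  by apply: le_trans lamT; rewrite (le_trans (ler_norm _))// lerDr.
rewrite -lam6; split.
  exact: (resolvent_set_oscillator c10 c20 C0_gt0 lam1 thr etaC).
apply: le_trans (resolvent_norm_oscillator c10 c20 C0_gt0 lam1 thr etaC) _.
have n0 : 0 < n.
  by apply: lt_le_trans nR; rewrite mulr_gt0// exprn_gt0.
rewrite lee_fin powRN ler_pdivlMr ?powR_gt0// mulrAC.
rewrite ler_pdivrMr ?exprn_gt0// -mulrA.
apply: ler_pM; rewrite ?sqrtr_ge0 ?powR_ge0// ?lerDl//.
rewrite lam2 -powRM ?(ltW C1) ?(ltW r0)//.
apply: ge0_ler_powR; rewrite ?nnegrE ?(ltW n0) ?divr_ge0//.
  by rewrite mulr_ge0// ltW.
apply: le_trans n_le _; rewrite mulrDl mul1r lerD2l ler_pM2l//.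
by rewrite -lam6 ler_weXn2l.
Qed.
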